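(* Let $t_0>0$ and let $\psi:[t_0,\infty)\to(0,\infty)$ be a differentiable function satisfying $$\int_{t_0}^\infty \frac{dt}{\psi(t)}=\infty$$ and $$1\le \frac{t\psi'(t)}{\psi(t)}\le L\qquad (t\ge t_0)$$ for some constant $L$ with $1<L<\frac65$. Then there exists an entire function $f$ which has exactly one direct tract $D$ such that if $r$ is sufficiently large and $|z|=r$, then the disk of radius $r/\sqrt{\psi(a(r,f,D))}$ around $z$ contains a zero of $f$.
   Context: Direct tract: Let $D$ be an unbounded domain in $\mathbb{C}$ whose boundary consists of piecewise smooth curves, and suppose that the complement of $D$ is unbounded. Let $f$ be a complex-valued function whose domain of definition contains the closure $\overline{D}$ of $D$. Then $D$ is called a direct tract of $f$ if $f$ is holomorphic in $D$ and continuous in $\overline{D}$ and there exists $R>0$ such that $|f(z)|=R$ for $z\in\partial D$ while $|f(z)|>R$ for $z\in D$. ''Exactly one direct tract'' is understood for a given value of $R$: for each $R>0$ there is exactly one domain $D$ which is a direct tract of $f$ with this value of $R$ (changing $R$ changes the set $D$). When this holds for an entire $f$, $a(r,f,D)$ for large $r$ does not depend on the chosen $R$. For $r>0$ such that $D$ meets the circle $|z|=r$ (this is the case for all large $r$), put $M(r,f,D):=\max_{|z|=r,\,z\in D}|f(z)|$. The function $\log M(r,f,D)$ is convex in $\log r$, and $a(r,f,D)$ denotes the right derivative of $\log M(r,f,D)$ with respect to $\log r$. It is nondecreasing in $r$, and it is known that $a(r,f,D)\to\infty$ as $r\to\infty$, so $\psi(a(r,f,D))$ is defined for all large $r$. 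*)

(* Defs.v *)
From mathcomp Require Import all_boot all_order all_algebra.
From mathcomp Require Export complex.
From mathcomp Require Import all_classical all_reals all_analysis.
Set Implicit Arguments.
Unset Strict Implicit.
Unset Printing Implicit Defensive.
Import Order.TTheory GRing.Theory Num.Theory.
Import numFieldNormedType.Exports.
Local Open Scope classical_set_scope.
Local Open Scope ring_scope.

(* The complex plane is [R[i]^o], i.e. [R[i]] as a normed module over itself.
   Its library norm takes values in [R[i]]; [cmod] is the same modulus with
   values in [R]. *)
Notation Cplane R := (R[i]^o)%type (only parsing).

Definition cmod (R : realType) (z : Cplane R) : R := complex.Re `|z|.

(* The scalars of [Cplane R] are complex, so derivability in the direction 1 is
   complex differentiability. *)
Definition holomorphic_at (R : realType) (f : Cplane R -> Cplane R)
    (z : Cplane R) : Prop :=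
  derivable f z 1.

Definition entire (R : realType) (f : Cplane R -> Cplane R) : Prop :=
  forall z, holomorphic_at f z.

(* Derivatives at points of an interval [I], one-sided at its end points. *)
Definition is_derive_within (R : realType) (I : set R) (u : R -> R) (t l : R) :
    Prop :=
  (u s - u t) / (s - t) @[s --> within I t^'] --> l.

Definition is_curve_derive_within (R : realType) (I : set R)
    (g : R -> Cplane R) (t : R) (l : Cplane R) : Prop :=
  ((g s - g t) / (real_complex R (s - t)) : Cplane R) @[s --> within I t^'] --> l.

Definition smooth_on (R : realType) (a b : R) (g : R -> Cplane R) : Prop :=
  exists dg : R -> Cplane R,
    {within `[a, b], continuous dg} /\
    (forall t, t \in `[a, b] ->
       is_curve_derive_within `[a, b] g t (dg t) /\ dg t != 0).

Definition piecewise_smooth_curve (R : realType) (g : R -> Cplane R) : Prop :=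
  {within `[0, 1], continuous g} /\
  exists2 B : set R, finite_set B &
    forall a b : R, 0 <= a -> a < b -> b <= 1 ->
      `]a, b[ `&` B = set0 -> smooth_on a b g.

(* Unbounded curves are allowed: they are cut into countably many compact
   ones, only finitely many of which meet a given disk. *)
Definition consists_of_piecewise_smooth_curves (R : realType)
    (A : set (Cplane R)) : Prop :=
  exists (N : set nat) (g : nat -> R -> Cplane R),
    [/\ forall n, N n -> piecewise_smooth_curve (g n),
        A = \bigcup_(n in N) (g n @` `[0, 1]) &
        forall r : R,
          finite_set [set n | N n /\
                      exists2 t, t \in `[0, 1] & cmod (g n t) <= r]].

Definition boundary (T : topologicalType) (A : set T) : set T :=
  closure A `\` interior A.

(* [D] is a direct tract of [f] with the value [rho]. *)
Definition direct_tract (R : realType) (f : Cplane R -> Cplane R) (rho : R)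
    (D : set (Cplane R)) : Prop :=
  [/\ [/\ open D, connected D & ~ bounded_set D],
      consists_of_piecewise_smooth_curves (boundary D),
      ~ bounded_set (~` D),
      (forall z, D z -> holomorphic_at f z) /\
        {within closure D, continuous f} &
      [/\ 0 < rho, forall z, boundary D z -> cmod (f z) = rho &
          forall z, D z -> rho < cmod (f z)]].

Definition has_exactly_one_direct_tract (R : realType)
    (f : Cplane R -> Cplane R) : Prop :=
  forall rho : R, 0 < rho -> exists! D, direct_tract f rho D.

(* M(r, f, D): a maximum as soon as the circle |z| = r meets the tract [D],
   since |f| is smallest on the boundary of [D]. *)
Definition max_modulus (R : realType) (r : R) (f : Cplane R -> Cplane R)
    (D : set (Cplane R)) : R :=
  sup [set cmod (f z) | z in [set z | cmod z = r /\ D z]].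

(* a(r, f, D): right derivative of x |-> log M(e^x, f, D) at x = log r.
   The limit exists for large r because log M(e^x, f, D) is convex in x. *)
Definition growth_slope (R : realType) (r : R) (f : Cplane R -> Cplane R)
    (D : set (Cplane R)) : R :=
  let u x := ln (max_modulus (expR x) f D) in
  lim ((u (ln r + h) - u (ln r)) / h @[h --> 0^'+]).

(* Main.v *)
Require Import Defs.
From mathcomp Require Import all_boot all_order all_algebra.
From mathcomp Require Import all_classical all_reals all_analysis.
From mathcomp Require Import measurable_realfun.
From mathcomp Require Import ring lra zify.
From Stdlib Require List.
Import Order.TTheory GRing.Theory Num.Theory.
Import numFieldNormedType.Exports.
Local Open Scope classical_set_scope.
Local Open Scope ring_scope.
Set Implicit Arguments.
Unset Strict Implicit.
Unset Printing Implicit Defensive.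

(* The function is f(z) = prod_k (1 + (z / r_k)^(n_k)) with log r_k = 4 sum_(j<k) 1/n_j,
   so that the circle |z| = r_k carries n_k equally spaced zeros and consecutive
   circles are at logarithmic distance 4/n_k: every z with r_k <= |z| <= r_(k+1) is
   within 12 |z| / n_k of a zero.  The coefficients of f are nonnegative, hence
   |f(z)| <= f(|z|).

   On the circles |z| = r_k exp(2/n_k) the k-th factor dominates and |f| tends to
   infinity along them.  A direct tract contains every connected subset of
   {|f| > rho} that it meets; being unbounded and connected it meets such a circle,
   hence contains it, and then it contains a half-line [X, oo).  So two direct tracts
   with the same rho coincide, and M(r, f, D) = f(r).  Therefore a(r, f, D) is the
   logarithmic derivative of f on the half-line, which is comparable to
   n_0 + ... + n_k when r_k <= r < r_(k+1).  Conversely, the component of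
   {|f| > rho} containing one of these circles is a direct tract: near a boundary
   point p one has f(p + w) = f(p) (1 + w^m g(w)) with g(0) <> 0, and in polar
   coordinates the implicit function theorem turns {|f| = rho} into finitely many
   smooth arcs; compactness of the disks gives the locally finite family of curves.

   Put S_k = N_0 + n_0 + ... + n_(k-1).  If n_k <= S_k for all k then a <= 8 S_k, so
   it remains to have 12 sqrt(psi(8 S_k)) < n_k; take n_k ~ C sqrt(psi(8 S_k)).  As
   psi(t) / t is nondecreasing and psi(t)^2 / t^3 nonincreasing, n_k is at least of
   order sqrt(S_k) and at most S_k if N_0 is large.  Moreover the integral of 1/psi
   over [8 S_k, 8 S_(k+1)] is at most 8 n_k / psi(8 S_k), which is comparable to 1/n_k;
   so sum_k 1/n_k diverges and r_k tends to infinity. *)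

(** * The modulus and polar coordinates *)

(** The gap 4 in log r_k leaves 2 on either side of the intermediate circles. There the factors up
    to the k-th have modulus at least exp(2) - 1 >= 3, and the later ones tend to 1 so fast that
    their product is at least 2/3. Later factors also enter the logarithmic derivative, weighted by
    their degrees: n_k <= S_k lets degree sums at most double at each step, and the weights decay
    like 4^(-d), so they contribute at most as much again as the main term.

    The delicate part of the tract definition is the boundary. Where f' vanishes the level set
    branches, and D may occupy only some of the sectors at such a point, so the level arcs bordering
    D have to be singled out. The radius is the parameter: every arc then leaves the branch point
    with nonzero speed. An arc is kept when a point on its side {|f| > rho} lies in D; absorption
    then puts that whole side into D.

    The product is rewritten as a power series because recentring at a boundary point and the order
    of vanishing there are needed. Limits are mostly replaced by explicit errors C / 2^N, so that
    rearrangements become finite identities plus an error. *)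

Section ComplexModulus.
Variable R : realType.
Implicit Types (x y : R) (z w : Cplane R).

Lemma normc_cmod z : `|z| = (cmod z)%:C%C.
Proof. by rewrite /cmod normc_def. Qed.

Lemma cmodE z : cmod z = Num.sqrt (complex.Re z ^+ 2 + complex.Im z ^+ 2).
Proof. by rewrite /cmod normc_def. Qed.

Lemma cmod_ge0 z : 0 <= cmod z.
Proof. by rewrite -lecR -normc_cmod normr_ge0. Qed.

Lemma cmod0 : cmod (0 : Cplane R) = 0.
Proof. by rewrite /cmod normr0. Qed.

Lemma cmod1 : cmod (1 : Cplane R) = 1.
Proof. by rewrite /cmod normr1. Qed.

Lemma cmodM z w : cmod (z * w) = cmod z * cmod w.
Proof.
by apply: (@complexI R); rewrite rmorphM /= -!normc_cmod -normrM.
Qed.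

Lemma cmodN z : cmod (- z) = cmod z.
Proof. by rewrite /cmod normrN. Qed.

Lemma cmod_distC z w : cmod (z - w) = cmod (w - z).
Proof. by rewrite -cmodN opprB. Qed.

Lemma cmodX z n : cmod (z ^+ n) = cmod z ^+ n.
Proof.
elim: n => [|n IH]; first by rewrite !expr0 cmod1.
by rewrite !exprS cmodM IH.
Qed.

Lemma cmodV z : cmod (z^-1) = (cmod z)^-1.
Proof.
by apply: (@complexI R); rewrite fmorphV /= -!normc_cmod normfV.
Qed.

Lemma cmod_triangle z w : cmod (z + w) <= cmod z + cmod w.
Proof. by rewrite -lecR rmorphD /= -!normc_cmod ler_normD. Qed.

Lemma cmod_triangleB z w : cmod (z - w) <= cmod z + cmod w.
Proof. by rewrite -(cmodN w) cmod_triangle. Qed.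

Lemma cmod_sub_le z w : cmod z - cmod w <= cmod (z - w).
Proof. by rewrite lerBlDr -{1}(subrK w z) cmod_triangle. Qed.

Lemma cmod_dist_le z w : `|cmod z - cmod w| <= cmod (z - w).
Proof.
by rewrite ler_norml cmod_sub_le andbT lerNl opprB cmod_distC cmod_sub_le.
Qed.

Lemma cmod_real x : cmod (x%:C%C : Cplane R) = `|x|.
Proof. by rewrite cmodE /= expr0n addr0 sqrtr_sqr. Qed.

Lemma cmod_eq0 z : (cmod z == 0) = (z == 0).
Proof. by rewrite -(normr_eq0 z) normc_cmod (inj_eq (@complexI R) _ 0). Qed.

Lemma cmod_gt0 z : (0 < cmod z) = (z != 0).
Proof. by rewrite lt_def cmod_ge0 andbT cmod_eq0. Qed.

Lemma cmod_Re z : `|complex.Re z| <= cmod z.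
Proof. by rewrite cmodE -[leLHS]sqrtr_sqr ler_wsqrtr // lerDl sqr_ge0. Qed.

Lemma cmod_Im z : `|complex.Im z| <= cmod z.
Proof. by rewrite cmodE -[leLHS]sqrtr_sqr ler_wsqrtr // lerDr sqr_ge0. Qed.

Lemma cmod_le_ReIm z : cmod z <= `|complex.Re z| + `|complex.Im z|.
Proof.
rewrite cmodE -[leRHS]ger0_norm ?addr_ge0// -sqrtr_sqr ler_wsqrtr//.
by rewrite -(real_normK (num_real (complex.Re z)))
           -(real_normK (num_real (complex.Im z))) sqrrD addrAC lerDl
           mulrn_wge0 ?mulr_ge0.
Qed.

Lemma cmod_sum (I : Type) (r : seq I) (P : pred I) (F : I -> Cplane R) :
  cmod (\sum_(i <- r | P i) F i) <= \sum_(i <- r | P i) cmod (F i).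
Proof.
elim/big_ind2: _ => //; first by rewrite cmod0.
by move=> a b c d ab cd; rewrite (le_trans (cmod_triangle _ _))// lerD.
Qed.

Lemma cmod_prod (I : Type) (r : seq I) (P : pred I) (F : I -> Cplane R) :
  cmod (\prod_(i <- r | P i) F i) = \prod_(i <- r | P i) cmod (F i).
Proof. by apply: (big_morph _ cmodM cmod1). Qed.

(** Balls of [Cplane R] have radii in [R[i]], but positivity in [R[i]] forces the radius to be real.
    All later epsilon arguments can therefore be carried out in [R]. *)
Lemma nbhs_cmodP z (A : set (Cplane R)) :
  nbhs z A <-> exists2 e : R, 0 < e & forall w, cmod (w - z) < e -> A w.
Proof.
split.
  move=> /nbhs_ballP[e /= e0 eA].
  have er : (complex.Re e)%:C%C = e by rewrite RRe_real// gtr0_real.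
  exists (complex.Re e); first by rewrite -ltcR er.
  move=> w we; apply: eA; rewrite -ball_normE /ball_/= -er.
  by rewrite normc_cmod ltcR cmod_distC.
move=> [e e0 eA]; apply/nbhs_ballP; exists e%:C%C => /=.
  by rewrite ltcR.
move=> w; rewrite -ball_normE /ball_/= normc_cmod ltcR => we.
by apply: eA; rewrite cmod_distC.
Qed.

Lemma ccvgP (T : Type) (F : set_system T) (FF : Filter F) (f : T -> Cplane R)
    (l : Cplane R) :
  (f x @[x --> F] --> l) <->
  (forall e : R, 0 < e -> \forall x \near F, cmod (f x - l) < e).
Proof.
split=> H.
  move=> e e0; apply: (H [set w | cmod (w - l) < e]).
  by apply/nbhs_cmodP; exists e.
move=> A /nbhs_cmodP[e e0 eA]; rewrite /nbhs/=.
by apply: filterS (H e e0) => x; exact: eA.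
Qed.

Lemma ccvgM (T : Type) (F : set_system T) (FF : Filter F)
    (f g : T -> Cplane R) (a b : Cplane R) :
  f x @[x --> F] --> a -> g x @[x --> F] --> b ->
  (f x * g x : Cplane R) @[x --> F] --> (a * b : Cplane R).
Proof. exact: (@cvgM R[i] T F FF f g a b). Qed.

Lemma ccvgD (T : Type) (F : set_system T) (FF : Filter F)
    (f g : T -> Cplane R) (a b : Cplane R) :
  f x @[x --> F] --> a -> g x @[x --> F] --> b ->
  (f x + g x : Cplane R) @[x --> F] --> (a + b : Cplane R).
Proof. exact: (@cvgD R[i] (R[i]^o) T F FF f g a b). Qed.

Lemma ccvg_cst (T : Type) (F : set_system T) (FF : Filter F) (a : Cplane R) :
  (fun _ : T => a) x @[x --> F] --> a.
Proof. exact: (@cvg_cst (R[i]^o) a T F FF). Qed.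

Lemma ccvg_nbhsP (f : Cplane R -> Cplane R) z (l : Cplane R) :
  (f w @[w --> z] --> l) <->
  forall e : R, 0 < e ->
    exists2 d : R, 0 < d & forall w, cmod (w - z) < d -> cmod (f w - l) < e.
Proof.
rewrite (ccvgP (nbhs_filter z)); split=> H e e0.
  by have /nbhs_cmodP := H e e0.
by apply/nbhs_cmodP; exact: H.
Qed.

Lemma continuous_cmod : continuous (@cmod R).
Proof.
move=> z; apply/(@cvgrPdist_lt _ R^o _ _ (nbhs_filter z)) => e e0.
rewrite near_simpl; apply/nbhs_cmodP; exists e => // w we.
by rewrite (le_lt_trans (cmod_dist_le _ _))// cmod_distC.
Qed.

Lemma ccvg_ReIm (T : Type) (F : set_system T) (FF : Filter F)
    (f : T -> Cplane R) (l : Cplane R) :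
  complex.Re (f x) @[x --> F] --> complex.Re l ->
  complex.Im (f x) @[x --> F] --> complex.Im l ->
  f x @[x --> F] --> l.
Proof.
move=> /cvgrPdist_lt hR /cvgrPdist_lt hI; apply/ccvgP => e e0.
have e20 : 0 < e / 2 by rewrite divr_gt0.
near=> x; rewrite cmod_distC (le_lt_trans (cmod_le_ReIm _))// [ltRHS]splitr.
by rewrite !raddfB ltrD//; near: x; [exact: hR|exact: hI].
Unshelve. all: by end_near. Qed.

Lemma ccvg_Re (T : Type) (F : set_system T) (FF : Filter F)
    (f : T -> Cplane R) (l : Cplane R) :
  f x @[x --> F] --> l -> complex.Re (f x) @[x --> F] --> complex.Re l.
Proof.
move=> /ccvgP h; apply/cvgrPdist_lt => e e0; near=> x.
rewrite -raddfB (le_lt_trans (cmod_Re _))// cmod_distC.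
by near: x; exact: h.
Unshelve. all: by end_near. Qed.

Lemma ccvg_Im (T : Type) (F : set_system T) (FF : Filter F)
    (f : T -> Cplane R) (l : Cplane R) :
  f x @[x --> F] --> l -> complex.Im (f x) @[x --> F] --> complex.Im l.
Proof.
move=> /ccvgP h; apply/cvgrPdist_lt => e e0; near=> x.
rewrite -raddfB (le_lt_trans (cmod_Im _))// cmod_distC.
by near: x; exact: h.
Unshelve. all: by end_near. Qed.

Lemma bounded_cmodP (A : set (Cplane R)) :
  bounded_set A <-> exists M : R, forall z, A z -> cmod z <= M.
Proof.
split.
  move=> [M [Mr HM]].
  exists (complex.Re M + 1) => z Az.
  have := HM (complex.Re M + 1)%:C%C; rewrite -lecR -normc_cmod; apply=> //.
  by rewrite -{1}(RRe_real Mr) ltcR ltrDl.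
move=> [M HM]; exists M%:C%C; split.
  by apply/complex_realP; exists M.
move=> x /ltW Mx z Az; apply: le_trans Mx; rewrite normc_cmod lecR.
exact: HM.
Qed.

Lemma cmod_sqr z : cmod z ^+ 2 = complex.Re z ^+ 2 + complex.Im z ^+ 2.
Proof. by rewrite cmodE sqr_sqrtr// addr_ge0 ?sqr_ge0. Qed.

End ComplexModulus.

Section Polar.
Variable R : realType.
Implicit Types (a b : R) (z u : Cplane R).

Definition cis a : Cplane R := (cos a +i* sin a)%C.

Lemma cisD a b : cis (a + b) = cis a * cis b.
Proof.
by rewrite /cis cosD sinD; congr (_ +i* _)%C; rewrite addrC [sin a * _]mulrC.
Qed.

Lemma cis0 : cis 0 = 1.
Proof. by rewrite /cis cos0 sin0. Qed.

Lemma cmod_cis a : cmod (cis a) = 1.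
Proof. by rewrite cmodE /= cos2Dsin2 sqrtr1. Qed.

Lemma cis_neq0 a : cis a != 0.
Proof. by rewrite -cmod_eq0 cmod_cis oner_eq0. Qed.

Lemma cisX a n : cis a ^+ n = cis (n%:R * a).
Proof.
elim: n => [|n IH]; first by rewrite expr0 mul0r cis0.
by rewrite exprS IH -cisD mulrSr mulrDl mul1r addrC.
Qed.

Lemma abs_deriv_le (f df : R -> R) (M a b : R) :
  (forall x : R, is_derive x 1 f (df x)) -> (forall x, `|df x| <= M) ->
  `|f a - f b| <= M * `|a - b|.
Proof.
move=> fd dM; wlog ab : a b / b <= a.
  move=> W; have [/W//|/ltW/W] := leP b a.
  by rewrite distrC [X in _ * X]distrC.
have [c _ ->] : exists2 c, c \in `[b, a] & f a - f b = df c * (a - b).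
  apply: MVT_segment => //; apply: continuous_subspaceT => y.
  by apply: differentiable_continuous; apply/derivable1_diffP; case: (fd y).
by rewrite normrM ler_wpM2r.
Qed.

Lemma cos_lipschitz a b : `|cos a - cos b| <= `|a - b|.
Proof.
rewrite -[leRHS]mul1r; apply: (abs_deriv_le (df := fun x => - sin x)) => x.
by rewrite normrN ler_norml sin_geN1 sin_le1.
Qed.

Lemma sin_lipschitz a b : `|sin a - sin b| <= `|a - b|.
Proof.
rewrite -[leRHS]mul1r; apply: (abs_deriv_le (df := cos)) => x.
by rewrite ler_norml cos_geN1 cos_le1.
Qed.

Lemma cis_lipschitz a b : cmod (cis a - cis b) <= 2 * `|a - b|.
Proof.
rewrite (le_trans (cmod_le_ReIm _))//= mulr_natl mulr2n.
by rewrite lerD ?cos_lipschitz ?sin_lipschitz.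
Qed.

Lemma atan_le v : `|atan v| <= `|v : R|.
Proof.
rewrite -[v in leRHS]subr0 -[atan v]subr0 -{1}(atan0 R) -[leRHS]mul1r.
apply: (abs_deriv_le (df := fun x => (1 + x ^+ 2)^-1)) => x.
have h : 1 <= 1 + x ^+ 2 by rewrite lerDl sqr_ge0.
by rewrite ger0_norm ?invr_ge0 ?invf_le1 ?(le_trans ler01 h) ?(lt_le_trans ltr01 h).
Qed.

(** The angle is [acos (Re z / |z|)] with the sign of [Im z]. Its range is compact, which later
    allows all directions to be covered by finitely many intervals. *)
Lemma polar z : exists2 a, `|a| <= pi & z = (cmod z)%:C%C * cis a.
Proof.
have [->|z0] := eqVneq z 0.
  by exists 0; rewrite ?normr0 ?pi_ge0// cmod0 mul0r.
have c0 : 0 < cmod z by rewrite cmod_gt0.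
set x := complex.Re z / cmod z.
have x1 : -1 <= x <= 1.
  by rewrite -ler_norml normrM normfV (gtr0_norm c0) ler_pdivrMr// mul1r cmod_Re.
have ca : cos (acos x) = x by rewrite acosK// in_itv.
have xE : x * cmod z = complex.Re z by rewrite divfK// gt_eqF.
have sa : sin (acos x) * cmod z = `|complex.Im z|.
  rewrite sin_acos// -[cmod z in LHS](ger0_norm (cmod_ge0 z)) -sqrtr_sqr.
  rewrite -sqrtrM ?subr_ge0 ?sqr_le1// -?sqrtr_sqr; last first.
    by case/andP: x1 => ? ?; rewrite expr2; nra.
  congr Num.sqrt; rewrite mulrBl mul1r -exprMn xE cmod_sqr; ring.
have a0 := acos_ge0 x1; have api := acos_lepi x1.
have [i0|i0] := leP 0 (complex.Im z).
  exists (acos x); first by rewrite ger0_norm.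
  rewrite /cis ca.
  apply/eqP; rewrite eq_complex /= !mul0r subr0 addr0.
  by rewrite mulrC xE eqxx /= mulrC sa ger0_norm.
exists (- acos x); first by rewrite normrN ger0_norm.
rewrite /cis cosN sinN ca.
apply/eqP; rewrite eq_complex /= !mul0r subr0 addr0.
by rewrite mulrC xE eqxx /= mulrN mulrC sa ltr0_norm ?opprK.
Qed.

(** Here Re u > 1/2, so [atan (Im u / Re u)] is an argument of [u] and is at most |Im u| / Re u <= 2
    |u - 1|. Unlike in [polar], the angle is small when [u] is close to 1; this converts closeness
    of points into closeness of angles. *)
Lemma polar_near1 u : cmod (u - 1) < 1 / 2 ->
  exists2 b, `|b| <= 2 * cmod (u - 1) & u = (cmod u)%:C%C * cis b.
Proof.
move=> u1; set x := complex.Re u; set y := complex.Im u.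
have x2 : 1 / 2 < x.
  have := le_lt_trans (cmod_Re _) u1; rewrite raddfB /= -/x ltr_norml.
  by move=> /andP[? _]; lra.
have yu : `|y| <= cmod (u - 1).
  by have := cmod_Im (u - 1); rewrite raddfB /= subr0.
have x0 : 0 < x by apply: lt_trans x2; rewrite divr_gt0.
have cE : cmod u * (Num.sqrt (1 + (y / x) ^+ 2))^-1 = x.
  have -> : cmod u = x * Num.sqrt (1 + (y / x) ^+ 2).
    have -> : x * Num.sqrt (1 + (y / x) ^+ 2) =
        Num.sqrt (x ^+ 2) * Num.sqrt (1 + (y / x) ^+ 2).
      by rewrite sqrtr_sqr (gtr0_norm x0).
    rewrite -sqrtrM ?sqr_ge0// cmodE.
    congr Num.sqrt; rewrite -/x -/y; move: (x) (y) x0 => x' y' x'0. by field; rewrite gt_eqF.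
  by rewrite mulfK// gt_eqF// sqrtr_gt0 ltr_pwDl// sqr_ge0.
exists (atan (y / x)).
  rewrite (le_trans (atan_le _))// normrM normfV (gtr0_norm x0).
  by rewrite ler_pdivrMr//; have := normr_ge0 y; nra.
have cx : cos (atan (y / x)) = (Num.sqrt (1 + (y / x) ^+ 2))^-1 by exact: cos_atan.
have sx : sin (atan (y / x)) = y / x * cos (atan (y / x)).
  have := atanK (y / x); rewrite /tan => {2}<-.
  by rewrite divfK// cx gt_eqF// invr_gt0 sqrtr_gt0 ltr_pwDl// sqr_ge0.
rewrite /cis sx cx; apply/eqP; rewrite eq_complex /= !mul0r subr0 addr0.
by rewrite mulrCA !cE eqxx divfK ?eqxx// gt_eqF.
Qed.

Lemma continuous_cis : continuous cis.
Proof.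
move=> a; apply/ccvgP => e e0.
have e2 : 0 < e / 2 by rewrite divr_gt0.
apply: filterS (nbhsx_ballx a _ e2) => x; rewrite /ball/= distrC => xa.
by rewrite (le_lt_trans (cis_lipschitz _ _))// mulrC -ltr_pdivlMr.
Qed.

End Polar.

(** * Power series with infinite radius of convergence *)

Section PowerSeries.
Variable R : realType.
Implicit Types (c d : nat -> Cplane R) (z w p : Cplane R).

Definition csum d n : Cplane R := \sum_(i < n) d i.

Lemma csum0 d : csum d 0 = 0.
Proof. by rewrite /csum big_ord0. Qed.

Lemma csumS d n : csum d n.+1 = csum d n + d n.
Proof. by rewrite /csum big_ord_recr. Qed.

(** Taken componentwise, to rely on the completeness of [R] only; it is meaningful for the
    geometrically dominated sums below. *)
Definition clim (u : nat -> Cplane R) : Cplane R :=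
  (limn (fun n => complex.Re (u n)) +i* limn (fun n => complex.Im (u n)))%C.

(** The device that replaces passages to the limit: a quantity with an error bound K / 2^n for every
    n. *)
Lemma le_geo_le0 (x K : R) : (forall n, x <= K / 2 ^+ n) -> x <= 0.
Proof.
move=> H.
have cv : (K / 2 ^+ n) @[n --> \oo] --> (0 : R).
  rewrite -(mulr0 K); apply: cvgM; first exact: cvg_cst.
  under eq_fun do rewrite -exprVn.
  by apply: cvg_expr; rewrite ger0_norm ?invr_ge0// invf_lt1// ltr1n.
rewrite -(cvg_lim _ cv)//; apply: limr_ge; first by apply/cvg_ex; exists 0.
by apply: nearW => n; exact: H.
Qed.

(** The bound is a difference of geometric tails rather than the first tail alone, so that the
    induction telescopes. *)
Lemma csum_tail_le d (M : R) (N K : nat) : (forall n, cmod (d n) <= M / 2 ^+ n) ->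
  (N <= K)%N -> cmod (csum d K - csum d N) <= 2 * M / 2 ^+ N - 2 * M / 2 ^+ K.
Proof.
move=> dM /subnKC <-; elim: (K - N)%N => [|k IH].
  by rewrite addn0 !subrr cmod0.
rewrite addnS csumS addrAC.
apply: (le_trans (cmod_triangle _ _)).
apply: (le_trans (lerD IH (dM _))); rewrite exprS.
have : 2 ^+ (N + k) != 0 :> R by rewrite expf_neq0// pnatr_eq0.
have : 2 ^+ N != 0 :> R by rewrite expf_neq0// pnatr_eq0.
move: (2 ^+ (N + k)) (2 ^+ N) => a b b0 a0.
by rewrite le_eqVlt; apply/orP; left; apply/eqP; field; rewrite a0 b0.
Qed.

Lemma csum_clim d (M : R) : (forall n, cmod (d n) <= M / 2 ^+ n) ->
  forall N, cmod (clim (csum d) - csum d N) <= 2 * M / 2 ^+ N.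
Proof.
move=> dM.
have M0 : 0 <= M by have := dM 0%N; rewrite expr0 divr1; apply/le_trans/cmod_ge0.
have geo : cvgn (series (fun n => M / 2 ^+ n)).
  have -> : (fun n => M / 2 ^+ n) = geometric M 2^-1.
    by apply/funext => n; rewrite /geometric/= exprVn.
  by apply: is_cvg_geometric_series; rewrite ger0_norm ?invr_ge0// invf_lt1// ltr1n.
have aux (g : Cplane R -> R) : (forall z, `|g z| <= cmod z) ->
    (forall a b, g (a + b) = g a + g b) -> g 0 = 0 ->
    cvgn (fun n => g (csum d n)).
  move=> gz gD g0.
  have -> : (fun n => g (csum d n)) = series (fun n => g (d n)).
    apply/funext; elim=> [|n IH]; first by rewrite /csum/= big_ord0 seriesEord/= big_ord0.
    by rewrite /csum big_ord_recr/= gD IH seriesEnat/= big_nat_recr.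
  apply: normed_cvg; apply: series_le_cvg geo => n //=.
    by rewrite divr_ge0// exprn_ge0.
  by rewrite (le_trans (gz _)).
have cv : csum d n @[n --> \oo] --> clim (csum d).
  apply: ccvg_ReIm => /=.
    by apply: (aux (@complex.Re R) (@cmod_Re R)) => //; exact: raddfD.
  by apply: (aux (@complex.Im R) (@cmod_Im R)) => //; exact: raddfD.
move=> N; apply/ler_addgt0Pr => e e0.
move/ccvgP : cv => /(_ e e0) [K _ HK].
have := HK (maxn K N) (leq_maxl _ _).
have := csum_tail_le dM (leq_maxr K N).
move: (csum d (maxn K N)) => s h1 h2.
have -> : clim (csum d) - csum d N = (s - csum d N) - (s - clim (csum d)).
  by ring.
rewrite (le_trans (cmod_triangleB _ _))// lerD//; last exact: ltW.
by rewrite (le_trans h1)// gerBl divr_ge0 ?mulr_ge0// exprn_ge0.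
Qed.

Lemma csum_clim_eq d (M K : R) l : (forall n, cmod (d n) <= M / 2 ^+ n) ->
  (forall N, cmod (l - csum d N) <= K / 2 ^+ N) -> clim (csum d) = l.
Proof.
move=> dM lK; apply/eqP; rewrite -subr_eq0 -cmod_eq0.
rewrite eq_le cmod_ge0 andbT; apply: (@le_geo_le0 _ (2 * M + K)) => N.
have -> : clim (csum d) - l = (clim (csum d) - csum d N) - (l - csum d N).
  by rewrite opprB addrA subrK.
by rewrite (le_trans (cmod_triangleB _ _))// mulrDl lerD// csum_clim.
Qed.

(** Infinite radius of convergence stated as boundedness: applied to 2 rho, it dominates the terms
    on |z| <= rho by M / 2^n. *)
Definition entire_seq c := forall rho : R, 0 <= rho ->
  exists M, forall n, cmod (c n) * rho ^+ n <= M.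

Definition ev c z := clim (csum (fun n => c n * z ^+ n)).

Lemma entire_seq_geo c (rho : R) : entire_seq c -> 0 <= rho ->
  exists2 M, 0 <= M &
    forall z, cmod z <= rho -> forall n, cmod (c n * z ^+ n) <= M / 2 ^+ n.
Proof.
move=> cE r0; have [M HM] := cE (2 * rho) (mulr_ge0 (ler0n _ _) r0).
exists M; first by have := HM 0%N; apply/le_trans; rewrite expr0 mulr1 cmod_ge0.
move=> z zr n; rewrite ler_pdivlMr ?exprn_gt0// cmodM cmodX -mulrA.
rewrite (le_trans _ (HM n))// ler_wpM2l ?cmod_ge0// mulrC exprMn.
by rewrite ler_wpM2l ?exprn_ge0// lerXn2r ?nnegrE ?cmod_ge0.
Qed.

Lemma ev_tail c (rho : R) : entire_seq c -> 0 <= rho ->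
  exists2 M, 0 <= M & forall z, cmod z <= rho -> forall N,
    cmod (ev c z - csum (fun n => c n * z ^+ n) N) <= M / 2 ^+ N.
Proof.
move=> cE r0; have [M M0 HM] := entire_seq_geo cE r0.
exists (2 * M); first by rewrite mulr_ge0.
by move=> z zr N; apply: csum_clim; apply: HM.
Qed.

Lemma ev_eq c z l (K : R) : entire_seq c ->
  (forall N, cmod (l - csum (fun n => c n * z ^+ n) N) <= K / 2 ^+ N) ->
  ev c z = l.
Proof.
move=> cE; have [M _ HM] := entire_seq_geo cE (cmod_ge0 z).
by apply: csum_clim_eq; apply: HM.
Qed.

Lemma ev_bounded c (rho : R) : entire_seq c -> 0 <= rho ->
  exists2 M, 0 <= M & forall z, cmod z <= rho -> cmod (ev c z) <= M.
Proof.
move=> cE r0; have [M M0 HM] := ev_tail cE r0.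
exists M => // z zr; have := HM z zr 0%N.
by rewrite /csum big_ord0 subr0 expr0 divr1.
Qed.

Lemma entire_seq_shift c k : entire_seq c -> entire_seq (fun n => c (k + n)%N).
Proof.
move=> cE rho r0; have [M HM] := cE (rho + 1) (addr_ge0 r0 ler01).
exists M => n; rewrite (le_trans _ (HM (k + n)%N))// ler_wpM2l ?cmod_ge0//.
have r1 : 1 <= rho + 1 by rewrite lerDr.
apply: (@le_trans _ _ ((rho + 1) ^+ n)).
  by rewrite lerXn2r ?nnegrE ?addr_ge0// lerDl.
by rewrite ler_weXn2l// leq_addl.
Qed.

Lemma ev_shift c z : entire_seq c ->
  ev c z = c 0%N + z * ev (fun n => c n.+1) z.
Proof.
move=> cE; have cE' := entire_seq_shift 1 cE.
have [M M0 HM] := ev_tail cE' (cmod_ge0 z).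
apply: (@ev_eq _ _ _ (cmod (c 0%N + z * ev (fun n => c n.+1) z) +
   2 * cmod z * M)) => // -[|N].
  rewrite /csum big_ord0 subr0 expr0 divr1 lerDl ?mulr_ge0 ?cmod_ge0//.
rewrite /csum big_ord_recl expr0 mulr1 [c 0%N + _]addrC addrKA.
have -> : \sum_(i < N) (c (lift ord0 i)%N * z ^+ lift ord0 i) =
   z * csum (fun n => c n.+1 * z ^+ n) N.
  by rewrite /csum mulr_sumr; apply: eq_bigr => i _; rewrite lift0 exprS mulrCA.
rewrite -mulrBr cmodM.
have := ler_wpM2l (cmod_ge0 z) (HM z (lexx _) N).
move=> /le_trans; apply.
rewrite exprS invfM !mulrA ler_pM2r ?invr_gt0 ?exprn_gt0//.
by rewrite ler_pdivlMr// mulrC mulrA lerDr cmod_ge0.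
Qed.

(** The m-th derivative of [ev c] at [p] divided by m!. *)
Definition taylor c p m := ev (fun i => c (m + i)%N *+ 'C(m + i, m)) p.

Lemma bin_le_exp2 n m : ('C(n, m) <= 2 ^ n)%N.
Proof.
have := expnDn 1 1 n; rewrite addn1 => ->.
have [mn|nm] := leqP m n; last by rewrite bin_small.
have mn1 : (m < n.+1)%N by [].
rewrite (bigD1 (Ordinal mn1)) //= !exp1n mul1n muln1; exact: leq_addr.
Qed.

Lemma cmodMn z n : cmod (z *+ n) = cmod z *+ n.
Proof. by rewrite -mulr_natr cmodM -[cmod z *+ n]mulr_natr -(rmorph_nat (real_complex R)) cmod_real normr_nat. Qed.

(** From 'C(m+i, m) <= 2^(m+i) and |p| <= rho / 4. The bound gives at once the convergence in i and
    the decay of the Taylor coefficients in m. *)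
Lemma taylor_term c p (rho M : R) m i : 0 < rho -> 4 * cmod p <= rho ->
  cmod (c (m + i)%N) * rho ^+ (m + i) <= M ->
  cmod (c (m + i)%N *+ 'C(m + i, m) * p ^+ i) <= M * (2 / rho) ^+ m / 2 ^+ i.
Proof.
move=> r0 pr cM; rewrite cmodM cmodX cmodMn.
have h1 : cmod (c (m + i)%N) <= M / rho ^+ (m + i).
  by rewrite ler_pdivlMr ?exprn_gt0.
have h2 : cmod (c (m + i)%N) *+ 'C(m + i, m) <=
    M / rho ^+ (m + i) * 2 ^+ (m + i).
  rewrite -[leLHS]mulr_natr ler_pM ?cmod_ge0// -natrX ler_nat; exact: bin_le_exp2.
have M0 : 0 <= M.
  by apply: le_trans cM; rewrite mulr_ge0 ?cmod_ge0// exprn_ge0// ltW.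
apply: (@le_trans _ _ (M / rho ^+ (m + i) * 2 ^+ (m + i) * (rho / 4) ^+ i)).
  rewrite ler_pM ?exprn_ge0 ?mulrn_wge0 ?cmod_ge0//=.
  by rewrite lerXn2r ?nnegrE ?cmod_ge0// ?divr_ge0 ?(ltW r0)// ler_pdivlMr// mulrC.
rewrite le_eqVlt; apply/orP; left; apply/eqP.
have -> : (4 : R) = 2 * 2 by rewrite -natrM.
rewrite !exprD !exprMn !exprVn exprMn.
have : rho ^+ m != 0 by rewrite expf_neq0// gt_eqF.
have : rho ^+ i != 0 by rewrite expf_neq0// gt_eqF.
have : 2 ^+ i != 0 :> R by rewrite expf_neq0// pnatr_eq0.
move: (rho ^+ m) (rho ^+ i) (2 ^+ i) (2 ^+ m) => a b e f a0 b0 e0.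
by field; rewrite a0 b0 e0.
Qed.

Lemma entire_seq_binom c m : entire_seq c ->
  entire_seq (fun i => c (m + i)%N *+ 'C(m + i, m)).
Proof.
move=> cE rho r0; set tau := 2 * rho + 1.
have t0 : 0 < tau by rewrite ltr_wpDl// mulr_ge0.
have [M HM] := cE tau (ltW t0).
exists (M * (2 / tau) ^+ m) => n; rewrite cmodMn.
have M0 : 0 <= M.
  by apply: le_trans (HM 0%N); rewrite mulr_ge0 ?cmod_ge0.
apply: (@le_trans _ _ (M / tau ^+ (m + n) * 2 ^+ (m + n) * (tau / 2) ^+ n)).
  rewrite ler_pM ?exprn_ge0 ?mulrn_wge0 ?cmod_ge0//=.
    rewrite -[leLHS]mulr_natr ler_pM ?cmod_ge0//; first by rewrite ler_pdivlMr ?exprn_gt0.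
    by rewrite -natrX ler_nat; exact: bin_le_exp2.
  rewrite lerXn2r ?nnegrE// ?divr_ge0 ?(ltW t0)// ler_pdivlMr// /tau; lra.
rewrite le_eqVlt; apply/orP; left; apply/eqP.
rewrite !exprD !exprMn !exprVn.
have : tau ^+ m != 0 by rewrite expf_neq0// gt_eqF.
have : tau ^+ n != 0 by rewrite expf_neq0// gt_eqF.
have : 2 ^+ n != 0 :> R by rewrite expf_neq0// pnatr_eq0.
move: (tau ^+ m) (tau ^+ n) (2 ^+ n) (2 ^+ m) => a b e f a0 b0 e0.
by field; rewrite a0 b0 e0.
Qed.

Lemma entire_seq_taylor c p : entire_seq c -> entire_seq (taylor c p).
Proof.
(* This radius gives both 4 |p| <= rho, as [taylor_term] requires, and 2 tau / rho <= 1, which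
   absorbs tau^m. *)
move=> cE tau t0; set rho := 2 * tau + 4 * cmod p + 1.
have r0 : 0 < rho by rewrite ltr_wpDl// addr_ge0// mulr_ge0// cmod_ge0.
have [M HM] := cE rho (ltW r0).
have M0 : 0 <= M.
  by apply: le_trans (HM 0%N); rewrite mulr_ge0 ?cmod_ge0.
exists (2 * M) => m.
have pr : 4 * cmod p <= rho by rewrite /rho; lra.
have := csum_clim (fun i => taylor_term r0 pr (HM (m + i)%N)) 0.
rewrite -/(ev (fun i => c (m + i)%N *+ 'C(m + i, m)) p) -/(taylor c p m).
rewrite /csum big_ord0 subr0 expr0 divr1 => h.
apply: (@le_trans _ _ (2 * (M * (2 / rho) ^+ m) * tau ^+ m)).
  by rewrite ler_wpM2r// exprn_ge0.
rewrite -!mulrA ler_wpM2l// ler_piMr// -exprMn exprn_ile1//.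
  by rewrite mulr_ge0// divr_ge0// ltW.
by rewrite mulrAC ler_pdivrMr// mul1r /rho; have := cmod_ge0 p; lra.
Qed.

(** An exact finite identity: truncating the m-th Taylor coefficient at N - m terms makes the
    rearrangement triangular, so no limits are exchanged. *)
Lemma csum_taylor c p w N : csum (fun n => c n * (p + w) ^+ n) N =
  \sum_(m < N) csum (fun i => c (m + i)%N *+ 'C(m + i, m) * p ^+ i) (N - m)
     * w ^+ m.
Proof.
elim: N => [|N IH]; first by rewrite /csum !big_ord0.
rewrite csumS IH.
rewrite exprDn mulr_sumr.
under [X in _ = X]eq_bigr => m _.
  rewrite subSn; last by rewrite -ltnS.
  rewrite csumS mulrDl subnKC; last by rewrite -ltnS.
  over.
rewrite big_split /=; congr (_ + _); last first.
  by apply: eq_bigr => m _; rewrite mulrnAr !mulrnAl mulrA.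
by rewrite big_ord_recr /= subnn csum0 mul0r addr0.
Qed.

(** By [csum_taylor] the two partial sums differ by tails of the coefficient series; the m-th one
    contributes at most 2 M / 2^N * 2^(-m), and the sum over m is a further error of order
    2^(-N). *)
Lemma ev_taylor c p w : entire_seq c -> ev c (p + w) = ev (taylor c p) w.
Proof.
move=> cE; symmetry.
(* The factor 8 makes (2 / rho)^m 2^m |w|^m at most 2^(-m). *)
set rho := 8 * (cmod p + cmod w + 1).
have r0 : 0 < rho by rewrite mulr_gt0// ltr_wpDl// addr_ge0// cmod_ge0.
have [M HM] := cE rho (ltW r0).
have M0 : 0 <= M by apply: le_trans (HM 0%N); rewrite mulr_ge0 ?cmod_ge0.
have pr : 4 * cmod p <= rho.
  by rewrite /rho; have := cmod_ge0 p; have := cmod_ge0 w; lra.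
have wr : cmod w <= rho / 8 by rewrite /rho; have := cmod_ge0 p; lra.
have [K K0 HK] := ev_tail cE (cmod_ge0 (p + w)).
apply: (@ev_eq _ _ _ (K + 4 * M)); first exact: entire_seq_taylor.
move=> N.
have := HK (p + w) (lexx _) N; rewrite csum_taylor.
set s := \sum_(m < N) _ => h.
have -> : ev c (p + w) - csum (fun n => taylor c p n * w ^+ n) N =
   (ev c (p + w) - s) - (csum (fun n => taylor c p n * w ^+ n) N - s).
  by rewrite opprB addrA subrK.
rewrite (le_trans (cmod_triangleB _ _))// mulrDl lerD//.
rewrite /csum -sumrB (le_trans (cmod_sum _ _ _))//.
have geo : \sum_(m < N) (1 / 2 : R) ^+ m <= 2.
  suff -> : \sum_(m < N) (1 / 2 : R) ^+ m = 2 - 2 / 2 ^+ N.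
    by rewrite gerBl divr_ge0// exprn_ge0.
  elim: {s h} N => [|N IH]; first by rewrite big_ord0 expr0 divr1 subrr.
  rewrite big_ord_recr/= IH exprS expr_div_n expr1n.
  have : 2 ^+ N != 0 :> R by rewrite expf_neq0// pnatr_eq0.
  by move: (2 ^+ N) => a a0; field.
apply: (@le_trans _ _ (\sum_(m < N) (2 * M / 2 ^+ N * (1 / 2) ^+ m))); last first.
  rewrite -mulr_sumr; apply: (@le_trans _ _ (2 * M / 2 ^+ N * 2)).
    by rewrite ler_wpM2l// divr_ge0 ?mulr_ge0// exprn_ge0.
  by rewrite le_eqVlt; apply/orP; left; apply/eqP; ring.
apply: ler_sum => m _; rewrite -mulrBl cmodM cmodX.
have := csum_clim (fun i => taylor_term r0 pr (HM (m + i)%N)) (N - m).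
rewrite -/(ev (fun i => c (m + i)%N *+ 'C(m + i, m)) p) -/(taylor c p m).
move=> h2; have := ler_wpM2r (exprn_ge0 m (cmod_ge0 w)) h2.
move=> /le_trans; apply.
have mN : (m <= N)%N by apply: ltnW.
apply: (@le_trans _ _
   (2 * (M * (2 / rho) ^+ m) / 2 ^+ (N - m) * (rho / 8) ^+ m)).
  rewrite ler_wpM2l//; last first.
    by rewrite lerXn2r ?nnegrE ?cmod_ge0// divr_ge0// ltW.
  by rewrite divr_ge0 ?exprn_ge0// mulr_ge0// mulr_ge0// exprn_ge0// divr_ge0// ltW.
rewrite le_eqVlt; apply/orP; left; apply/eqP.
clearbody rho; have e8 : (8 : R) = 2 * 2 * 2 by rewrite -!natrM.
have -> : 2 ^+ N = 2 ^+ (N - m) * 2 ^+ m :> R by rewrite -exprD subnK.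
rewrite e8 !expr_div_n !exprMn !expr1n.
have : rho ^+ m != 0 by rewrite expf_neq0// gt_eqF.
have : 2 ^+ m != 0 :> R by rewrite expf_neq0// pnatr_eq0.
have : 2 ^+ (N - m) != 0 :> R by rewrite expf_neq0// pnatr_eq0.
move: (rho ^+ m) (2 ^+ m) (2 ^+ (N - m)) => a b e e0 b0 a0.
by field; rewrite a0 b0 e0.
Qed.

End PowerSeries.

(** * Derivatives and order of vanishing of power series *)

Section PowerSeriesDerivative.
Variable R : realType.
Implicit Types (c d : nat -> Cplane R) (z w p : Cplane R).

Lemma ev_cvg0 c : entire_seq c -> ev c w @[w --> (0 : Cplane R)] --> c 0%N.
Proof.
move=> cE; have [M M0 HM] := ev_bounded (entire_seq_shift 1 cE) ler01.
apply/ccvg_nbhsP => e e0.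
exists (Num.min 1 (e / (M + 1))).
  by rewrite lt_min ltr01 divr_gt0// ltr_wpDl.
move=> w; rewrite subr0 lt_min => /andP[w1 we].
rewrite ev_shift// addrC addKr cmodM.
rewrite (le_lt_trans (ler_wpM2l (cmod_ge0 _) (HM _ (ltW w1))))//.
rewrite ltr_pdivlMr in we; last by rewrite ltr_wpDl.
by rewrite (le_lt_trans _ we)// ler_wpM2l ?cmod_ge0// lerDl.
Qed.

Lemma ev_at0 c : entire_seq c -> ev c 0 = c 0%N.
Proof. by move=> cE; rewrite ev_shift// mul0r addr0. Qed.

Lemma taylor0 c p : entire_seq c -> taylor c p 0%N = ev c p.
Proof.
move=> cE; have := ev_taylor p 0 cE; rewrite addr0 => ->.
by rewrite ev_at0//; exact: entire_seq_taylor.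
Qed.

Definition dseq c n := c n.+1 *+ n.+1.

Lemma entire_seq_dseq c : entire_seq c -> entire_seq (dseq c).
Proof.
move=> /(@entire_seq_binom _ _ 1); congr entire_seq.
by apply/funext => n; rewrite /dseq add1n bin1.
Qed.

Lemma taylor1 c p : taylor c p 1%N = ev (dseq c) p.
Proof.
by congr ev; apply/funext => n; rewrite /dseq add1n bin1.
Qed.

(** The difference quotient at [p] is again a power series in [z - p], namely the Taylor series
    shifted by one. Continuity, complex derivability and the chain rule along curves are all read
    off from [q]. *)
Lemma ev_slope c p : entire_seq c -> exists q : Cplane R -> Cplane R,
  [/\ forall z, ev c z - ev c p = (z - p) * q z, q p = ev (dseq c) p &
      q z @[z --> p] --> q p].
Proof.
move=> cE; have tE := entire_seq_taylor p cE.
have sE := entire_seq_shift 1 tE.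
exists (fun z => ev (fun n => taylor c p (1 + n)%N) (z - p)); split.
- move=> z.
  have -> : ev c z = ev (taylor c p) (z - p).
    by have := ev_taylor p (z - p) cE; rewrite [p + _]addrC subrK.
  by rewrite ev_shift// taylor0// [X in X - _]addrC addrK.
- by rewrite subrr ev_at0// addn0 taylor1.
- rewrite subrr ev_at0//; apply: cvg_comp (ev_cvg0 sE).
  by apply/ccvg_nbhsP => e e0; exists e => // w; rewrite subr0.
Qed.

Lemma continuous_ev c : entire_seq c -> continuous (ev c).
Proof.
move=> cE p; have [q [cq _ qp]] := ev_slope p cE.
have FF := @nbhs_filter (Cplane R) p.
have zp : (z - p : Cplane R) @[z --> p] --> (0 : Cplane R).
  by apply/ccvg_nbhsP => e e0; exists e => // w; rewrite subr0.
have := ccvgD FF (ccvgM FF zp qp) (@ccvg_cst _ _ _ FF (ev c p)).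
rewrite mul0r add0r; apply: cvg_trans.
by apply: near_eq_cvg; apply: nearW => z; rewrite -cq subrK.
Qed.

Lemma derivable_ev c p : entire_seq c -> derivable (ev c) p 1.
Proof.
move=> cE; have [q [cq _ qp]] := ev_slope p cE.
apply/cvg_ex; exists (q p); apply/ccvgP => e e0.
have /ccvg_nbhsP/(_ e e0)[d d0 Hd] := qp.
apply/nbhs_cmodP; exists d => // h; rewrite subr0 => hd h0.
have -> : h^-1 *: (ev c (h *: 1 + p) - ev c p) = q (h + p).
  rewrite cq (_ : h *: 1 = h :> Cplane R) ?addrK; last exact: mulr1.
  exact: (mulKf h0).
by apply: Hd; rewrite addrK.
Qed.

Lemma ev_const c z : entire_seq c -> (forall n, c n.+1 = 0) -> ev c z = c 0%N.
Proof.
move=> cE c0; apply: (@ev_eq _ _ _ _ (cmod (c 0%N))) => // -[|N].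
  by rewrite csum0 subr0 expr0 divr1.
rewrite /csum big_ord_recl expr0 mulr1 big1.
  by rewrite addr0 subrr cmod0 divr_ge0 ?cmod_ge0// exprn_ge0.
by move=> i _; rewrite lift0 c0 mul0r.
Qed.

Lemma ev_vanish c z m : entire_seq c -> (forall n, (n < m)%N -> c n.+1 = 0) ->
  ev c z = c 0%N + z ^+ m.+1 * ev (fun n => c (m.+1 + n)%N) z.
Proof.
move=> cE; elim: m => [|m IH] c0; first by rewrite expr1 ev_shift.
rewrite IH; last by move=> n nm; apply: c0; apply: ltnW.
have sE := entire_seq_shift m.+1 cE.
have e0 : c (m.+1 + 0)%N = 0 by rewrite addn0; exact: c0.
have := ev_shift z sE; rewrite e0 add0r => ->.
have -> : (fun n => c (m.+2 + n)%N) = (fun n => c (m.+1 + n.+1)%N).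
  by apply/funext => n; rewrite addnS.
by move: (ev _ z) => X; rewrite [in RHS]exprSr mulrA.
Qed.

Lemma ev_order c p z : entire_seq c -> ev c z != ev c p ->
  exists m d, [/\ entire_seq d, d 0%N != 0 &
    forall w, ev c (p + w) = ev c p + w ^+ m.+1 * ev d w].
Proof.
move=> cE zp; have tE := entire_seq_taylor p cE.
have ex : exists n, taylor c p n.+1 != 0.
  apply/not_existsP => H; move/eqP : zp; apply.
  have := ev_taylor p (z - p) cE; rewrite [p + _]addrC subrK => ->.
  rewrite ev_const//; first exact: taylor0.
  by move=> n; apply/eqP; rewrite -[_ == _]negbK; apply/negP/H.
exists (ex_minn ex), (fun n => taylor c p ((ex_minn ex).+1 + n)%N).
case: ex_minnP => m tm minm; split; first exact: entire_seq_shift.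
  by rewrite addn0.
move=> w; rewrite ev_taylor// (@ev_vanish _ _ m)// ?taylor0// => n nm.
by apply/eqP/negPn/negP => /minm; rewrite leqNgt nm.
Qed.

End PowerSeriesDerivative.

(** * Derivatives of curves in the plane *)

Section CurveDerivative.
Variable R : realType.
Implicit Types (g h : R -> Cplane R) (t : R) (l k : Cplane R).

(** Two-sided: the arcs constructed later extend differentiably beyond their parameter interval, and
    restricting the filter yields the one-sided notion of the definitions. *)
Definition curve_derive g t l :=
  ((g s - g t) / (s - t)%:C%C : Cplane R) @[s --> t^'] --> l.

Lemma curve_derive_within (I : set R) g t l :
  curve_derive g t l -> is_curve_derive_within I g t l.
Proof. by apply: cvg_trans; apply: cvg_app; apply: cvg_within. Qed.

Lemma slope_cvg (f : R -> R) t (df : R) :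
  is_derive t 1 f df <-> (f s - f t) / (s - t) @[s --> t^'] --> df.
Proof.
split.
  move=> [fd <-]; move/cvgrPdist_lt: fd => fd; apply/cvgrPdist_lt => e e0.
  have /nbhs_ballP[d /= d0 Hd] := fd e e0.
  apply/nbhs_ballP; exists d => // s; rewrite /ball/= => sd st.
  have := Hd (s - t); rewrite /ball/= sub0r opprB => /(_ sd).
  rewrite subr_eq0 => /(_ st); rewrite -[(s - t)%:A]/((s - t) * 1) mulr1 subrK.
  by rewrite -[_ *: _]/(_ * _) mulrC.
move=> H; have H' : h^-1 *: (f (h *: 1 + t) - f t) @[h --> 0^'] --> df.
  move/cvgrPdist_lt: H => fd; apply/cvgrPdist_lt => e e0.
  have /nbhs_ballP[d /= d0 Hd] := fd e e0.
  apply/nbhs_ballP; exists d => // s; rewrite /ball/= sub0r normrN => sd st.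
  have e1 : s + t - t = s by rewrite addrK.
  have := Hd (s + t); rewrite /ball/= distrC e1 => /(_ sd).
  rewrite -subr_eq0 e1 => /(_ st).
  by rewrite -[s%:A]/(s * 1) mulr1 -[_ *: _]/(_ * _) mulrC.
by apply: DeriveDef; [apply/cvg_ex; exists df | exact: cvg_lim H'].
Qed.

Lemma curve_derive_Re g t l : curve_derive g t l ->
  is_derive t 1 (fun s => complex.Re (g s)) (complex.Re l).
Proof.
move=> gl; apply/slope_cvg.
have FF : Filter (t^') by typeclasses eauto.
have := ccvg_Re FF gl; apply: cvg_trans; apply: near_eq_cvg; apply: nearW => s.
by rewrite -fmorphV /= -raddfB; case: (g s - g t) => a b /=; rewrite mulr0 subr0.
Qed.

Lemma curve_derive_ReIm g t l :
  is_derive t 1 (fun s => complex.Re (g s)) (complex.Re l) ->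
  is_derive t 1 (fun s => complex.Im (g s)) (complex.Im l) ->
  curve_derive g t l.
Proof.
move=> /slope_cvg gr /slope_cvg gi; apply: ccvg_ReIm.
  move: gr; apply: cvg_trans; apply: near_eq_cvg; apply: nearW => s.
  by rewrite -fmorphV /= -raddfB; case: (g s - g t) => a b /=; rewrite mulr0 subr0.
move: gi; apply: cvg_trans; apply: near_eq_cvg; apply: nearW => s.
by rewrite -fmorphV /= -raddfB; case: (g s - g t) => a b /=; rewrite mulr0 add0r mulrC.
Qed.

Lemma curve_derive_cst l t : curve_derive (fun=> l) t 0.
Proof.
rewrite /curve_derive; under eq_fun do rewrite subrr mul0r; exact: cvg_cst.
Qed.

Lemma curve_derive_line l t : curve_derive (fun s => s%:C%C * l) t l.
Proof.
apply/ccvgP => e e0; near=> s.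
have st : s != t by near: s; exact: nbhs_dnbhs_neq.
rewrite -mulrBl -rmorphB mulrAC divff ?mul1r ?subrr ?cmod0//.
by rewrite -(rmorph0 (real_complex R)) (inj_eq (@complexI R)) subr_eq0.
Unshelve. all: by end_near. Qed.

Lemma curve_derive_cvg_dnbhs g t l : curve_derive g t l -> g s @[s --> t^'] --> g t.
Proof.
move=> gl.
have FF := dnbhs_filter t.
have st0 : ((s - t)%:C%C : Cplane R) @[s --> t^'] --> (0 : Cplane R).
  apply/(ccvgP FF) => e e0; apply/nbhs_ballP; exists e => // s.
  by rewrite /ball/= distrC subr0 cmod_real.
have := ccvgD FF (ccvgM FF st0 gl) (@ccvg_cst _ _ _ FF (g t)).
rewrite mul0r add0r; apply: cvg_trans; apply: near_eq_cvg.
near=> s; have st : s != t by near: s; exact: nbhs_dnbhs_neq.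
rewrite mulrCA divff ?mulr1 ?subrK//.
by rewrite -(rmorph0 (real_complex R)) (inj_eq (@complexI R)) subr_eq0.
Unshelve. all: by end_near. Qed.

Lemma curve_deriveM g h t l k : curve_derive g t l -> curve_derive h t k ->
  curve_derive (fun s => g s * h s) t (l * h t + g t * k).
Proof.
move=> gl hk.
have FF := dnbhs_filter t.
have := ccvgD FF (ccvgM FF gl (curve_derive_cvg_dnbhs hk))
  (ccvgM FF (@ccvg_cst _ _ _ FF (g t)) hk).
apply: cvg_trans; apply: near_eq_cvg; apply: nearW => s.
by move: ((s - t)%:C%C)^-1 => i; ring.
Qed.

Lemma curve_derive_cis t : curve_derive (@cis R) t ('i%C * cis t).
Proof.
apply: curve_derive_ReIm => /=; rewrite !mul0r !mul1r.
  by rewrite sub0r; exact: is_derive_cos.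
by rewrite add0r; exact: is_derive_sin.
Qed.

Lemma curve_derive_ev c g t l : entire_seq c -> curve_derive g t l ->
  curve_derive (fun s => ev c (g s)) t (l * ev (dseq c) (g t)).
Proof.
move=> cE gl; have [q [cq <- qp]] := ev_slope (g t) cE.
have FF := dnbhs_filter t.
have qg : q (g s) @[s --> t^'] --> q (g t).
  by apply: cvg_comp qp; exact: curve_derive_cvg_dnbhs gl.
have := ccvgM FF gl qg.
apply: cvg_trans; apply: near_eq_cvg; apply: nearW => s.
by rewrite cq; move: ((s - t)%:C%C)^-1 => i; ring.
Qed.

End CurveDerivative.

(** * Local structure of a level set of the modulus *)

Section ImplicitFunction.
Variable R : realType.
Implicit Types (F : R -> R -> R) (t x s e : R).

Definition continuous2 F := continuous (fun u : R * R => F u.1 u.2).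

Lemma continuous2P F t x e : continuous2 F -> 0 < e ->
  exists2 d, 0 < d & forall s y, `|s - t| < d -> `|y - x| < d ->
    `|F s y - F t x| < e.
Proof.
move=> Fc e0; have /cvgrPdist_lt/(_ e e0)/nbhs_ballP[d /= d0 Hd] := Fc (t, x).
exists d => // s y st yx; have := Hd (s, y).
rewrite /ball/= /prod_ball /ball /= distrC [`|x - y|]distrC => /(_ (conj st yx)).
by rewrite distrC.
Qed.

Lemma quot_close (a b a0 b0 c e : R) : 0 < c -> c <= b -> c <= b0 ->
  `|a - a0| <= e -> `|b - b0| <= e ->
  `|a / b - a0 / b0| <= e * (`|a0| + b0) / c ^+ 2.
Proof.
move=> c0 cb cb0 ha hb; have b_0 := lt_le_trans c0 cb.
have b0_0 := lt_le_trans c0 cb0.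
have -> : a / b - a0 / b0 = ((a - a0) * b0 - a0 * (b - b0)) / (b * b0).
  by field; rewrite !gt_eqF.
rewrite normrM normfV [`|b * b0|]gtr0_norm ?mulr_gt0//.
have bb0 : 0 < b * b0 by rewrite mulr_gt0.
rewrite ler_pM ?invr_ge0 ?(ltW bb0)//.
  apply: (le_trans (ler_normB _ _)); rewrite !normrM (gtr0_norm b0_0).
  have := normr_ge0 a0; have := normr_ge0 (b - b0); nra.
by rewrite lef_pV2 ?posrE ?exprn_gt0// expr2 ler_pM// ltW.
Qed.

Lemma near_dist_lt t e : 0 < e -> \forall s \near t, `|s - t| < e.
Proof.
move=> e0; have : nbhs t (ball t e) by exact: nbhsx_ballx.
by apply: filterS => s; rewrite /ball/= distrC.
Qed.

Lemma near_norm_lt t e : `|t| < e -> \forall s \near t, `|s| < e.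
Proof.
rewrite -subr_gt0 => /(near_dist_lt t); apply: filterS => s st.
by have := ler_normD t (s - t); rewrite addrC subrK; lra.
Qed.

Lemma continuous2_graph F (phi : R -> R) t : continuous2 F ->
  {for t, continuous phi} -> F s (phi s) @[s --> t] --> F t (phi t).
Proof.
move=> Fc pc.
have pair : (s, phi s) @[s --> t] --> (t, phi t).
  have := @cvg_pair R R R (nbhs t) (nbhs t) (nbhs (phi t)) _ _ _ id phi cvg_id pc.
  exact.
move=> A hA; have h := Fc (t, phi t) A hA.
have h2 := pair _ h; exact: h2.
Qed.

Lemma add_le_of_sub_le (a b h : R) : a - b <= - h -> a + h <= b.
Proof. by lra. Qed.

Lemma gt0_close (x a : R) : `|x - a| < a -> 0 < x.
Proof. by rewrite ltr_norml => /andP[? ?]; lra. Qed.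

Lemma lt0_close (x a : R) : `|x - a| < - a -> x < 0.
Proof. by rewrite ltr_norml => /andP[? ?]; lra. Qed.

Variables (F F1 F2 : R -> R -> R).
Hypothesis Fd1 : forall t x : R, is_derive t 1 (F^~ x) (F1 t x).
Hypothesis Fd2 : forall t x : R, is_derive x 1 (F t) (F2 t x).
Hypotheses (Fc : continuous2 F) (F1c : continuous2 F1) (F2c : continuous2 F2).

Lemma is_derive_continuous (f : R -> R) x (l : R) : is_derive x 1 f l ->
  {for x, continuous f}.
Proof.
by case=> d _; apply: differentiable_continuous; apply/derivable1_diffP.
Qed.

(** The end points are not ordered. The last clause keeps the intermediate point in every interval
    centred at [x] that contains both end points, hence in the box where the derivative is bounded
    below. *)
Lemma MVT_between (f df : R -> R) (a b : R) :
  (forall x : R, is_derive x 1 f (df x)) ->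
  exists c, [/\ `|c - a| <= `|b - a|, f b - f a = df c * (b - a) &
    forall x d, `|a - x| <= d -> `|b - x| <= d -> `|c - x| <= d].
Proof.
move=> fd; have fc (u v : R) : {within `[u, v], continuous f}.
  apply: continuous_subspaceT => y; exact: is_derive_continuous (fd y).
have [ab|/ltW ba] := leP a b.
  have [c] := MVT_segment ab (fun x _ => fd x) (fc _ _).
  rewrite in_itv/= => /andP[ac cb] ->; exists c; split=> //.
    by rewrite !ger0_norm ?subr_ge0// lerB.
  move=> x d; rewrite !ler_norml => /andP[? ?] /andP[? ?].
  by apply/andP; split; lra.
have [c] := MVT_segment ba (fun x _ => fd x) (fc _ _).
rewrite in_itv/= => /andP[bc ca] e; exists c; split.
- by rewrite !ler0_norm ?subr_le0// !opprB lerB.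
- by rewrite -[LHS]opprB e -mulrN opprB.
- move=> x d; rewrite !ler_norml => /andP[? ?] /andP[? ?].
  by apply/andP; split; lra.
Qed.

(** On a small box F2 >= c > 0, so [F t] increases strictly in [x]; opposite signs at x0 - d and x0
    + d give the root. The sign clause records on which side of the graph [F] is positive, which
    later decides where |f| > rho; applied at phi t + h and phi t - h it also yields the continuity
    of [phi]. *)
Lemma implicit_function (x0 : R) : F 0 x0 = 0 -> 0 < F2 0 x0 ->
  exists d e (phi dphi : R -> R), [/\ 0 < d, 0 < e &
    forall t, `|t| < e ->
      [/\ `|phi t - x0| < d, F t (phi t) = 0,
          forall x, `|x - x0| <= d ->
            (phi t < x -> 0 < F t x) /\ (x < phi t -> F t x < 0),
          is_derive t 1 phi (dphi t) & {for t, continuous dphi}]].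
Proof.
move=> F0 F20; set c := F2 0 x0 / 2.
have c0 : 0 < c by rewrite divr_gt0.
have [d0 d00 Hd0] := continuous2P 0 x0 F2c c0.
set d := d0 / 2; have dpos : 0 < d by rewrite divr_gt0.
have F2ge t x : `|t| <= d -> `|x - x0| <= d -> c <= F2 t x.
  move=> td xd; have := Hd0 t x; rewrite subr0.
  have h : d < d0 by rewrite /d ltr_pdivrMr// mulr2n mulrDr mulr1 ltrDl.
  move=> /(_ (le_lt_trans td h) (le_lt_trans xd h)).
  by rewrite ltr_norml /c => /andP[? ?]; lra.
have mono t x y : `|t| <= d -> `|x - x0| <= d -> `|y - x0| <= d -> x <= y ->
    c * (y - x) <= F t y - F t x.
  move=> td xd yd xy; have fc : {within `[x, y], continuous (F t)}.
    by apply: continuous_subspaceT => z; exact: is_derive_continuous (Fd2 t z).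
  have [z] := MVT_segment xy (fun z _ => Fd2 t z) fc.
  rewrite in_itv/= => /andP[xz zy] ->; rewrite ler_wpM2r ?subr_ge0//.
  apply: F2ge => //; move: xd yd; rewrite !ler_norml => /andP[? ?] /andP[? ?].
  by apply/andP; split; lra.
have x0d : `|x0 - x0| <= d by rewrite subrr normr0 ltW.
have xpd : `|x0 + d - x0| <= d by rewrite addrC addKr ger0_norm// ltW.
have xmd : `|x0 - d - x0| <= d by rewrite addrAC subrr sub0r normrN ger0_norm// ltW.
have n0d : `|0 : R| <= d by rewrite normr0 ltW.
have cd : 0 < c * d by rewrite mulr_gt0.
have Fp : c * d <= F 0 (x0 + d).
  have := mono 0 x0 (x0 + d) n0d x0d xpd; rewrite F0 subr0.
  by rewrite (_ : x0 + d - x0 = d); [apply; rewrite lerDl ltW|ring].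
have Fm : F 0 (x0 - d) <= - (c * d).
  have := mono 0 (x0 - d) x0 n0d xmd x0d; rewrite F0 sub0r lerNr.
  by rewrite (_ : x0 - (x0 - d) = d); [apply; rewrite gerBl ltW|ring].
have [e1 e10 He1] := continuous2P 0 (x0 + d) Fc cd.
have [e2 e20 He2] := continuous2P 0 (x0 - d) Fc cd.
pose e := Num.min d (Num.min e1 e2).
have e0 : 0 < e by rewrite !lt_min dpos e10 e20.
have root t : `|t| < e -> exists x, `|x - x0| < d /\ F t x = 0.
  rewrite !lt_min => /and3P[td te1 te2].
  have Ftp : 0 < F t (x0 + d).
    have := He1 t (x0 + d); rewrite subr0 subrr normr0 => /(_ te1 e10).
    by rewrite ltr_norml => /andP[? ?]; lra.
  have Ftm : F t (x0 - d) < 0.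
    have := He2 t (x0 - d); rewrite subr0 subrr normr0 => /(_ te2 e20).
    by rewrite ltr_norml => /andP[? ?]; lra.
  have fc : {within `[x0 - d, x0 + d], continuous (F t)}.
    by apply: continuous_subspaceT => z; exact: is_derive_continuous (Fd2 t z).
  have le : x0 - d <= x0 + d by lra.
  have [] := @IVT R (F t) _ _ 0 le fc.
    by rewrite min_l ?max_r ?(ltW (lt_trans Ftm Ftp))// !ltW.
  move=> x; rewrite in_itv/= => /andP[x1 x2] Fx; exists x; split => //.
  rewrite ltr_norml; apply/andP; split; rewrite lt_neqAle; apply/andP; split.
  - by apply/eqP => h; move: Ftm; rewrite (_ : x0 - d = x) ?Fx ?ltxx//; lra.
  - by lra.
  - by apply/eqP => h; move: Ftp; rewrite (_ : x0 + d = x) ?Fx ?ltxx//; lra.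
  - by lra.
have /choice[phi Hphi] : forall t, exists x, `|t| < e -> `|x - x0| < d /\ F t x = 0.
  move=> t; have [/root[x Hx]|te] := boolP (`|t| < e); first by exists x.
  by exists 0.
have ed t : `|t| < e -> `|t| <= d.
  by rewrite !lt_min => /and3P[/ltW].
have sgn t x : `|t| < e -> `|x - x0| <= d ->
    (phi t < x -> 0 < F t x) /\ (x < phi t -> F t x < 0).
  move=> te xd; have [pd Fp0] := Hphi t te; split=> px.
    have := mono t (phi t) x (ed _ te) (ltW pd) xd (ltW px).
    rewrite Fp0 subr0; apply: lt_le_trans.
    by rewrite mulr_gt0// subr_gt0.
  have := mono t x (phi t) (ed _ te) xd (ltW pd) (ltW px).
  rewrite Fp0 sub0r lerNr => /le_lt_trans; apply.
  by rewrite oppr_lt0 mulr_gt0// subr_gt0.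
have phic t : `|t| < e -> {for t, continuous phi}.
  move=> te; have [pd Fp0] := Hphi t te.
  apply/cvgrPdist_lt => eta eta0.
  pose h := Num.min (eta / 2) ((d - `|phi t - x0|) / 2).
  have h0 : 0 < h by rewrite lt_min !divr_gt0// subr_gt0.
  have heta : h < eta.
    apply: (@le_lt_trans _ _ (eta / 2)); first by rewrite /h ge_min lexx.
    lra.
  have hd : h <= (d - `|phi t - x0|) / 2 by rewrite /h ge_min lexx orbT.
  have hdp : `|phi t + h - x0| <= d.
    rewrite addrAC (le_trans (ler_normD _ _))// (gtr0_norm h0).
    by move: pd hd; lra.
  have hdm : `|phi t - h - x0| <= d.
    rewrite addrAC (le_trans (ler_normB _ _))// (gtr0_norm h0).
    by move: pd hd; lra.
  have [Pp _] := sgn t (phi t + h) te hdp.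
  have [_ Pm] := sgn t (phi t - h) te hdm.
  have {}Pp : 0 < F t (phi t + h) by apply: Pp; rewrite ltrDl.
  have {}Pm : F t (phi t - h) < 0 by apply: Pm; rewrite gtrBl.
  have nPm : 0 < - F t (phi t - h) by rewrite oppr_gt0.
  have [r1 r10 Hr1] := continuous2P t (phi t + h) Fc Pp.
  have [r2 r20 Hr2] := continuous2P t (phi t - h) Fc nPm.
  near=> s.
  have se : `|s| < e by near: s; exact: near_norm_lt.
  have s1 : `|s - t| < r1 by near: s; exact: near_dist_lt.
  have s2 : `|s - t| < r2 by near: s; exact: near_dist_lt.
  have Q1 : 0 < F s (phi t + h).
    have := Hr1 s (phi t + h) s1; rewrite subrr normr0 => /(_ r10).
    exact: gt0_close.
  have Q2 : F s (phi t - h) < 0.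
    have := Hr2 s (phi t - h) s2; rewrite subrr normr0 => /(_ r20).
    exact: lt0_close.
  apply: (lt_trans _ heta); rewrite ltr_norml; apply/andP; split.
    rewrite ltNge; apply/negP => hh.
    have [_ Z] := sgn s (phi t + h) se hdp; have [_ Fs0] := Hphi s se.
    have [zz|zz] := eqVneq (phi s) (phi t + h).
      by move: Q1; rewrite -zz Fs0 ltxx.
    have : phi t + h < phi s by rewrite lt_neqAle eq_sym zz/=; exact: add_le_of_sub_le hh.
    by move=> /Z; rewrite ltNge (ltW Q1).
  rewrite ltNge; apply/negP => hh.
  have [Z _] := sgn s (phi t - h) se hdm; have [_ Fs0] := Hphi s se.
  have [zz|zz] := eqVneq (phi s) (phi t - h).
    by move: Q2; rewrite -zz Fs0 ltxx.
  have : phi s < phi t - h by rewrite lt_neqAle zz/= lerBrDr -lerBrDl.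
  by move=> /Z; rewrite ltNge (ltW Q2).
pose dphi t := - F1 t (phi t) / F2 t (phi t).
exists d, e, phi, dphi; split=> // t te.
have [pd Fp0] := Hphi t te.
have cF2 : c <= F2 t (phi t) by apply: F2ge; [exact: ed|exact: ltW].
split=> //; first by move=> x xd; exact: sgn.
  apply/slope_cvg; apply/cvgrPdist_lt => eps eps0.
  (* The summand 1 makes the bound from [quot_close], eps (K - 1) / K, strictly smaller than eps. *)
  pose K := `|- F1 t (phi t)| + F2 t (phi t) + 1.
  have K0 : 0 < K by rewrite ltr_wpDl// addr_ge0// (le_trans (ltW c0)).
  pose e' := eps * c ^+ 2 / K.
  have e'0 : 0 < e' by rewrite divr_gt0// mulr_gt0// exprn_gt0.
  have [r1 r10 Hr1] := continuous2P t (phi t) F1c e'0.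
  have [r2 r20 Hr2] := continuous2P t (phi t) F2c e'0.
  have r0 : 0 < Num.min r1 r2 by rewrite lt_min r10.
  near=> s.
  have se : `|s| < e by near: s; apply: nbhs_dnbhs; exact: near_norm_lt.
  have st : `|s - t| < Num.min r1 r2.
    by near: s; apply: nbhs_dnbhs; exact: near_dist_lt.
  have ps : `|phi s - phi t| < Num.min r1 r2.
    near: s; apply: nbhs_dnbhs; have /cvgrPdist_lt/(_ _ r0) := phic t te.
    by apply: filterS => s; rewrite distrC.
  have sNt : s - t != 0.
    by rewrite subr_eq0; near: s; exact: nbhs_dnbhs_neq.
  have [psd Fs0] := Hphi s se.
  (* The increment of [F] from (t, phi t) to (s, phi s) is zero; it is split at (t, phi s), with one
     mean value theorem in each variable, so the slope of [phi] is an exact quotient of partial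
     derivatives. *)
  have [xi [xi1 xi2 _]] := MVT_between t s (fun z => Fd1 z (phi s)).
  have [z [z1 z2 z3]] := MVT_between (phi t) (phi s) (Fd2 t).
  move: st ps; rewrite !lt_min => /andP[st1 st2] /andP[ps1 ps2].
  have zd : `|z - x0| <= d by apply: z3; exact: ltW.
  have F2z : c <= F2 t z by apply: F2ge => //; exact: ed.
  have key : (phi s - phi t) / (s - t) = - F1 xi (phi s) / F2 t z.
    have : F1 xi (phi s) * (s - t) + F2 t z * (phi s - phi t) = 0.
      by rewrite -xi2 -z2 Fs0 Fp0; ring.
    move=> /eqP; rewrite addr_eq0 => /eqP h.
    have z0 : F2 t z != 0 by rewrite gt_eqF// (lt_le_trans c0).
    apply: (canLR (mulfK sNt)); rewrite -mulrA [_^-1 * _]mulrC mulrA mulNr h.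
    by field.
  rewrite key distrC.
  have a1 : `|- F1 xi (phi s) - - F1 t (phi t)| <= e'.
    rewrite -opprD normrN ltW//; apply: Hr1 => //; exact: le_lt_trans xi1 _.
  have a2 : `|F2 t z - F2 t (phi t)| <= e'.
    by rewrite ltW//; apply: Hr2; rewrite ?subrr ?normr0//; exact: le_lt_trans z1 _.
  apply: (le_lt_trans (quot_close c0 F2z cF2 a1 a2)).
  rewrite /e' ltr_pdivrMr ?exprn_gt0// mulrAC ltr_pdivrMr//.
  by rewrite ltr_pM2l ?mulr_gt0 ?exprn_gt0// /K ltrDl.
have pc := phic t te.
apply: cvgM; first by apply: cvgN; exact: continuous2_graph F1c pc.
apply: cvgV; first by rewrite gt_eqF// (lt_le_trans c0).
exact: continuous2_graph F2c pc.
Unshelve. all: by end_near. Qed.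

End ImplicitFunction.

(** * The modulus in polar coordinates around a point *)

Section PolarModulus.
Variable R : realType.
Implicit Types (t x : R).

Lemma curve_derive_Im (g : R -> Cplane R) t (l : Cplane R) : curve_derive g t l ->
  is_derive t 1 (fun s => complex.Im (g s)) (complex.Im l).
Proof.
move=> gl; apply/slope_cvg; have FF := dnbhs_filter t.
have := ccvg_Im FF gl; apply: cvg_trans; apply: near_eq_cvg; apply: nearW => s.
rewrite -fmorphV /= -raddfB; case: (g s - g t) => a b /=.
by rewrite mulr0 add0r mulrC.
Qed.

Lemma curve_derive_comp (g : R -> Cplane R) (f : R -> R) t (df : R) (l : Cplane R) :
  curve_derive g (f t) l -> is_derive t 1 f df ->
  curve_derive (fun s => g (f s)) t (df%:C%C * l).
Proof.
move=> gl fd.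
have gR := curve_derive_Re gl; have gI := curve_derive_Im gl.
case: l gl gR gI => l1 l2 gl gR gI.
apply: curve_derive_ReIm => /=; rewrite mul0r ?subr0 ?addr0.
  have := @is_derive1_comp _ (fun s => complex.Re (g s)) f t l1 df gR fd.
  by rewrite mulrC.
have := @is_derive1_comp _ (fun s => complex.Im (g s)) f t l2 df gI fd.
by rewrite mulrC.
Qed.

Variables (g : nat -> Cplane R) (m : nat).
Hypothesis gE : entire_seq g.
Let M := m.+1.

(* If [f (p + w) = f p * (1 + w ^+ M * ev g w)] then, for [w = t cis x],
   [|f (p + w)|^2 = |f p|^2 (1 + t ^+ M * polF t x)]; unlike this expression,
   [polF] is nondegenerate at [t = 0]. *)
Definition polG t x : Cplane R := cis (M%:R * x) * ev g (t%:C%C * cis x).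

Definition polG1 t x : Cplane R :=
  cis (M%:R * x) * (cis x * ev (dseq g) (t%:C%C * cis x)).

Definition polG2 t x : Cplane R :=
  (M%:R)%:C%C * ('i%C * cis (M%:R * x)) * ev g (t%:C%C * cis x) +
  cis (M%:R * x) * ('i%C * cis x * t%:C%C * ev (dseq g) (t%:C%C * cis x)).

Lemma polG_derive1 t x : curve_derive (fun s => polG s x) t (polG1 t x).
Proof.
have h := curve_derive_ev gE (@curve_derive_line R (cis x) t).
have := curve_deriveM (@curve_derive_cst R (cis (M%:R * x)) t) h.
by rewrite mul0r add0r.
Qed.

Lemma polG_derive2 t x : curve_derive (polG t) x (polG2 t x).
Proof.
have l1 : is_derive x 1 (fun y : R => M%:R * y) M%:R.
  by apply: is_derive_eq; rewrite -[_ *: 1]/(_ * 1) mulr1.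
have h1 := curve_derive_comp (@curve_derive_cis R (M%:R * x)) l1.
have h2 := curve_deriveM (@curve_derive_cst R (t%:C%C : Cplane R) x)
  (@curve_derive_cis R x).
rewrite mul0r add0r in h2.
have := curve_deriveM h1 (curve_derive_ev gE h2).
by congr (curve_derive _ _ (_ + _ * (_ * _))); rewrite mulrC.
Qed.

Definition polF t x : R := 2 * complex.Re (polG t x) +
  t ^+ M * (complex.Re (polG t x) ^+ 2 + complex.Im (polG t x) ^+ 2).

Definition polF1 t x : R := 2 * complex.Re (polG1 t x) +
  (M%:R * t ^+ m * (complex.Re (polG t x) ^+ 2 + complex.Im (polG t x) ^+ 2) +
   t ^+ M * (2 * complex.Re (polG t x) * complex.Re (polG1 t x) +
             2 * complex.Im (polG t x) * complex.Im (polG1 t x))).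

Definition polF2 t x : R := 2 * complex.Re (polG2 t x) +
  t ^+ M * (2 * complex.Re (polG t x) * complex.Re (polG2 t x) +
            2 * complex.Im (polG t x) * complex.Im (polG2 t x)).

Lemma is_derive_modulus (k a b : R -> R) t (dk da db : R) :
  is_derive t 1 k dk -> is_derive t 1 a da -> is_derive t 1 b db ->
  is_derive t 1 (fun s => 2 * a s + k s * (a s ^+ 2 + b s ^+ 2))
    (2 * da + (dk * (a t ^+ 2 + b t ^+ 2) +
               k t * (2 * a t * da + 2 * b t * db))).
Proof.
move=> kd ad bd.
have sq (f : R -> R) (df : R) : is_derive t 1 f df ->
    is_derive t 1 (fun s => f s ^+ 2) (2 * f t * df).
  move=> fd; have := is_deriveX 2 fd; rewrite expr1 /GRing.scale /=.
  by rewrite mulr_natl.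
have := is_deriveD (is_deriveZ 2 ad) (is_deriveM kd (is_deriveD (sq _ _ ad) (sq _ _ bd))).
congr (is_derive _ _ _ _); rewrite /GRing.scale /=.
by rewrite -[(_ + _) t]/(a t ^+ 2 + b t ^+ 2); ring.
Qed.

Lemma polF_derive1 t x : is_derive t 1 (polF^~ x) (polF1 t x).
Proof.
have hr := curve_derive_Re (@polG_derive1 t x).
have hi := curve_derive_Im (@polG_derive1 t x).
have hk : is_derive t 1 (fun s : R => s ^+ M) (M%:R * t ^+ m).
  have := is_deriveX M (@is_derive_id R R t 1).
  by rewrite exprfctE /GRing.scale /= mulr1.
exact: is_derive_modulus hk hr hi.
Qed.

Lemma polF_derive2 t x : is_derive x 1 (polF t) (polF2 t x).
Proof.
have hr := curve_derive_Re (@polG_derive2 t x).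
have hi := curve_derive_Im (@polG_derive2 t x).
have := is_derive_modulus (is_derive_cst (t ^+ M) x 1) hr hi.
by rewrite mul0r add0r.
Qed.

Definition ccontinuous2 (H : R -> R -> Cplane R) :=
  continuous (fun u : R * R => H u.1 u.2).

Lemma ccontinuous2M H K : ccontinuous2 H -> ccontinuous2 K ->
  ccontinuous2 (fun t x => H t x * K t x).
Proof. by move=> Hc Kc u; exact: (ccvgM (nbhs_filter u) (Hc u) (Kc u)). Qed.

Lemma ccontinuous2D H K : ccontinuous2 H -> ccontinuous2 K ->
  ccontinuous2 (fun t x => H t x + K t x).
Proof. by move=> Hc Kc u; exact: (ccvgD (nbhs_filter u) (Hc u) (Kc u)). Qed.

Lemma ccontinuous2_cst (l : Cplane R) : ccontinuous2 (fun _ _ => l).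
Proof. by move=> u; exact: (@ccvg_cst _ _ _ (nbhs_filter u)). Qed.

Lemma ccontinuous2_ev c H : entire_seq c -> ccontinuous2 H ->
  ccontinuous2 (fun t x => ev c (H t x)).
Proof.
by move=> cE Hc u; apply: (continuous_comp (Hc u)); exact: continuous_ev.
Qed.

Lemma ccontinuous2_cis (k : R) : ccontinuous2 (fun _ x => cis (k * x)).
Proof.
have h : continuous (fun u : R * R => k * u.2).
  by move=> u; apply: cvgM; [exact: cvg_cst|exact: cvg_snd].
move=> u; apply: (continuous_comp (h u)); exact: continuous_cis.
Qed.

Lemma ccontinuous2_t : ccontinuous2 (fun t _ => t%:C%C : Cplane R).
Proof.
move=> u; apply: (ccvg_ReIm (nbhs_filter u)) => /=; first exact: cvg_fst.
exact: cvg_cst.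
Qed.

Lemma continuous2_Re H : ccontinuous2 H -> continuous2 (fun t x => complex.Re (H t x)).
Proof. by move=> Hc u; exact: (ccvg_Re (nbhs_filter u) (Hc u)). Qed.

Lemma continuous2_Im H : ccontinuous2 H -> continuous2 (fun t x => complex.Im (H t x)).
Proof. by move=> Hc u; exact: (ccvg_Im (nbhs_filter u) (Hc u)). Qed.

Lemma continuous2M (H K : R -> R -> R) : continuous2 H -> continuous2 K ->
  continuous2 (fun t x => H t x * K t x).
Proof. by move=> Hc Kc u; apply: cvgM; [exact: Hc|exact: Kc]. Qed.

Lemma continuous2D (H K : R -> R -> R) : continuous2 H -> continuous2 K ->
  continuous2 (fun t x => H t x + K t x).
Proof. by move=> Hc Kc u; apply: cvgD; [exact: Hc|exact: Kc]. Qed.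

Lemma continuous2_cst (k : R) : continuous2 (fun _ _ => k).
Proof. by move=> u; exact: cvg_cst. Qed.

Lemma continuous2_tX n : continuous2 (fun t _ => t ^+ n).
Proof.
have h : continuous (fun u : R * R => u.1) by move=> u; exact: cvg_fst.
move=> u; apply: (@continuous_comp _ _ _ (fun u : R * R => u.1) (fun y => y ^+ n)).
  exact: h.
exact: exprn_continuous.
Qed.

Lemma ccontinuous2_cis1 : ccontinuous2 (fun _ x => cis x).
Proof.
have := @ccontinuous2_cis 1; congr ccontinuous2.
by apply/funext => t; apply/funext => x; rewrite mul1r.
Qed.

Lemma polG_continuous : ccontinuous2 polG.
Proof.
apply: ccontinuous2M; first exact: ccontinuous2_cis.
apply: ccontinuous2_ev => //.
exact: ccontinuous2M ccontinuous2_t ccontinuous2_cis1.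
Qed.

Lemma polG1_continuous : ccontinuous2 polG1.
Proof.
apply: ccontinuous2M; first exact: (@ccontinuous2_cis _).
apply: ccontinuous2M; first exact: ccontinuous2_cis1.
apply: ccontinuous2_ev; first exact: entire_seq_dseq.
exact: ccontinuous2M ccontinuous2_t ccontinuous2_cis1.
Qed.

Lemma polG2_continuous : ccontinuous2 polG2.
Proof.
have tc := ccontinuous2M ccontinuous2_t ccontinuous2_cis1.
apply: ccontinuous2D; apply: ccontinuous2M.
- apply: ccontinuous2M; first exact: (@ccontinuous2_cst _).
  exact: ccontinuous2M (@ccontinuous2_cst _) (@ccontinuous2_cis _).
- exact: ccontinuous2_ev.
- exact: ccontinuous2_cis.
- apply: ccontinuous2M; last by apply: ccontinuous2_ev => //; exact: entire_seq_dseq.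
  apply: ccontinuous2M; last exact: ccontinuous2_t.
  exact: ccontinuous2M (@ccontinuous2_cst _) ccontinuous2_cis1.
Qed.

Lemma polF_continuous : continuous2 polF.
Proof.
have rc := continuous2_Re polG_continuous; have ic := continuous2_Im polG_continuous.
apply: continuous2D; first exact: continuous2M (@continuous2_cst 2) rc.
apply: continuous2M; first exact: (@continuous2_tX M).
by apply: continuous2D; [exact: (continuous2M rc rc)|exact: (continuous2M ic ic)].
Qed.

Lemma polF1_continuous : continuous2 polF1.
Proof.
have rc := continuous2_Re polG_continuous; have ic := continuous2_Im polG_continuous.
have rc1 := continuous2_Re polG1_continuous; have ic1 := continuous2_Im polG1_continuous.
apply: continuous2D; first exact: continuous2M (@continuous2_cst 2) rc1.
apply: continuous2D; apply: continuous2M.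
- exact: continuous2M (@continuous2_cst _) (@continuous2_tX m).
- by apply: continuous2D; [exact: (continuous2M rc rc)|exact: (continuous2M ic ic)].
- exact: continuous2_tX.
- apply: continuous2D.
    exact: continuous2M (continuous2M (@continuous2_cst 2) rc) rc1.
  exact: continuous2M (continuous2M (@continuous2_cst 2) ic) ic1.
Qed.

Lemma polF2_continuous : continuous2 polF2.
Proof.
have rc := continuous2_Re polG_continuous; have ic := continuous2_Im polG_continuous.
have rc1 := continuous2_Re polG2_continuous; have ic1 := continuous2_Im polG2_continuous.
apply: continuous2D; first exact: continuous2M (@continuous2_cst 2) rc1.
apply: continuous2M; first exact: (@continuous2_tX M).
apply: continuous2D.
  exact: continuous2M (continuous2M (@continuous2_cst 2) rc) rc1.
exact: continuous2M (continuous2M (@continuous2_cst 2) ic) ic1.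
Qed.

Lemma cmod_polF t x :
  cmod (1 + (t%:C%C * cis x) ^+ M * ev g (t%:C%C * cis x)) ^+ 2 =
  1 + t ^+ M * polF t x.
Proof.
have -> : (t%:C%C * cis x) ^+ M * ev g (t%:C%C * cis x) =
    (t ^+ M)%:C%C * polG t x.
  by rewrite exprMn cisX -rmorphXn /= mulrA.
rewrite /polF; case: (polG t x) => a b.
by rewrite cmod_sqr /=; ring.
Qed.

Lemma polF_gt0 t x : 0 < t ->
  (1 < cmod (1 + (t%:C%C * cis x) ^+ M * ev g (t%:C%C * cis x))) = (0 < polF t x).
Proof.
move=> t0; rewrite -(ltr_pXn2r (ltn0Sn 1)) ?nnegrE ?cmod_ge0// expr1n.
by rewrite cmod_polF ltrDl pmulr_rgt0// exprn_gt0.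
Qed.

Lemma polF_eq0 t x : 0 < t ->
  (cmod (1 + (t%:C%C * cis x) ^+ M * ev g (t%:C%C * cis x)) == 1) = (polF t x == 0).
Proof.
move=> t0; rewrite -(@eqrXn2 _ 2) ?cmod_ge0// expr1n.
by rewrite cmod_polF addrC -subr_eq0 addrK mulf_eq0 gt_eqF ?exprn_gt0.
Qed.

Hypothesis g0 : g 0%N != 0.

Lemma polG_t0 x : polG 0 x = cis (M%:R * x) * g 0%N.
Proof.
by rewrite /polG (_ : (0%:C)%C * cis x = 0 :> Cplane R) ?mul0r// ev_at0.
Qed.

Lemma polF_t0 x : polF 0 x = 2 * complex.Re (cis (M%:R * x) * g 0%N).
Proof. by rewrite /polF /M [0 ^+ m.+1]exprS !mul0r addr0 polG_t0. Qed.

(** For u = cis (M x) g(0), the value at t = 0 is 2 Re u and the angular derivative is -2 M Im u;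
    they cannot both vanish because u is nonzero. So all zero directions at t = 0 are simple. *)
Lemma polF2_t0 x : polF 0 x = 0 -> polF2 0 x != 0.
Proof.
rewrite polF_t0 => /eqP; rewrite mulf_eq0 pnatr_eq0 /= => /eqP h.
rewrite /polF2 {1}/M [0 ^+ m.+1]exprS !mul0r addr0 mulf_eq0 pnatr_eq0.
have -> : polG2 0 x = (M%:R)%:C%C * ('i%C * (cis (M%:R * x) * g 0%N)).
  rewrite /polG2 (_ : (0%:C)%C * cis x = 0 :> Cplane R) ?mul0r// ev_at0//.
  by rewrite (_ : (0%:C)%C = 0 :> Cplane R)// mulr0 mul0r mulr0 addr0 -!mulrA.
rewrite orFb.
have nz : cis (M%:R * x) * g 0%N != 0 by rewrite mulf_neq0 ?cis_neq0.
move: h nz; case: (_ * _) => a b /= ->; rewrite eq_complex /= eqxx /= => b0.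
by rewrite !(mul0r, mul1r, sub0r, subr0, add0r, mulr0) mulrN oppr_eq0 mulf_neq0// pnatr_eq0.
Qed.

(** The angle is chosen so that cis (M x) g(0) = -|g(0)|. In this direction |f| < rho near the
    point, so small circles cannot lie inside a tract. *)
Lemma polF_neg : exists x, polF 0 x < 0.
Proof.
have [a _ ga] := polar (g 0%N).
exists ((pi - a) / M%:R); rewrite polF_t0 ga mulrCA -cisD [M%:R * _]mulrC divfK ?pnatr_eq0//.
by rewrite subrK /cis cospi sinpi /= mul0r subr0 mulrN1 mulrN oppr_lt0 mulr_gt0// cmod_gt0.
Qed.

(** The sign [s] makes the angular derivative of [s * polF] positive, as [implicit_function]
    requires; it thereby tells on which side of the arc [polF] is positive. If [polF 0 x0] is
    nonzero, continuity excludes zeros nearby. *)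
Lemma polF_local (x0 : R) : exists d e : R, [/\ 0 < d, 0 < e &
  (forall t x, `|t| < e -> `|x - x0| <= d -> polF t x != 0) \/
  exists (s : R) (phi dphi : R -> R), (s = 1 \/ s = -1) /\
    forall t, `|t| < e ->
      [/\ `|phi t - x0| < d, polF t (phi t) = 0,
          forall x, `|x - x0| <= d ->
            (phi t < x -> 0 < s * polF t x) /\ (x < phi t -> s * polF t x < 0),
          is_derive t 1 phi (dphi t) & {for t, continuous dphi}]].
Proof.
have [/eqP F0|F0] : polF 0 x0 == 0 \/ polF 0 x0 != 0; [by apply/orP; rewrite orbN| |]; last first.
  have a0 : 0 < `|polF 0 x0| by rewrite normr_gt0.
  have [d d0 Hd] := continuous2P 0 x0 polF_continuous a0.
  exists (d / 2), d; split; rewrite ?divr_gt0//; left => t x td xd.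
  have := Hd t x; rewrite subr0 => /(_ td).
  have d2 : d / 2 < d by lra.
  move=> /(_ (le_lt_trans xd d2)); apply: contraTneq => ->.
  by rewrite sub0r normrN ltxx.
have F20 := polF2_t0 F0.
have [s s1 sF] : exists2 s : R, s = 1 \/ s = -1 & 0 < s * polF2 0 x0.
  have [p|n] := ltP 0 (polF2 0 x0); first by exists 1; [left|rewrite mul1r].
  by exists (-1); [right|rewrite mulN1r oppr_gt0 lt_neqAle F20].
have s0 : s != 0 by case: s1 => ->; rewrite ?oppr_eq0 oner_eq0.
have dZ (f : R -> R) (x l : R) : is_derive x 1 f l ->
    is_derive x 1 (fun y => s * f y) (s * l).
  by move=> fl; apply: is_deriveZ.
have [|//|d [e [phi [dphi [d0 e0 H]]]]] := @implicit_function R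
  (fun t x => s * polF t x) (fun t x => s * polF1 t x) (fun t x => s * polF2 t x)
  (fun t x => dZ _ _ _ (@polF_derive1 t x)) (fun t x => dZ _ _ _ (@polF_derive2 t x))
  (continuous2M (@continuous2_cst s) polF_continuous)
  (continuous2M (@continuous2_cst s) polF1_continuous)
  (continuous2M (@continuous2_cst s) polF2_continuous) x0.
  by rewrite F0 mulr0.
exists d, e; split; [exact: d0|exact: e0|right].
exists s, phi, dphi; split; first exact: s1.
move=> t te; have [h1 h2 h3 h4 h5] := H t te.
split; [exact: h1| |exact: h3|exact: h4|exact: h5].
by move/eqP: h2; rewrite mulf_eq0 (negPf s0) => /eqP.
Qed.

End PolarModulus.

(** * Direct tracts and their boundaries *)

Section PlaneTopology.
Variable R : realType.
Implicit Types (z w p : Cplane R).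

Lemma boundary_open (T : topologicalType) (D : set T) (z : T) : open D ->
  boundary D z <-> closure D z /\ ~ D z.
Proof. by move=> /interior_id Di; rewrite /boundary Di. Qed.

(** Otherwise [D] and the complement of its closure would separate [C]. *)
Lemma connected_meets_boundary (T : topologicalType) (C D : set T) :
  connected C -> open D -> C `&` D !=set0 -> ~ C `<=` D ->
  exists2 z, C z & boundary D z.
Proof.
move=> Cc Do [x [Cx Dx]] CD; apply: contrapT => H.
have sep : separated D (~` closure D).
  split; first by rewrite setICr.
  apply/seteqP; split=> // y [Dy Cly].
  have [z [/= nz Dz]] := Cly D (open_nbhs_nbhs (conj Do Dy)).
  exact: (nz (@subset_closure _ D z Dz)).
have cover : C `<=` D `|` ~` closure D.
  move=> y Cy; have [Dy|nDy] := pselect (D y); first by left.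
  by right=> cy; apply: H; exists y => //; apply/boundary_open.
have [//|sub] := connected_subset sep cover Cc.
exact: (sub x Cx (@subset_closure _ D x Dx)).
Qed.

Lemma connected_segment_image (g : R -> Cplane R) (a b : R) :
  continuous g -> connected (g @` `[a, b]).
Proof.
move=> gc; apply: connected_continuous_connected; first exact: segment_connected.
exact: continuous_subspaceT.
Qed.

Lemma continuous_real_complex : continuous (fun t : R => t%:C%C : Cplane R).
Proof.
move=> t; apply: (ccvg_ReIm (nbhs_filter t)) => /=; first exact: cvg_id.
exact: cvg_cst.
Qed.

Lemma continuous_ray p w : continuous (fun t : R => p + t%:C%C * w).
Proof.
move=> t; have FF := nbhs_filter t.
apply: (ccvgD FF (@ccvg_cst _ _ _ FF p)).
exact: (ccvgM FF (@continuous_real_complex t) (@ccvg_cst _ _ _ FF w)).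
Qed.

Lemma continuous_circle p w : continuous (fun x : R => p + w * cis x).
Proof.
move=> t; have FF := nbhs_filter t.
apply: (ccvgD FF (@ccvg_cst _ _ _ FF p)).
exact: (ccvgM FF (@ccvg_cst _ _ _ FF w) (@continuous_cis R t)).
Qed.

Lemma open_cdisk z (e : R) : open [set w | cmod (w - z) < e].
Proof.
rewrite openE => w /= we; apply/nbhs_cmodP; exists (e - cmod (w - z)).
  by rewrite subr_gt0.
move=> v vw /=; rewrite -(subrK w v) -addrA.
by rewrite (le_lt_trans (cmod_triangle _ _))// -ltrBrDr.
Qed.

Lemma connected_cdisk z (e : R) : connected [set w | cmod (w - z) < e].
Proof.
have [e0|e0] := ltP 0 e; last first.
  rewrite (_ : [set _ | _] = set0); first exact: connected0.
  apply/seteqP; split=> // w /=; rewrite ltNge (le_trans e0)//.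
  exact: cmod_ge0.
pose A w := (fun t : R => z + t%:C%C * (w - z)) @` `[0, 1].
have -> : [set w | cmod (w - z) < e] =
    \bigcup_(w in [set w | cmod (w - z) < e]) A w.
  apply/seteqP; split=> w /=.
    move=> we; exists w => //; exists 1; first by rewrite /= in_itv/= ler01 lexx.
    by rewrite (_ : 1%:C%C = 1 :> Cplane R)// mul1r addrC subrK.
  move=> [v /= ve [t]]; rewrite /= in_itv/= => /andP[t0 t1] <-.
  rewrite addrC addKr cmodM cmod_real ger0_norm//.
  by rewrite (le_lt_trans _ ve)// ler_piMl// cmod_ge0.
apply: bigcup_connected.
  exists z => w _; exists 0; first by rewrite /= in_itv/= lexx ler01.
  by rewrite (_ : 0%:C%C = 0 :> Cplane R)// mul0r addr0.
by move=> w _; apply: connected_segment_image; exact: continuous_ray.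
Qed.

Lemma closure_cmodP (A : set (Cplane R)) z :
  closure A z <-> forall e : R, 0 < e -> exists2 w, A w & cmod (w - z) < e.
Proof.
split=> [H e e0|H B /nbhs_cmodP[e e0 eB]].
  have [|w [Aw we]] := H [set w | cmod (w - z) < e]; last by exists w.
  by apply/nbhs_cmodP; exists e.
by have [w Aw we] := H e e0; exists w; split=> //; exact: eB.
Qed.

Lemma between_dist_le (a b c x d : R) : `|a - x| <= d -> `|b - x| <= d ->
  (a <= c) || (b <= c) -> (c <= a) || (c <= b) -> `|c - x| <= d.
Proof.
rewrite !ler_norml => /andP[? ?] /andP[? ?].
by case/orP => ?; case/orP => ?; apply/andP; split; lra.
Qed.

Lemma between_side_gt0 (s a b c q : R) : s = 1 \/ s = -1 ->
  0 < s * (a - q) -> 0 < s * (b - q) ->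
  (a <= c) || (b <= c) -> (c <= a) || (c <= b) -> 0 < s * (c - q).
Proof. by case=> -> ? ? /orP[?|?] /orP[?|?]; lra. Qed.

Lemma half_gap (a h d : R) : a < d -> h <= (d - a) / 2 -> a + h <= d.
Proof. by lra. Qed.

Lemma quarter_lt (u h e : R) : 0 < e -> h * (4 * u) <= e -> u * (2 * h) < e.
Proof. by nra. Qed.

End PlaneTopology.

(** * Absorbing sets and the arcs in their boundary *)

Section Absorbing.
Variables (R : realType) (f : Cplane R -> Cplane R) (rho : R).
Implicit Types (z w p : Cplane R) (D C : set (Cplane R)).

(* The part of the direct tract axioms saying that [D] is a union of components
   of [{z | rho < |f z|}]. *)
Definition absorbing D := [/\ open D, forall z, D z -> rho < cmod (f z) &
  forall C, connected C -> (forall z, C z -> rho < cmod (f z)) ->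
    C `&` D !=set0 -> C `<=` D].

(** A connected subset of {|f| > rho} that meets [D] without being contained in it would meet the
    boundary, where |f| = rho. *)
Lemma direct_tract_absorbing D : direct_tract f rho D -> absorbing D.
Proof.
move=> [[Do Dc _] _ _ _ [_ bD DU]]; split=> // C Cc CU CD.
apply: contrapT => nCD; have [z Cz bz] := connected_meets_boundary Cc Do CD nCD.
by have := CU z Cz; rewrite bD// ltxx.
Qed.

Hypothesis fc : continuous f.

Lemma continuous_cmod_f : continuous (fun z => cmod (f z)).
Proof. by move=> z; apply: (continuous_comp (@fc z)); exact: continuous_cmod. Qed.

Lemma near_cmod_gt z : rho < cmod (f z) ->
  exists2 e : R, 0 < e & forall w, cmod (w - z) < e -> rho < cmod (f w).
Proof.
move=> zr; apply/nbhs_cmodP.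
have := @cvgr_gt R (Cplane R) (nbhs z) (nbhs_filter z) (fun z => cmod (f z))
  (cmod (f z)) (@continuous_cmod_f z) rho zr.
exact.
Qed.

Lemma near_cmod_lt z : cmod (f z) < rho ->
  exists2 e : R, 0 < e & forall w, cmod (w - z) < e -> cmod (f w) < rho.
Proof.
move=> zr; apply/nbhs_cmodP.
have := @cvgr_lt R (Cplane R) (nbhs z) (nbhs_filter z) (fun z => cmod (f z))
  (cmod (f z)) (@continuous_cmod_f z) rho zr.
exact.
Qed.

(** If |f z| > rho, a disk around [z] on which this persists meets [D], so it is absorbed and [z]
    lies in [D]. If |f z| < rho, points of [D] near [z] violate |f| > rho. *)
Lemma absorbing_boundary D z : absorbing D -> boundary D z -> cmod (f z) = rho.
Proof.
move=> [Do DU Dabs] /(boundary_open z Do)[/closure_cmodP clz nDz].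
apply/eqP; rewrite eq_le; apply/andP; split; rewrite leNgt; apply/negP => h.
  have [e e0 He] := near_cmod_gt h.
  apply: nDz; apply: (Dabs [set w | cmod (w - z) < e]).
  - exact: connected_cdisk.
  - by move=> w; exact: He.
  - by have [w Dw we] := clz e e0; exists w.
  - by rewrite /= subrr cmod0.
have [e e0 He] := near_cmod_lt h; have [w Dw we] := clz e e0.
by have := DU w Dw; rewrite ltNge (ltW (He w we)).
Qed.

Section Arc.
Variables (D : set (Cplane R)) (p : Cplane R) (F : R -> R -> R).
Hypotheses (Dabs : absorbing D) (bp : boundary D p).

Definition ppt (t x : R) : Cplane R := p + t%:C%C * cis x.

Lemma ppt0 x : ppt 0 x = p.
Proof. by rewrite /ppt rmorph0 mul0r addr0. Qed.

Hypothesis Fpos : forall t x, 0 < t ->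
  (rho < cmod (f (ppt t x))) = (0 < F t x).

Lemma absorb_angle t a b : 0 < t ->
  (forall x, Num.min a b <= x <= Num.max a b -> 0 < F t x) ->
  D (ppt t a) -> D (ppt t b).
Proof.
move=> t0 H Da; have [_ _ dabs] := Dabs.
apply: (dabs (ppt t @` `[Num.min a b, Num.max a b])).
- by apply: connected_segment_image; exact: continuous_circle.
- by move=> _ [x xab <-]; rewrite Fpos//; apply: H; move: xab; rewrite /= in_itv.
- exists (ppt t a); split=> //; exists a => //.
  by rewrite /= in_itv/= ge_min le_max lexx.
- by exists b => //; rewrite /= in_itv/= ge_min le_max lexx !orbT.
Qed.

Lemma absorb_radius x a b : 0 < a -> 0 < b ->
  (forall t, Num.min a b <= t <= Num.max a b -> 0 < F t x) ->
  D (ppt a x) -> D (ppt b x).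
Proof.
move=> a0 b0 H Da; have [_ _ dabs] := Dabs.
apply: (dabs ((fun t => ppt t x) @` `[Num.min a b, Num.max a b])).
- by apply: connected_segment_image; exact: continuous_ray.
- move=> _ [t tab <-]; move: tab; rewrite /= in_itv/= => tab.
  rewrite Fpos//; first exact: H.
  by case/andP: tab => tab _; apply: lt_le_trans tab; rewrite lt_min a0.
- exists (ppt a x); split=> //; exists a => //.
  by rewrite /= in_itv/= ge_min le_max lexx.
- by exists b => //; rewrite /= in_itv/= ge_min le_max lexx !orbT.
Qed.

Variables (x0 d e r s : R) (phi : R -> R).
Hypotheses (s1 : s = 1 \/ s = -1) (d0 : 0 < d) (r0 : 0 < r) (re : r < e).
Hypothesis phiB : forall t, `|t| < e ->
  [/\ `|phi t - x0| < d, F t (phi t) = 0 & forall x, `|x - x0| <= d ->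
    (phi t < x -> 0 < s * F t x) /\ (x < phi t -> s * F t x < 0)].

(* The side of the arc on which [|f| > rho]. *)
Definition arc_side t x := [/\ 0 < t, t <= r, `|x - x0| <= d & 0 < s * (x - phi t)].

Let te t : 0 < t -> t <= r -> `|t| < e.
Proof. by move=> t0 tr; rewrite gtr0_norm// (le_lt_trans tr). Qed.

Lemma arc_side_gt0 t x : arc_side t x -> 0 < F t x.
Proof.
move=> [t0 tr xd]; have [_ _ /(_ x xd)[h1 h2]] := phiB (te t0 tr).
case: s1 h1 h2 => -> h1 h2.
  by rewrite mul1r subr_gt0 => /h1; rewrite mul1r.
by rewrite mulN1r oppr_gt0 subr_lt0 => /h2; rewrite mulN1r oppr_lt0.
Qed.

Lemma gt0_arc_side t x : 0 < t -> t <= r -> `|x - x0| <= d -> 0 < F t x ->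
  arc_side t x.
Proof.
move=> t0 tr xd Fx; split=> //; have [_ p0 /(_ x xd)[h1 h2]] := phiB (te t0 tr).
have pe : phi t != x by apply: contraTneq Fx => <-; rewrite p0 ltxx.
case: s1 h1 h2 => -> h1 h2.
  rewrite mul1r subr_gt0 lt_neqAle pe leNgt; apply/negP => /h2.
  by rewrite mul1r ltNge (ltW Fx).
rewrite mulN1r oppr_gt0 subr_lt0 lt_neqAle eq_sym pe leNgt; apply/negP => /h1.
by rewrite mulN1r oppr_gt0 ltNge (ltW Fx).
Qed.

(** The end of the angular interval on the side where [F] is positive. It stays on that side for all
    radii up to [r], and so serves as a corridor between radii. *)
Let xout := x0 + s * d.

Lemma arc_side_out t : 0 < t -> t <= r -> arc_side t xout.
Proof.
move=> t0 tr; split=> //; have [+ _ _] := phiB (te t0 tr).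
  by rewrite /xout addrAC subrr add0r normrM (gtr0_norm d0); case: s1 => ->;
    rewrite ?normrN normr1 mul1r.
by rewrite /xout ltr_norml; case: s1 => -> /andP[? ?]; lra.
Qed.

Lemma arc_side_conv t x y (z : R) : arc_side t x -> arc_side t y ->
  Num.min x y <= z <= Num.max x y -> arc_side t z.
Proof.
move=> [t0 tr xd sx] [_ _ yd sy] /andP[]; rewrite ge_min le_max => z1 z2.
split=> //.
  exact: between_dist_le xd yd z1 z2.
exact: between_side_gt0 s1 sx sy z1 z2.
Qed.

(** The side is path connected: turn to the angle [xout], move radially, turn back. Hence a single
    point of [D] on the side puts the whole side into [D]. *)
Lemma arc_side_absorb t x t' x' : arc_side t x -> arc_side t' x' ->
  D (ppt t x) -> D (ppt t' x').
Proof.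
move=> A A' Dx; have [t0 tr _ _] := A; have [t'0 t'r _ _] := A'.
apply: (@absorb_angle t' xout) => // [y yx|].
  by apply: arc_side_gt0; apply: arc_side_conv yx => //; exact: arc_side_out.
apply: (@absorb_radius xout t) => // [u uu|].
  apply: arc_side_gt0; apply: arc_side_out; case/andP: uu => u1 u2.
    by apply: lt_le_trans u1; rewrite lt_min t0.
  by apply: (le_trans u2); rewrite ge_max tr.
apply: (@absorb_angle t x) => // y yx.
by apply: arc_side_gt0; apply: arc_side_conv yx => //; exact: arc_side_out.
Qed.

Lemma ppt_lipschitz t x y : 0 <= t -> cmod (ppt t x - ppt t y) <= t * (2 * `|x - y|).
Proof.
move=> t0; rewrite /ppt opprD addrACA subrr add0r -mulrBr cmodM cmod_real.
by rewrite ger0_norm// ler_wpM2l// cis_lipschitz.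
Qed.

(** On the arc |f| = rho, so its points are not in [D]; points slightly off it on the positive side
    are in [D] by [arc_side_absorb]. At radius 0 the arc is at [p] itself. *)
Lemma arc_boundary t x u : arc_side t x -> D (ppt t x) -> 0 <= u -> u <= r ->
  boundary D (ppt u (phi u)).
Proof.
move=> A Dx u0 ur; have [->|un0] := eqVneq u 0.
  by rewrite ppt0; exact: bp.
have {un0} u0' : 0 < u by rewrite lt_neqAle eq_sym un0.
have [Do DU _] := Dabs; have [pd Fp0 _] := phiB (te u0' ur).
apply/(boundary_open _ Do); split; last first.
  by move=> /DU; rewrite Fpos// Fp0 ltxx.
apply/closure_cmodP => eps eps0.
(* The first bound makes the displacement 2 u h at most eps / 2, the second keeps the angle within
   distance [d] of [x0]. *)
pose h := Num.min (eps / (4 * u)) ((d - `|phi u - x0|) / 2).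
have h0 : 0 < h by rewrite lt_min !divr_gt0 ?mulr_gt0// subr_gt0.
have h1 : h <= eps / (4 * u) by rewrite ge_min lexx.
have h2 : h <= (d - `|phi u - x0|) / 2 by rewrite ge_min lexx orbT.
have sn : `|s| = 1 by case: s1 => ->; rewrite ?normrN normr1.
have ss : s * s = 1 by case: s1 => ->; rewrite ?mulr1 ?mulN1r ?opprK.
exists (ppt u (phi u + s * h)).
  apply: arc_side_absorb A _ Dx; split=> //.
    rewrite addrAC (le_trans (ler_normD _ _))// normrM sn mul1r (gtr0_norm h0).
    exact: half_gap.
  by rewrite addrAC subrr add0r mulrA ss mul1r.
rewrite (le_lt_trans (ppt_lipschitz _ _ u0))// addrAC subrr add0r normrM sn mul1r.
rewrite (gtr0_norm h0); move: h1; rewrite ler_pdivlMr ?mulr_gt0// => h1.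
exact: quarter_lt.
Qed.

End Arc.
End Absorbing.

(** * Regularity of the arcs *)

Section ArcSmooth.
Variables (R : realType) (p : Cplane R) (r e : R) (phi dphi : R -> R).
Implicit Types u v t : R.
Hypotheses (r0 : 0 < r) (re : r < e).
Hypothesis phid : forall t : R, `|t| < e ->
  is_derive t 1 phi (dphi t) /\ {for t, continuous dphi}.

Definition arc (u : R) : Cplane R := ppt p (r * u) (phi (r * u)).

Definition darc (u : R) : Cplane R :=
  r%:C%C * cis (phi (r * u)) +
  (r * u)%:C%C * ((r * dphi (r * u))%:C%C * ('i%C * cis (phi (r * u)))).

Let rue u : u \in `[0, 1] -> `|r * u| < e.
Proof.
rewrite in_itv/= => /andP[u0 u1]; rewrite ger0_norm ?(mulr_ge0 (ltW r0))//.
by rewrite (le_lt_trans _ re)// ler_piMr// ltW.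
Qed.

Let scal u : is_derive u 1 (fun v : R => r * v) r.
Proof.
have := is_deriveZ r (@is_derive_id R R u 1).
by rewrite /GRing.scale /= mulr1.
Qed.

Let scalc : continuous (fun v : R => r * v).
Proof. by move=> u; exact: is_derive_continuous (scal u). Qed.

Lemma arc_derive u : u \in `[0, 1] -> curve_derive arc u (darc u).
Proof.
move=> u01; have [pd _] := phid (rue u01).
have h1 : curve_derive (fun v => (r * v)%:C%C) u r%:C%C.
  have := curve_derive_comp (@curve_derive_line R 1 (r * u)) (scal u).
  rewrite mulr1; congr (curve_derive _ _ _); apply/funext => v.
  exact: mulr1.
have h2 : is_derive u 1 (fun v => phi (r * v)) (r * dphi (r * u)).
  by have := is_derive1_comp pd (scal u); rewrite mulrC.
have h3 := curve_derive_comp (@curve_derive_cis R (phi (r * u))) h2.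
have h := curve_deriveM h1 h3.
rewrite /curve_derive; under eq_fun => s.
  rewrite {1}/arc {1}/arc /ppt opprD addrACA subrr add0r; over.
exact: h.
Qed.

(** Once the factor cis is removed, the real part is r. So the velocity is nonzero even at the
    centre [p], where polar coordinates are singular. *)
Lemma darc_neq0 u : darc u != 0.
Proof.
have -> : darc u = cis (phi (r * u)) *
   (r%:C%C + (r * u * (r * dphi (r * u)))%:C%C * 'i%C).
  by rewrite /darc; ring.
rewrite mulf_neq0 ?cis_neq0// eq_complex /= negb_and; apply/orP; left.
by rewrite !mulr0 mul0r subr0 addr0 gt_eqF.
Qed.

Let phic u : u \in `[0, 1] -> {for u, continuous (fun v => phi (r * v))}.
Proof.
move=> u01; have [pd _] := phid (rue u01).
apply: (@continuous_comp _ _ _ (fun v => r * v) phi); first exact: scalc.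
exact: is_derive_continuous pd.
Qed.

Let cisphic u : u \in `[0, 1] ->
  (cis (phi (r * v)) : Cplane R) @[v --> u] --> cis (phi (r * u)).
Proof.
move=> u01; apply: (@continuous_comp _ _ _ (fun v => phi (r * v)) (@cis R)).
  exact: phic.
exact: continuous_cis.
Qed.

Let rcomp (h : R -> R) u : {for u, continuous h} ->
  ((h v)%:C%C : Cplane R) @[v --> u] --> ((h u)%:C%C : Cplane R).
Proof.
move=> hc; apply: (@continuous_comp _ _ _ h (fun t : R => t%:C%C : Cplane R)).
  exact: hc.
exact: continuous_real_complex.
Qed.

Lemma arc_continuous u : u \in `[0, 1] -> {for u, continuous arc}.
Proof.
move=> u01; have FF := nbhs_filter u.
apply: (ccvgD FF (@ccvg_cst _ _ _ FF p)).
exact: (ccvgM FF (@rcomp _ u (@scalc u)) (cisphic u01)).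
Qed.

Lemma darc_continuous u : u \in `[0, 1] -> {for u, continuous darc}.
Proof.
move=> u01; have FF := nbhs_filter u; have [_ dc] := phid (rue u01).
have dc' : {for u, continuous (fun v => r * dphi (r * v))}.
  apply: cvgM; first exact: cvg_cst.
  by apply: (@continuous_comp _ _ _ (fun v => r * v) dphi) => //; exact: scalc.
apply: (ccvgD FF); first exact: (ccvgM FF (@ccvg_cst _ _ _ FF _) (cisphic u01)).
apply: (ccvgM FF (@rcomp _ u (@scalc u))).
apply: (ccvgM FF (@rcomp _ u dc')).
exact: (ccvgM FF (@ccvg_cst _ _ _ FF _) (cisphic u01)).
Qed.

Lemma arc_piecewise_smooth : piecewise_smooth_curve arc.
Proof.
split.
  apply: continuous_in_subspaceT => u; rewrite inE /= => u01.
  exact: arc_continuous.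
exists set0; first exact: finite_set0.
move=> a b a0 ab b1 _; exists darc.
have sub t : t \in `[a, b] -> t \in `[0, 1].
  rewrite !in_itv/= => /andP[ta tb].
  by rewrite (le_trans a0 ta) (le_trans tb b1).
split.
  apply: continuous_in_subspaceT => u; rewrite inE /= => /sub u01.
  exact: darc_continuous.
move=> t /sub t01; split; last exact: darc_neq0.
apply: curve_derive_within; exact: arc_derive.
Qed.

End ArcSmooth.

Lemma evZ (R : realType) (c : nat -> Cplane R) k z : entire_seq c ->
  entire_seq (fun n => k * c n) /\ ev (fun n => k * c n) z = k * ev c z.
Proof.
move=> cE; have kE : entire_seq (fun n => k * c n).
  move=> rho r0; have [M HM] := cE rho r0; exists (cmod k * M) => n.
  by rewrite cmodM -mulrA ler_wpM2l// cmod_ge0.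
split=> //; have [M M0 HM] := ev_tail cE (cmod_ge0 z).
apply: (@ev_eq _ _ _ _ (cmod k * M)) => // N.
have -> : csum (fun n => k * c n * z ^+ n) N = k * csum (fun n => c n * z ^+ n) N.
  by rewrite /csum mulr_sumr; apply: eq_bigr => i _; rewrite mulrA.
by rewrite -mulrBr cmodM -mulrA ler_wpM2l ?cmod_ge0// HM.
Qed.

Lemma common_lower_bound (R : realType) (T : Type) (h : T -> R) (s : seq T) :
  (forall x, 0 < h x) -> exists2 r : R, 0 < r & forall x, List.In x s -> r < h x.
Proof.
move=> h0; elim: s => [|x s [r r0 Hr]]; first by exists 1.
exists (Num.min r (h x / 2)); first by rewrite lt_min r0 divr_gt0.
move=> y /= [<-|/Hr]; last by apply: le_lt_trans; rewrite ge_min lexx.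
apply: (@le_lt_trans _ _ (h x / 2)); first by rewrite ge_min lexx orbT.
by rewrite ltr_pdivrMr// mulr_natr mulr2n ltrDl.
Qed.

Lemma mem_In (T : eqType) (x : T) (s : seq T) : x \in s -> List.In x s.
Proof.
by elim: s => //= y s IH; rewrite in_cons => /orP[/eqP ->|/IH]; [left|right].
Qed.

Lemma lt_of_half_gap (R : realType) (x y eta q : R) : x < eta ->
  eta <= (q - 1) / 2 -> 0 < q - 1 -> y <= x + 1 -> y < q.
Proof. by lra. Qed.

Lemma gt0_of_half (R : realType) (x y : R) : x < 1 / 2 -> 1 <= y + x -> 0 < y.
Proof. by lra. Qed.

Lemma le_of_half_gap (R : realType) (x b d eta v : R) : b <= 2 * x -> x < eta ->
  eta <= (d - v) / 2 -> v + b <= d.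
Proof. by lra. Qed.

Lemma In_mem (T : eqType) (x : T) (s : seq T) : List.In x s -> x \in s.
Proof.
by elim: s => //= y s IH [->|/IH]; rewrite in_cons ?eqxx// => ->; rewrite orbT.
Qed.

(** * The boundary of a tract near one of its points *)

Section LocalBoundary.
Variables (R : realType) (c : nat -> Cplane R) (rho : R).
Hypothesis cE : entire_seq c.
Hypothesis nonconst : forall p, exists z, ev c z != ev c p.
Hypothesis rho0 : 0 < rho.
Variable D : set (Cplane R).
Hypothesis Dabs : absorbing (ev c) rho D.

Let fc := continuous_ev cE.

(** Since |f p| = rho > 0, one can divide by f(p): f(p + w) = f(p) (1 + w^(m+1) g(w)), and the level
    rho of |f| becomes the level 1 treated by [polF]. *)
Lemma cmod_polar_factor p : cmod (ev c p) = rho -> exists m g,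
  [/\ entire_seq g, g 0%N != 0,
    (forall t x, 0 < t ->
      (rho < cmod (ev c (ppt p t x))) = (0 < polF g m t x)) &
    (forall t x, 0 < t ->
      (cmod (ev c (ppt p t x)) == rho) = (polF g m t x == 0))].
Proof.
move=> fp; have [z zp] := nonconst p.
have [m [d [dE d0 Hd]]] := ev_order cE zp.
have fp0 : ev c p != 0 by rewrite -cmod_gt0 fp.
pose g n := (ev c p)^-1 * d n.
have gE : entire_seq g by have [] := evZ (ev c p)^-1 0 dE.
have Hf w : cmod (ev c (p + w)) = rho * cmod (1 + w ^+ m.+1 * ev g w).
  have [_ ->] := evZ (ev c p)^-1 w dE.
  rewrite -fp -cmodM Hd; congr cmod.
  by move: (ev c p) fp0 (ev d w) => a a0 b; field.
exists m, g; split=> //.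
- by rewrite /g mulf_neq0 ?invr_eq0.
- by move=> t x t0; rewrite /ppt Hf -polF_gt0// ltr_pMr.
- move=> t x t0; rewrite /ppt Hf -polF_eq0//.
  by rewrite -[X in _ == X]mulr1 (inj_eq (mulfI _))// gt_eqF.
Qed.

(** Finitely many boxes of [polF_local] cover all directions, and in each box the level set is empty
    or a single arc. Only arcs with [D] on their positive side are listed, because [D] need not
    contain every sector of {|f| > rho} at [p]. *)
Lemma local_boundary p : boundary D p ->
  exists (r : R) (n : nat) (G : nat -> R -> Cplane R), [/\ 0 < r,
    (forall i, (i < n)%N -> piecewise_smooth_curve (G i) /\
      forall t, t \in `[0, 1] -> boundary D (G i t) /\ cmod (G i t - p) <= 1) &
    forall z, boundary D z -> cmod (z - p) < r ->
      exists2 i, (i < n)%N & exists2 t, t \in `[0, 1] & G i t = z].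
Proof.
move=> bp; have fp := absorbing_boundary fc Dabs bp.
have [m [g [gE g0 Fpos Fzero]]] := cmod_polar_factor fp.
have [Do DU dabs] := Dabs.
have Fneg := @polF_neg R g m gE g0.
have Fc := polF_continuous (m := m) gE.
have Floc := @polF_local R g m gE g0.
move: (polF g m) Fpos Fzero Fneg Fc Floc => F Fpos Fzero Fneg Fc Floc.
(* The tuple packs d, e, the sign s, the arc phi and its derivative, so that a single [choice]
   provides all of them as functions of [x0]. *)
pose data (x0 : R) (u : (R * R) * (R * ((R -> R) * (R -> R)))) :=
  [/\ 0 < u.1.1, 0 < u.1.2 &
  (forall t x, `|t| < u.1.2 -> `|x - x0| <= u.1.1 -> F t x != 0) \/
  ((u.2.1 = 1 \/ u.2.1 = -1) /\
    forall t, `|t| < u.1.2 ->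
      [/\ `|u.2.2.1 t - x0| < u.1.1, F t (u.2.2.1 t) = 0,
          forall x, `|x - x0| <= u.1.1 ->
            (u.2.2.1 t < x -> 0 < u.2.1 * F t x) /\
            (x < u.2.2.1 t -> u.2.1 * F t x < 0),
          is_derive t 1 u.2.2.1 (u.2.2.2 t) & {for t, continuous u.2.2.2}])].
have /choice[U HU] : forall x0, exists u, data x0 u.
  move=> x0; have [d [e [d0 e0 [A|[s [phi [dphi B]]]]]]] := Floc x0.
    (* There is no arc in this case; sign, arc and derivative are placeholders. *)
    by exists ((d, e), (0, (id, id))); split; [exact: d0|exact: e0|left].
  by exists ((d, e), (s, (phi, dphi))); split; [exact: d0|exact: e0|right].
have [xs Hxs] : exists xs : seq R, forall x, `|x| <= pi ->
    exists2 x0, List.In x0 xs & `|x - x0| < (U x0).1.1.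
  have := @segment_compact R (- pi) pi; rewrite compact_cover.
  move=> /(_ R setT (fun x0 => ball x0 (U x0).1.1))[|x _|S _ HS].
  - by move=> i _; exact: ball_open.
  - by exists x => //; apply: ballxx; have [] := HU x.
  - exists (finmap.enum_fset S) => x xpi.
    have [|x0 /= x0S xx0] := HS x; first by rewrite /= in_itv/= -ler_norml.
    exists x0; first exact: mem_In.
    by move: xx0; rewrite /ball/= distrC.
(* A direction that avoids [D] for all small radii; it is needed to show that [p] itself lies on a
   listed arc. *)
have [xn Fxn] := Fneg.
have [en en0 Hen] : exists2 en : R, 0 < en & forall t, `|t| < en -> F t xn < 0.
  have nF : 0 < - F 0 xn by rewrite oppr_gt0.
  have [d d0 Hd] := continuous2P 0 xn Fc nF.
  exists d; [exact: d0|move=> t td; apply: (@lt0_close _ _ (F 0 xn))].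
  by apply: Hd; [rewrite subr0|rewrite subrr normr0].
have U2 x0 : 0 < (U x0).1.2 by have [] := HU x0.
have [r1 r10 Hr1] := common_lower_bound xs U2.
pose r := Num.min r1 (Num.min 1 (en / 2)).
have r0 : 0 < r by rewrite !lt_min r10 ltr01 divr_gt0.
have r_1 : r <= 1 by rewrite /r !ge_min lexx orbT.
have ren : r < en.
  apply: (@le_lt_trans _ _ (en / 2)); first by rewrite /r !ge_min lexx !orbT.
  by rewrite ltr_pdivrMr// mulr_natr mulr2n ltrDl.
have rU x0 : List.In x0 xs -> r < (U x0).1.2.
  by move=> /Hr1; apply: le_lt_trans; rewrite /r ge_min lexx.
pose phi x0 := (U x0).2.2.1; pose dphi x0 := (U x0).2.2.2.
pose side x0 := arc_side x0 (U x0).1.1 r (U x0).2.1 (phi x0).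
(* The first conjunct says that the arc carries all zeros of [F] in the box; the second provides a
   point of [D] on its positive side. *)
pose chosen x0 := (forall t x, `|t| < (U x0).1.2 -> `|x - x0| <= (U x0).1.1 ->
    F t x = 0 -> x = phi x0 t) /\ exists t x, side x0 t x /\ D (ppt p t x) /\
    ((U x0).2.1 = 1 \/ (U x0).2.1 = -1) /\
    forall t, `|t| < (U x0).1.2 ->
      [/\ `|phi x0 t - x0| < (U x0).1.1, F t (phi x0 t) = 0,
          forall x, `|x - x0| <= (U x0).1.1 ->
            (phi x0 t < x -> 0 < (U x0).2.1 * F t x) /\
            (x < phi x0 t -> (U x0).2.1 * F t x < 0),
          is_derive t 1 (phi x0) (dphi x0 t) & {for t, continuous (dphi x0)}].
pose ys := [seq x <- xs | `[< chosen x >]].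
pose G i := arc p r (phi (nth 0 ys i)).
have ysP x0 : List.In x0 xs -> chosen x0 -> exists2 i, (i < size ys)%N & nth 0 ys i = x0.
  move=> x0s cx; have : x0 \in ys.
    rewrite mem_filter; apply/andP; split; first exact/asboolP.
    exact: In_mem.
  by move=> h; exists (index x0 ys); rewrite ?index_mem ?nth_index.
have nthys i : (i < size ys)%N -> List.In (nth 0 ys i) xs /\ chosen (nth 0 ys i).
  move=> iy; have := mem_nth 0 iy; rewrite mem_filter => /andP[/asboolP cx xs_].
  by split=> //; exact: mem_In.
(* A boundary point other than [p] lies on the unique arc of its box. A point of [D] close enough to
   it is in the same box, necessarily on the positive side, so the arc is chosen. *)
have claim2 z : boundary D z -> 0 < cmod (z - p) -> cmod (z - p) < r ->
    exists x0 t, [/\ List.In x0 xs, chosen x0, 0 < t, t < r & z = ppt p t (phi x0 t)].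
  move=> bz zp zr; have [th thpi zth] := polar (z - p).
  set t := cmod (z - p) in zp zr zth *.
  have zE : z = ppt p t th by rewrite /ppt -zth addrC subrK.
  have [x0 x0s xx0] := Hxs th thpi.
  have Fz : F t th = 0.
    by apply/eqP; rewrite -Fzero// -zE (absorbing_boundary fc Dabs bz).
  have tU : `|t| < (U x0).1.2.
    by rewrite gtr0_norm// (lt_trans zr)//; exact: rU.
  have [d0 e0 [A|[s1 B]]] := HU x0.
    by have := A t th tU (ltW xx0); rewrite Fz eqxx.
  have uniqz t' x : `|t'| < (U x0).1.2 -> `|x - x0| <= (U x0).1.1 ->
      F t' x = 0 -> x = phi x0 t'.
    move=> t'U xd Fx; have [_ _ /(_ x xd)[h1 h2] _ _] := B t' t'U.
    apply/eqP; rewrite eq_le !leNgt; apply/andP; split; apply/negP.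
      by move=> /h1; rewrite Fx mulr0 ltxx.
    by move=> /h2; rewrite Fx mulr0 ltxx.
  exists x0, t; split=> //; last by rewrite zE (uniqz t th)// ltW.
  split=> //.
  have z0 : z - p != 0 by rewrite -cmod_gt0.
  have gap : 0 < (U x0).1.1 - `|th - x0| by rewrite subr_gt0.
  (* The three bounds serve [polar_near1], keep the angle of the nearby point in the box (it moves
     by at most 2 eta), and keep its radius below [r]. *)
  pose eta := Num.min (1 / 4) (Num.min (((U x0).1.1 - `|th - x0|) / 2) ((r / t - 1) / 2)).
  have rt : 0 < r / t - 1 by rewrite subr_gt0 ltr_pdivlMr// mul1r.
  have eta0 : 0 < eta by rewrite !lt_min !divr_gt0.
  have eta1 : eta <= 1 / 4 by rewrite ge_min lexx.
  have eta2 : eta <= ((U x0).1.1 - `|th - x0|) / 2 by rewrite !ge_min lexx orbT.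
  have eta3 : eta <= (r / t - 1) / 2 by rewrite !ge_min lexx !orbT.
  have [clz _] := (boundary_open z Do).1 bz.
  have [z' Dz' zz'] := (closure_cmodP D z).1 clz _ (mulr_gt0 eta0 zp).
  (* The modulus and argument of this quotient are the changes of radius and angle from [z] to
     [z']. *)
  pose u := (z' - p) / (z - p).
  have u1 : cmod (u - 1) < eta.
    rewrite /u -(mulfV z0) -mulrBl opprB addrA subrK cmodM cmodV.
    by rewrite ltr_pdivrMr.
  have u12 : cmod (u - 1) < 1 / 2.
    by rewrite (lt_le_trans u1)// (le_trans eta1)// ler_pM2l// lef_pV2 ?posrE// ler_nat.
  have [b bu ub] := polar_near1 u12.
  have cu : cmod u < r / t.
    have := cmod_triangle (u - 1) 1; rewrite subrK cmod1.
    exact: lt_of_half_gap u1 eta3 rt.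
  have cu0 : 0 < cmod u.
    have := cmod_triangleB u (u - 1); rewrite opprB addrC subrK cmod1.
    exact: gt0_of_half u12.
  have z'E : z' = ppt p (t * cmod u) (th + b).
    have -> : z' = p + (z - p) * u by rewrite mulrC divfK// addrC subrK.
    by rewrite /ppt zth {1}ub cisD rmorphM /=; congr (p + _); ring.
  have tu0 : 0 < t * cmod u by rewrite mulr_gt0.
  have tur : t * cmod u < r by rewrite mulrC -ltr_pdivlMr.
  have thb : `|th + b - x0| <= (U x0).1.1.
    rewrite addrAC (le_trans (ler_normD _ _))//.
    exact: le_of_half_gap bu u1 eta2.
  have FF : 0 < F (t * cmod u) (th + b).
    by rewrite -Fpos// -z'E; exact: DU.
  exists (t * cmod u), (th + b); rewrite -z'E; split; last by split.
  apply: (@gt0_arc_side _ F x0 _ (U x0).1.2 r _ _ s1 (rU _ x0s)) => //.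
  - by move=> t' /B[].
  - exact: ltW.
exists r, (size ys), G; split; [exact: r0| |].
  move=> i /nthys[x0s [_ [t [x [sd [Dx [s1 B]]]]]]].
  set x0 := nth 0 ys i in x0s sd s1 B *.
  have d0 : 0 < (U x0).1.1 by have [] := HU x0.
  split.
    apply: (@arc_piecewise_smooth _ _ _ (U x0).1.2 _ (dphi x0)) => //.
      exact: rU.
    by move=> t' /B[].
  move=> v; rewrite in_itv/= => /andP[v0 v1]; split.
    have B' t' : `|t'| < (U x0).1.2 ->
      [/\ `|phi x0 t' - x0| < (U x0).1.1, F t' (phi x0 t') = 0 &
        forall x, `|x - x0| <= (U x0).1.1 ->
          (phi x0 t' < x -> 0 < (U x0).2.1 * F t' x) /\
          (x < phi x0 t' -> (U x0).2.1 * F t' x < 0)] by move=> /B[].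
    apply: (arc_boundary Dabs bp Fpos s1 d0 (rU _ x0s) B' sd Dx).
    - by rewrite mulr_ge0// ltW.
    - by rewrite ler_piMr// ltW.
  rewrite /G /arc /ppt addrAC subrr add0r cmodM cmod_real cmod_cis mulr1.
  by rewrite ger0_norm ?mulr_ge0 ?(ltW r0)// (le_trans _ r_1)// ler_piMr// ltW.
move=> z bz zr; have [zp|zp] := eqVneq z p; last first.
  have [|x0 [t [x0s cx t0 tr zE]]] := claim2 z bz _ zr.
    by rewrite cmod_gt0 subr_eq0.
  have [i iy ix] := ysP x0 x0s cx; exists i => //; exists (t / r).
    by rewrite in_itv/= divr_ge0 ?(ltW t0) ?(ltW r0)//= ler_pdivrMr// mul1r ltW.
  by rewrite /G /arc ix mulrC divfK ?gt_eqF.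
(* All arcs start at [p], so one chosen arc suffices. A small circle around [p] through a point of
   [D] leaves [D] in the direction [xn]; it therefore meets the boundary, and [claim2] applies
   there. *)
have [clp nDp] := (boundary_open p Do).1 bp.
have [z1 Dz1 z1r] := (closure_cmodP D p).1 clp r r0.
have z1p : 0 < cmod (z1 - p).
  by rewrite cmod_gt0 subr_eq0; apply: contra_notN nDp => /eqP <-.
set t := cmod (z1 - p) in z1r z1p.
have [th _ zth] := polar (z1 - p).
have z1E : z1 = ppt p t th by rewrite /ppt -zth addrC subrK.
pose C := (fun x => ppt p t x) @` `[Num.min th xn, Num.max th xn].
have Cc : connected C by apply: connected_segment_image; exact: continuous_circle.
have [|CD|z2 [x _ xz2] bz2] := connected_meets_boundary Cc Do.
- exists z1; split=> //; exists th => //.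
  by rewrite /= in_itv/= ge_min le_max lexx.
- have : D (ppt p t xn).
    by apply: CD; exists xn => //; rewrite /= in_itv/= ge_min le_max lexx !orbT.
  move=> /DU; rewrite Fpos// ltNge ltW// Hen// gtr0_norm//.
  exact: lt_trans ren.
have z2p : cmod (z2 - p) = t.
  by rewrite -xz2 /ppt addrAC subrr add0r cmodM cmod_real cmod_cis mulr1 gtr0_norm.
have [||x0 [t' [x0s cx _ _ _]]] := claim2 z2 bz2; rewrite ?z2p//.
have [i iy ix] := ysP x0 x0s cx; exists i => //; exists 0.
  by rewrite in_itv/= lexx ler01.
by rewrite /G /arc mulr0 ppt0.
Qed.

End LocalBoundary.

(** * The boundary as a locally finite family of curves *)

Section LevelBoundary.
Variables (R : realType).

Lemma compact_cdisk (r : R) : compact [set z : Cplane R | cmod z <= r].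
Proof.
have [r0|r0] := leP 0 r; last first.
  rewrite (_ : [set _ | _] = set0); first exact: compact0.
  by apply/seteqP; split=> // z /=; rewrite leNgt (lt_le_trans r0)// cmod_ge0.
have -> : [set z : Cplane R | cmod z <= r] =
    (fun u : R * R => u.1%:C%C * cis u.2) @` (`[0, r] `*` `[- pi, pi]).
  apply/seteqP; split=> [z /= zr|_ [[t x] [/= ti _] <-]].
    have [a api za] := polar z; exists (cmod z, a) => //=; split.
      by rewrite /= in_itv/= cmod_ge0.
    by rewrite /= in_itv/= -ler_norml.
  move: ti; rewrite /= in_itv/= => /andP[t0 tr].
  by rewrite cmodM cmod_real cmod_cis mulr1 ger0_norm.
apply: continuous_compact; last first.
  by apply: compact_setX; exact: segment_compact.
apply: continuous_subspaceT.
exact: (ccontinuous2M (@ccontinuous2_t R) (@ccontinuous2_cis1 R)).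
Qed.

Lemma closed_boundary (T : topologicalType) (D : set T) : closed (boundary D).
Proof.
rewrite /boundary setDE; apply: closedI; first exact: closed_closure.
by apply: open_closedC; exact: open_interior.
Qed.

Lemma closed_cmod_ge (r : R) : closed [set z : Cplane R | r <= cmod z].
Proof.
have -> : [set z : Cplane R | r <= cmod z] = ~` [set z | cmod (z - 0) < r].
  by apply/seteqP; split=> z /=; rewrite subr0 leNgt => /negP.
by apply: open_closedC; exact: open_cdisk.
Qed.

Variables (c : nat -> Cplane R) (rho : R).
Hypothesis cE : entire_seq c.
Hypothesis nonconst : forall p, exists z, ev c z != ev c p.
Hypothesis rho0 : 0 < rho.
Variable D : set (Cplane R).
Hypothesis Dabs : absorbing (ev c) rho D.

(** The part of the boundary in the annulus is compact, so finitely many local descriptions cover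
    it. Their curves stay within distance 1 of centres in the annulus; this is the source of the
    lower bound on |G t|, which yields local finiteness. *)
Lemma annulus_boundary (k : nat) : exists L : list (R -> Cplane R),
  (forall G, List.In G L -> piecewise_smooth_curve G /\
    forall t, t \in `[0, 1] -> boundary D (G t) /\ k%:R <= cmod (G t) + 1) /\
  forall z, boundary D z -> k%:R <= cmod z <= k.+1%:R ->
    exists2 G, List.In G L & exists2 t, t \in `[0, 1] & G t = z.
Proof.
pose data p (u : R * (nat * (nat -> R -> Cplane R))) :=
  boundary D p -> [/\ 0 < u.1,
    (forall i, (i < u.2.1)%N -> piecewise_smooth_curve (u.2.2 i) /\
      forall t, t \in `[0, 1] ->
        boundary D (u.2.2 i t) /\ cmod (u.2.2 i t - p) <= 1) &
    forall z, boundary D z -> cmod (z - p) < u.1 ->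
      exists2 i, (i < u.2.1)%N & exists2 t, t \in `[0, 1] & u.2.2 i t = z].
have /choice[U HU] : forall p, exists u, data p u.
  move=> p; have [bp|nbp] := pselect (boundary D p).
    have [r [n [G H]]] := local_boundary cE nonconst rho0 Dabs bp.
    by exists (r, (n, G)) => _.
  by exists (0, (0%N, fun _ _ => 0)) => /nbp.
pose K := boundary D `&` [set z | k%:R <= cmod z] `&` [set z | cmod z <= k.+1%:R].
have Kc : compact K.
  apply: (subclosed_compact _ (@compact_cdisk k.+1%:R)); last by move=> z [].
  apply: closedI; last first.
    by apply: compact_closed; [exact: norm_hausdorff|exact: compact_cdisk].
  by apply: closedI; [exact: closed_boundary|exact: closed_cmod_ge].
have := Kc; rewrite compact_cover.
move=> /(_ (Cplane R) K (fun p => [set w | cmod (w - p) < (U p).1]))[|z Kz|S SK HS].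
- by move=> p _; exact: open_cdisk.
- exists z => //=; rewrite subrr cmod0; have [[bz _] _] := Kz.
  by have [] := HU z bz.
exists (List.flat_map (fun p => List.map (U p).2.2 (List.seq 0 (U p).2.1))
  (finmap.enum_fset S)); split.
  move=> G /List.in_flat_map[p [/In_mem pS /List.in_map_iff[i [<- /List.in_seq[_ /ssrnat.ltP ip]]]]].
  have [[bp kp] _] : K p by have := SK p pS; rewrite inE.
  have [_ H _] := HU p bp; have [G1 G2] := H i ip.
  split; [exact: G1|move=> t t01].
  have [b1 b2] := G2 t t01; split; [exact: b1|].
  rewrite (le_trans kp)//; have := cmod_sub_le p ((U p).2.2 i t).
  by rewrite cmod_distC => h; rewrite addrC -lerBlDr (le_trans h).
move=> z bz /andP[z1 z2]; have [|p /= pS zp] := HS z; first by split.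
have [[bp kp] _] : K p by have := SK p pS; rewrite inE.
have [_ _ H] := HU p bp; have [i ip Gi] := H z bz zp.
exists ((U p).2.2 i) => //; apply/List.in_flat_map; exists p; split.
  exact: mem_In.
by apply/List.in_map_iff; exists i; split=> //; apply/List.in_seq; split;
  [exact/ssrnat.leP|exact/ssrnat.ltP].
Qed.

Lemma level_boundary_curves : consists_of_piecewise_smooth_curves (boundary D).
Proof.
have /choice[L HL] := annulus_boundary.
pose d : R -> Cplane R := fun=> 0.
pose g n : R -> Cplane R :=
  let u : nat * nat := odflt (0%N, 0%N) (unpickle n) in List.nth u.2 (L u.1) d.
pose N := [set n | exists k i, n = pickle (k, i) /\ (i < length (L k))%coq_nat].
have gE k i : g (pickle (k, i)) = List.nth i (L k) d by rewrite /g pickleK.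
exists N, g; split.
- move=> _ [k [i [-> ik]]]; rewrite gE.
  by have [H _] := HL k; have [] := H _ (List.nth_In _ d ik).
- apply/seteqP; split=> [z bz|z [_ [k [i [-> ik]]]] [t t01 <-]].
    have [k /andP[k1 k2]] : exists k : nat, k%:R <= cmod z <= k.+1%:R.
      exists (Num.trunc (cmod z)); have := truncn_itv (cmod_ge0 z).
      by move=> /andP[-> /ltW ->].
    have [_ H] := HL k; have [|G GL [t t01 Gt]] := H z bz; first by rewrite k1.
    have [i [ik iG]] := List.In_nth _ _ d GL.
    exists (pickle (k, i)); first by exists k, i.
    by exists t => //; rewrite gE iG.
  rewrite gE; have [H _] := HL k; have [_ G2] := H _ (List.nth_In _ d ik).
  by have [] := G2 t t01.
(* A curve of the k-th annulus that meets |z| <= r has k <= r + 1, which leaves finitely many k,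
   each with a finite list. *)
- move=> r; pose K := Num.bound (`|r| + 1).
  apply: (@sub_finite_set _ _ [set` [seq pickle (k, i) | k <- iota 0 K, i <- iota 0 (length (L k))]]);
    last exact: finite_seq.
  move=> _ [[k [i [-> ik]]] [t t01]]; rewrite gE => gr.
  have [H _] := HL k; have [_ G2] := H _ (List.nth_In _ d ik).
  have [_ kt] := G2 t t01.
  apply/allpairsPdep; exists k, i; split=> //; last first.
    by rewrite mem_iota /= add0n; apply/ssrnat.ltP.
  rewrite mem_iota /= add0n -(ltr_nat R).
  apply: (le_lt_trans kt); apply: (@le_lt_trans _ _ (`|r| + 1)).
    by rewrite lerD2r (le_trans gr)// ler_norm.
  by apply: archi_boundP; rewrite addr_ge0.
Qed.

End LevelBoundary.

(** * The product function *)

Section Product.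
Variables (R : realType) (n : nat -> nat).
Hypothesis n_gt : forall k, (k < n k)%N.
Hypothesis n_mono : forall k, (n k <= n k.+1)%N.
Hypothesis n_div : forall M : R, exists k, M <= \sum_(j < k) (n j)%:R^-1.

(* The zeros of the factor of degree [n k] have modulus [expR (xlog k)]. *)
Definition xlog (k : nat) : R := 4 * \sum_(j < k) (n j)%:R^-1.

Let n_gt0 k : (0 : R) < (n k)%:R.
Proof. by rewrite ltr0n; exact: leq_ltn_trans (n_gt k). Qed.

Lemma n_le i j : (i <= j)%N -> (n i <= n j)%N.
Proof. by move=> /subnKC <-; elim: (j - i)%N => [|d IH]; rewrite ?addn0// addnS (leq_trans IH). Qed.

Lemma xlogS k : xlog k.+1 = xlog k + 4 / (n k)%:R.
Proof. by rewrite /xlog big_ord_recr /= mulrDr. Qed.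

Lemma xlog_le i j : (i <= j)%N -> xlog i <= xlog j.
Proof.
move=> /subnKC <-; elim: (j - i)%N => [|d IH]; rewrite ?addn0// addnS xlogS.
by rewrite (le_trans IH)// lerDl divr_ge0// ltW.
Qed.

(** Degrees increase, so each of the j - i gaps is at least 4 / n_j. Consequently, for |z| <= r_i
    the j-th factor differs from 1 by at most exp(-4 (j - i)). *)
Lemma xlog_gap_ge i j : (i <= j)%N -> 4 * (j - i)%:R / (n j)%:R <= xlog j - xlog i.
Proof.
move=> /subnKC <-; rewrite addKn; elim: (j - i)%N => [|d IH].
  by rewrite mulr0 mul0r addn0 subrr.
rewrite addnS xlogS addrAC -[d.+1%:R]natr1 mulrDr mulr1 mulrDl lerD//.
  apply: le_trans IH; rewrite ler_wpM2l ?mulr_ge0// lef_pV2 ?posrE//.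
  by rewrite ler_nat.
by rewrite ler_wpM2l// lef_pV2 ?posrE// ler_nat.
Qed.

Lemma xlog_gap_ltn i j : (i < j)%N -> 4 / (n i)%:R <= xlog j - xlog i.
Proof.
by move=> ij; rewrite lerBrDl -xlogS xlog_le.
Qed.

Lemma xlog_unbounded (M : R) : exists k, M <= xlog k.
Proof.
have [k Hk] := n_div (M / 4); exists k.
by rewrite /xlog mulrC -ler_pdivrMr.
Qed.

(** This is r_k^(-n_k), so that 1 + [pcoef k] z^(n_k) is the k-th factor. *)
Definition pcoef k : R := expR (- ((n k)%:R * xlog k)).

Definition ppoly K : {poly R} := \prod_(k < K) (1 + pcoef k *: 'X^(n k)).

Definition pval K (t : R) : R := \prod_(k < K) (1 + expR ((n k)%:R * (t - xlog k))).

Definition pcval K (z : Cplane R) : Cplane R :=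
  \prod_(k < K) (1 + (pcoef k)%:C%C * z ^+ n k).

(* The later factors do not change the coefficient of ['X^i], because [i < n i]. *)
Definition acoef i : R := (ppoly i.+1)`_i.

Lemma pcoef_exp k t : pcoef k * expR t ^+ n k = expR ((n k)%:R * (t - xlog k)).
Proof. by rewrite /pcoef -expRM_natl -expRD; congr expR; ring. Qed.

Lemma pcoef_gt0 k : 0 < pcoef k.
Proof. exact: expR_gt0. Qed.

Lemma ppolyS K : ppoly K.+1 = ppoly K * (1 + pcoef K *: 'X^(n K)).
Proof. by rewrite /ppoly big_ord_recr. Qed.

Lemma coef_ppolyS K i : (ppoly K.+1)`_i =
  (ppoly K)`_i + pcoef K * (if (i < n K)%N then 0 else (ppoly K)`_(i - n K)).
Proof. by rewrite ppolyS mulrDr mulr1 coefD -scalerAr coefZ coefMXn. Qed.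

Lemma coef_ppoly_ge0 K i : 0 <= (ppoly K)`_i.
Proof.
elim: K i => [|K IH] i; first by rewrite /ppoly big_ord0 coef1; case: eqP.
by rewrite coef_ppolyS addr_ge0// mulr_ge0 ?(ltW (pcoef_gt0 _))//; case: ifP.
Qed.

Lemma coef_ppoly_stable K i : (i < K)%N -> (ppoly K)`_i = acoef i.
Proof.
move=> /subnKC <-; elim: (K - i.+1)%N => [|d IH]; first by rewrite addn0.
rewrite addnS coef_ppolyS IH ifT ?mulr0 ?addr0//.
by rewrite (leq_trans _ (n_gt _))//= ltnS addSn leqW// leq_addr.
Qed.

Lemma acoef_ge0 i : 0 <= acoef i.
Proof. exact: coef_ppoly_ge0. Qed.

Lemma horner_ppoly K t : (ppoly K).[expR t] = pval K t.
Proof.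
rewrite /ppoly horner_prod; apply: eq_bigr => k _.
by rewrite !hornerE -pcoef_exp.
Qed.

Lemma expR_mulN2 (x : R) m : - (x * m%:R) <= - m%:R -> expR (- (x * m%:R)) <= (1 / 2) ^+ m.
Proof.
move=> h; apply: (@le_trans _ _ (expR (- m%:R))); first by rewrite ler_expR.
rewrite -mulrN1 expRM_natl lerXn2r ?nnegrE ?expR_ge0 ?divr_ge0//.
rewrite expRN -[leRHS]mul1r div1r mul1r lef_pV2 ?posrE ?expR_gt0//.
by have := expR_ge1Dx (1 : R).
Qed.

(** Once t <= log r_k, the factor of index k + d is at most 1 + exp(-4 d) <= exp(2^(-d)). The
    exponents sum to at most 2, and their partial sums 2 - 2 * 2^(-d) form the induction
    invariant. *)
Lemma pval_bounded t : exists B, forall K, pval K t <= B.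
Proof.
have [k tk] := xlog_unbounded t.
exists (pval k t * expR 2) => K.
have pge0 m : 0 <= pval m t.
  by apply: prodr_ge0 => i _; rewrite addr_ge0// expR_ge0.
have pS m : pval m.+1 t = pval m t * (1 + expR ((n m)%:R * (t - xlog m))).
  by rewrite /pval big_ord_recr.
have [Kk|/ltnW kK] := leqP K k.
  apply: (@le_trans _ _ (pval k t)).
    move: Kk => /subnKC <-; elim: (k - K)%N => [|d IH]; rewrite ?addn0// addnS pS.
    by rewrite (le_trans IH)// ler_peMr// lerDl expR_ge0.
  by rewrite ler_peMr//; have := expR_ge1Dx (2 : R); lra.
suff H : pval K t <= pval k t * expR (2 - 2 * (1 / 2) ^+ (K - k)).
  apply: (le_trans H); rewrite ler_wpM2l// ler_expR gerBl.
  by rewrite mulr_ge0 ?exprn_ge0 ?divr_ge0.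
move: kK => /subnKC <-; rewrite addKn; elim: (K - k)%N => [|d IH].
  by rewrite addn0 expr0 mulr1 subrr expR0 mulr1.
rewrite addnS pS.
have f1 : 1 + expR ((n (k + d)%N)%:R * (t - xlog (k + d))) <= expR ((1 / 2) ^+ d).
  apply: le_trans (expR_ge1Dx _); rewrite lerD2l.
  apply: (@le_trans _ _ (expR (- (4 * d%:R)))); last first.
    by apply: expR_mulN2; rewrite lerN2 ler_peMl// ler1n.
  rewrite ler_expR; have := xlog_gap_ge (leq_addr d k); rewrite addKn.
  rewrite ler_pdivrMr// => h; rewrite -(opprB _ t) mulrN lerN2.
  apply: (le_trans h); rewrite mulrC.
  by rewrite ler_wpM2l ?(ltW (n_gt0 _))// lerD2l lerN2.
apply: (le_trans (ler_pM (pge0 _) _ IH f1)); first by rewrite addr_ge0// expR_ge0.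
rewrite -mulrA -expRD ler_wpM2l// ler_expR exprS.
by rewrite le_eqVlt; apply/orP; left; apply/eqP; field.
Qed.

Lemma coef_le_pval K i t : (ppoly K)`_i * expR t ^+ i <= pval K t.
Proof.
rewrite -horner_ppoly horner_coef.
have [iK|Ki] := ltnP i (size (ppoly K)); last first.
  rewrite nth_default// mul0r sumr_ge0// => j _.
  by rewrite mulr_ge0 ?coef_ppoly_ge0// exprn_ge0// expR_ge0.
rewrite (bigD1 (Ordinal iK)) //= lerDl sumr_ge0// => j _.
by rewrite mulr_ge0 ?coef_ppoly_ge0// exprn_ge0// expR_ge0.
Qed.

Definition aseq i : Cplane R := (acoef i)%:C%C.

(** With nonnegative coefficients each term is at most the value of a partial product, which is
    bounded uniformly in K; rho + 1 keeps the logarithm legitimate at rho = 0. *)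
Lemma entire_seq_aseq : entire_seq aseq.
Proof.
move=> rho r0; have [B HB] := pval_bounded (ln (rho + 1)).
exists B => i; rewrite cmod_real ger0_norm ?acoef_ge0//.
apply: le_trans (HB i.+1).
apply: le_trans (coef_le_pval i.+1 i _).
rewrite lnK ?posrE ?ltr_wpDl// ler_wpM2l ?coef_ppoly_ge0//.
by rewrite lerXn2r ?nnegrE ?addr_ge0// lerDl.
Qed.

Definition pfun := ev aseq.

Lemma pcval_horner K z : pcval K z =
  \sum_(i < size (ppoly K)) ((ppoly K)`_i)%:C%C * z ^+ i.
Proof.
have -> : pcval K z = (map_poly (real_complex R) (ppoly K)).[z].
  rewrite /ppoly rmorph_prod horner_prod; apply: eq_bigr => k _.
  by rewrite rmorphD rmorph1 /= map_polyZ /= map_polyXn !hornerE.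
rewrite horner_coef size_map_poly; apply: eq_bigr => i _.
by rewrite coef_map.
Qed.

(** Series and partial product have the same first K coefficients, so only their tails matter.
    Replacing |z| by 2 |z| + 1 enlarges each term of index at least K by at least 2^K, and the
    enlarged sum is bounded by [pval_bounded]. *)
Lemma pfun_approx z : exists C, forall K, cmod (pfun z - pcval K z) <= C / 2 ^+ K.
Proof.
have [M M0 HM] := ev_tail entire_seq_aseq (cmod_ge0 z).
have [B HB] := pval_bounded (ln (2 * cmod z + 1)).
have z1 : 0 < 2 * cmod z + 1 by rewrite ltr_wpDl// mulr_ge0// cmod_ge0.
exists (M + B) => K; pose s := csum (fun i => aseq i * z ^+ i) K.
have -> : pfun z - pcval K z = (pfun z - s) - (pcval K z - s) by ring.
rewrite (le_trans (cmod_triangleB _ _))// mulrDl lerD//; first exact: HM.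
pose m := maxn K (size (ppoly K)).
have -> : pcval K z = \sum_(i < m) ((ppoly K)`_i)%:C%C * z ^+ i.
  rewrite pcval_horner -!(big_mkord xpredT (fun i => ((ppoly K)`_i)%:C%C * z ^+ i)).
  rewrite [RHS](big_cat_nat (leq0n _) (leq_maxr K _))/=.
  rewrite [X in _ = _ + X]big1_seq ?addr0// => i /andP[_].
  by rewrite mem_index_iota => /andP[ki _]; rewrite nth_default// mul0r.
have -> : s = \sum_(i < m | (i < K)%N) ((ppoly K)`_i)%:C%C * z ^+ i.
  rewrite /s /csum (big_ord_widen _ (fun i => aseq i * z ^+ i) (leq_maxl K (size (ppoly K)))).
  by apply: eq_bigr => i iK; rewrite coef_ppoly_stable.
rewrite (bigID (fun i : 'I_m => (i < K)%N)) /= addrAC subrr add0r.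
rewrite (le_trans (cmod_sum _ _ _))// ler_pdivlMr ?exprn_gt0//.
apply: le_trans (HB K); rewrite -horner_ppoly lnK// horner_coef mulr_suml.
apply: (@le_trans _ _ (\sum_(i < m) (ppoly K)`_i * (2 * cmod z + 1) ^+ i)).
  rewrite [X in X <= _]big_mkcond; apply: ler_sum => i _.
  have a0 : 0 <= (ppoly K)`_i * (2 * cmod z + 1) ^+ i.
    by rewrite mulr_ge0 ?coef_ppoly_ge0// exprn_ge0// ltW.
  case: ifP => [|_]; last exact: a0.
  rewrite -leqNgt => Ki.
  rewrite cmodM cmodX cmod_real ger0_norm ?coef_ppoly_ge0// -mulrA.
  rewrite ler_wpM2l ?coef_ppoly_ge0//.
  apply: (@le_trans _ _ (cmod z ^+ i * 2 ^+ i)).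
    by rewrite ler_wpM2l ?exprn_ge0 ?cmod_ge0// ler_weXn2l// ler1n.
  by rewrite -exprMn lerXn2r ?nnegrE ?mulr_ge0 ?cmod_ge0 ?(ltW z1)// mulrC lerDl.
rewrite -!(big_mkord xpredT (fun i => (ppoly K)`_i * (2 * cmod z + 1) ^+ i)).
rewrite [leLHS](big_cat_nat (leq0n _) (leq_maxr K _))/=.
rewrite [X in _ + X <= _]big1_seq ?addr0// => i /andP[_].
by rewrite mem_index_iota => /andP[ki _]; rewrite nth_default// mul0r.
Qed.

Lemma pfun_limit_le (u : nat -> R) (C l M : R) (K0 : nat) :
  (forall K, `|l - u K| <= C / 2 ^+ K) -> (forall K, (K0 <= K)%N -> u K <= M) ->
  l <= M.
Proof.
move=> uC uM; rewrite -subr_le0; apply: (@le_geo_le0 _ _ C) => K.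
have C0 : 0 <= C by have := uC 0%N; rewrite expr0 divr1; exact: le_trans.
have := uC (maxn K0 K); have := uM _ (leq_maxl K0 K).
move: (u (maxn K0 K)) => v vM; rewrite ler_norml => /andP[_ h].
have : C / 2 ^+ maxn K0 K <= C / 2 ^+ K.
  rewrite ler_wpM2l// lef_pV2 ?posrE ?exprn_gt0// ler_weXn2l ?ler1n//.
  exact: leq_maxr.
by move: h vM; lra.
Qed.

Lemma pcval_real K t : pcval K (expR t)%:C%C = (pval K t)%:C%C.
Proof.
rewrite /pcval /pval rmorph_prod /=; apply: eq_bigr => k _.
by rewrite -rmorphXn -rmorphM /= pcoef_exp rmorphD rmorph1.
Qed.

(** The restriction of the product to the positive axis in the variable t = log r; it is real and
    equals the maximum modulus on |z| = exp t. *)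
Definition rfun (t : R) : R := complex.Re (pfun (expR t)%:C%C).

Lemma rfun_approx t : exists C, forall K, `|rfun t - pval K t| <= C / 2 ^+ K.
Proof.
have [C HC] := pfun_approx (expR t)%:C%C; exists C => K.
apply: le_trans (HC K); rewrite pcval_real; apply: le_trans (cmod_Re _).
by rewrite raddfB.
Qed.

Lemma rfun_le (t s M : R) (K0 : nat) :
  (forall K, (K0 <= K)%N -> pval K t <= M * pval K s) -> rfun t <= M * rfun s.
Proof.
move=> H; have [C HC] := rfun_approx t; have [C' HC'] := rfun_approx s.
move: (rfun t) (rfun s) HC HC' => a b HC HC'; rewrite -subr_le0.
apply: (@pfun_limit_le (fun K => pval K t - M * pval K s) (C + `|M| * C') _ _ K0).
  move=> K; have -> : a - M * b - (pval K t - M * pval K s) =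
    (a - pval K t) - M * (b - pval K s) by ring.
  rewrite (le_trans (ler_normB _ _))// mulrDl lerD// normrM -mulrA ler_wpM2l//.
by move=> K /H; rewrite subr_le0.
Qed.

Lemma pval_ge1 K t : 1 <= pval K t.
Proof.
elim: K => [|K IH]; first by rewrite /pval big_ord0.
rewrite /pval big_ord_recr /= -/(pval K t) (le_trans IH)// ler_peMr//.
  exact: le_trans IH.
by rewrite lerDl expR_ge0.
Qed.

Lemma rfun_ge1 t : 1 <= rfun t.
Proof.
have [C HC] := rfun_approx t; rewrite -lerN2.
apply: (@pfun_limit_le (fun K => - pval K t) C _ _ 0) => K.
  by rewrite opprK addrC distrC.
by rewrite lerN2 pval_ge1.
Qed.

Lemma pfun_real t : pfun (expR t)%:C%C = (rfun t)%:C%C.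
Proof.
have [C HC] := pfun_approx (expR t)%:C%C.
apply/eqP; rewrite eq_complex /= eqxx /= -normr_le0.
apply: (@le_geo_le0 _ _ C) => K; apply: le_trans (HC K); rewrite pcval_real.
by apply: le_trans (cmod_Im _); rewrite raddfB /= subr0.
Qed.

Lemma cmod_pfun_le t z : cmod z = expR t -> cmod (pfun z) <= rfun t.
Proof.
move=> zt; have [C HC] := pfun_approx z; have [C' HC'] := rfun_approx t.
move: (rfun t) (pfun z) HC HC' => a b HC HC'; rewrite -subr_le0.
apply: (@pfun_limit_le (fun K => cmod (pcval K z) - pval K t) (C + C') _ _ 0) => K.
  have -> : cmod b - a - (cmod (pcval K z) - pval K t) =
    (cmod b - cmod (pcval K z)) - (a - pval K t) by ring.
  rewrite (le_trans (ler_normB _ _))// mulrDl lerD//.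
  exact: le_trans (cmod_dist_le _ _) (HC K).
move=> _; rewrite subr_le0 /pcval cmod_prod; apply: ler_prod => k _.
rewrite cmod_ge0 /= (le_trans (cmod_triangle _ _))// cmod1 lerD2l.
by rewrite cmodM cmodX cmod_real zt gtr0_norm ?pcoef_gt0// pcoef_exp.
Qed.

Lemma pfun_zero k z : z ^+ n k = - ((pcoef k)^-1)%:C%C -> pfun z = 0.
Proof.
move=> zn; have [C HC] := pfun_approx z; apply/eqP; rewrite -cmod_eq0 eq_le cmod_ge0 andbT.
apply: (@pfun_limit_le (fun K => cmod (pcval K z)) C _ _ k.+1) => K.
  exact: le_trans (cmod_dist_le _ _) (HC K).
move=> kK; rewrite /pcval (bigD1 (Ordinal kK)) //= zn mulrN -rmorphM /=.
by rewrite mulfV ?gt_eqF ?pcoef_gt0// rmorph1 subrr mul0r cmod0.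
Qed.

End Product.

(** * Size, growth and zeros of the product *)

Section ProductGrowth.
Variables (R : realType) (n : nat -> nat).
Hypothesis n_gt : forall k, (k < n k)%N.
Hypothesis n_mono : forall k, (n k <= n k.+1)%N.
Hypothesis n_div : forall M : R, exists k, M <= \sum_(j < k) (n j)%:R^-1.

Definition degsum k := (\sum_(j < k.+1) n j)%N.

Variable n0 : nat.

(** With [n0] in the role of N_0 this is S_(k+1). *)
Definition majsum k := (n0 + degsum k)%N.

Hypothesis n_sum : forall k, (n k.+1 <= majsum k)%N.

Local Notation x := (@xlog R n).
Local Notation f := (@pfun R n).
Local Notation r := (@rfun R n).

Let n_gt0 k : (0 : R) < (n k)%:R.
Proof. by rewrite ltr0n; exact: leq_ltn_trans (n_gt k). Qed.

Lemma pcvalS K z : pcval n K.+1 z = pcval n K z * (1 + (@pcoef R n K)%:C%C * z ^+ n K).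
Proof. by rewrite /pcval big_ord_recr. Qed.

Lemma expR2_ge4 : 4 <= expR (2 : R).
Proof.
have -> : (2 : R) = 1 + 1 by [].
rewrite expRD; have := expR_ge1Dx (1 : R); rewrite (_ : 1 + 1 = 2 :> R)//.
by nra.
Qed.

(** For j <= k the exponent n_j (s - log r_j) is at least 2, for j = k + 1 + d it is at most -2 (d +
    1). The factors are thus at least 3 and at least 1 - 4^(-(d+1)) respectively, and 3^(k+1) * 2/3
    >= 3^k. *)
Lemma pfun_circle_ge k z : cmod z = expR (x k + 2 / (n k)%:R) ->
  3 ^+ k <= cmod (f z).
Proof.
set s := x k + _ => zs.
have [C HC] := pfun_approx n_gt n_mono n_div z.
pose y j : R := expR ((n j)%:R * (s - x j)).
have cy j : cmod ((@pcoef R n j)%:C%C * z ^+ n j) = y j.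
  by rewrite cmodM cmodX cmod_real zs gtr0_norm ?pcoef_gt0// pcoef_exp.
have small j : (j <= k)%N -> 3 <= cmod (1 + (@pcoef R n j)%:C%C * z ^+ n j).
  move=> jk; apply: (@le_trans _ _ (y j - 1)); last first.
    have := cmod_triangleB (1 + (@pcoef R n j)%:C%C * z ^+ n j) 1.
    by rewrite addrAC subrr add0r cmod1 cy lerBlDr.
  rewrite lerBrDr (_ : 3 + 1 = 4 :> R); last by ring.
  rewrite (le_trans expR2_ge4)//.
  rewrite ler_expR mulrC -ler_pdivrMr//.
  move: jk; rewrite leq_eqVlt => /predU1P[->|jk].
    by rewrite /s addrAC subrr add0r.
  have := @xlog_gap_ltn R n _ _ jk; rewrite /s.
  have : 0 < 2 / (n k)%:R :> R by rewrite divr_gt0.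
  have : 0 < 2 / (n j)%:R :> R by rewrite divr_gt0.
  have -> : 4 / (n j)%:R = 2 / (n j)%:R + 2 / (n j)%:R :> R.
    by rewrite -mulrDl -natrD.
  by move: (2 / _) (2 / _) => a b; lra.
have large d : 1 - (1 / 4) ^+ d.+1 <=
    cmod (1 + (@pcoef R n (k.+1 + d)%N)%:C%C * z ^+ n (k.+1 + d)%N).
  set j := (k.+1 + d)%N; apply: (@le_trans _ _ (1 - y j)); last first.
    have := cmod_triangleB (1 + (@pcoef R n j)%:C%C * z ^+ n j)
      ((@pcoef R n j)%:C%C * z ^+ n j).
    by rewrite addrK cmod1 cy lerBlDr.
  rewrite lerD2l lerN2.
  apply: (@le_trans _ _ (expR (- (2 * d.+1%:R)))).
    have kj : (k.+1 <= j)%N by rewrite /j leq_addr.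
    have := @xlog_gap_ge R n n_gt n_mono _ _ kj.
    have -> : (j - k.+1)%N = d by rewrite /j addKn.
    have : 2 / (n j)%:R <= 2 / (n k)%:R :> R.
      by rewrite ler_wpM2l// lef_pV2 ?posrE// ler_nat n_le// ltnW.
    rewrite ler_expR xlogS /s.
    have -> : 4 / (n k)%:R = 2 / (n k)%:R + 2 / (n k)%:R :> R.
      by rewrite -mulrDl -natrD.
    rewrite !ler_pdivrMr// -[d.+1%:R]natr1; move: (n_gt0 j).
    have : 0 <= d%:R :> R by [].
    by move: (2 / _) (n j)%:R (x j) (x k) d%:R => q m u v e; nra.
  rewrite mulrC -mulrN expRM_natl lerXn2r ?nnegrE ?expR_ge0 ?divr_ge0//.
  by rewrite expRN div1r lef_pV2 ?posrE ?expR_gt0// expR2_ge4.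
(* The extra term 4^(-d) / 3 closes the induction: (2/3 + q/3)(1 - q/4) >= 2/3 + q/12 for 0 <= q <=
   1. *)
have main d : 3 ^+ k.+1 * (2 / 3 + (1 / 4) ^+ d / 3) <= cmod (pcval n (k.+1 + d) z).
  elim: d => [|d IH].
    rewrite addn0 expr0 (_ : 2 / 3 + 1 / 3 = 1 :> R); last by field.
    rewrite mulr1 /pcval cmod_prod.
    have -> : (3 : R) ^+ k.+1 = \prod_(j < k.+1) 3.
      by rewrite prodr_const card_ord.
    by apply: ler_prod => j _; rewrite ler0n /=; apply: small; rewrite -ltnS.
  rewrite addnS pcvalS cmodM.
  have := large d; rewrite exprS.
  have : 0 <= (1 / 4 : R) ^+ d by rewrite exprn_ge0// divr_ge0.
  have : (1 / 4 : R) ^+ d <= 1.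
    by rewrite exprn_ile1 ?divr_ge0// ler_pdivrMr// mul1r ler1n.
  move: IH; move: ((1 / 4) ^+ d) (cmod (pcval _ _ _)) (cmod (1 + _)) => q p w IH q1 q0 wq.
  have A0 : 0 < 3 ^+ k.+1 :> R by rewrite exprn_gt0.
  move: (3 ^+ k.+1) A0 IH => A A0 IH.
  apply: (@le_trans _ _ (A * (2 / 3 + q / 3) * (1 - 1 / 4 * q))).
    by rewrite -[leRHS]mulrA ler_wpM2l ?(ltW A0)//; nra.
  by rewrite ler_pM// ?mulr_ge0 ?(ltW A0)//; nra.
have : - cmod (f z) <= - (3 ^+ k).
  apply: (@pfun_limit_le _ (fun K => - cmod (pcval n K z)) C _ _ k.+1) => K.
    rewrite -opprD normrN; exact: le_trans (cmod_dist_le _ _) (HC K).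
  move=> /subnKC <-; rewrite lerN2; apply: le_trans (main _).
  rewrite exprS mulrAC -[leLHS]mul1r ler_wpM2r ?exprn_ge0//.
  have : 0 <= (1 / 4 : R) ^+ (K - k.+1) by rewrite exprn_ge0// divr_ge0.
  by move: (_ ^+ _) => q; lra.
by rewrite lerN2.
Qed.

Lemma degsumS k : degsum k.+1 = (degsum k + n k.+1)%N.
Proof. by rewrite /degsum big_ord_recr. Qed.

Lemma majsum_double k d : (majsum (k + d) <= 2 ^ d * majsum k)%N.
Proof.
elim: d => [|d IH]; first by rewrite addn0 mul1n.
rewrite addnS /majsum degsumS addnA expnS -mulnA mul2n -addnn leq_add//.
exact: leq_trans (n_sum _) IH.
Qed.

(** A factor 1 + exp(a) of degree m has logarithmic derivative m exp(a) / (1 + exp(a)) in t. This is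
    at most m, at most m c where exp(a) <= c, and at least m / 2 where a >= 0; this lemma and the
    next two are the integrated forms, with b the increment of a. *)
Lemma factor_growth_le (a b : R) : 0 <= b -> 1 + expR (a + b) <= expR b * (1 + expR a).
Proof.
move=> b0; rewrite mulrDr mulr1 -expRD addrC [a + b]addrC addrC lerD2r.
by have := expR_ge1Dx b; lra.
Qed.

Lemma factor_growth_le_small (a b c : R) : 0 <= b -> expR (a + b) <= c ->
  1 + expR (a + b) <= expR (b * c) * (1 + expR a).
Proof.
move=> b0 ac; have a0 := expR_gt0 a.
have h1 : expR (a + b) - expR a <= b * expR (a + b).
  have -> : expR a = expR (a + b) * expR (- b) by rewrite -expRD addrK.
  by have := expR_ge1Dx (- b); have := expR_gt0 (a + b); nra.
have h2 := expR_ge1Dx (b * c).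
have h3 : b * expR (a + b) <= b * c by rewrite ler_wpM2l.
have h4 : 0 <= b * c by rewrite mulr_ge0// (le_trans (expR_ge0 _) ac).
by move: h1 h2 h3 h4 a0; move: (expR (a + b)) (expR a) (expR (b * c)) (b * c) => *; nra.
Qed.

Lemma factor_growth_ge (a b : R) : 0 <= a -> 0 <= b ->
  expR (b / 2) * (1 + expR a) <= 1 + expR (a + b).
Proof.
move=> a0 b0.
have -> : expR (a + b) = expR a * expR (b / 2) * expR (b / 2).
  by rewrite -!expRD; congr expR; field.
have h1 : 1 <= expR a by rewrite -expR0 ler_expR.
have h2 : 1 <= expR (b / 2) by rewrite -expR0 ler_expR divr_ge0.
move: (expR a) (expR (b / 2)) h1 h2 => u v h1 h2; rewrite -subr_ge0.
rewrite (_ : _ - _ = (u * v - 1) * (v - 1)); last by ring.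
by rewrite mulr_ge0 ?subr_ge0// mulr_ege1.
Qed.

(** The factors up to index k + 1 contribute at most their degrees, in total at most [majsum k.+1].
    The factor of index k + 2 + d has degree at most 2^d [majsum k.+1] and weight at most
    4^(-(d+1)), so these contribute at most the same amount again. *)
Lemma rfun_growth_le k t h : 0 <= h -> t + h <= x k.+1 ->
  r (t + h) <= expR (h * (2 * (majsum k.+1)%:R)) * r t.
Proof.
move=> h0 th; apply: (@rfun_le _ _ n_gt n_mono n_div _ _ _ k.+2) => K.
have pS m s : pval n m.+1 s = pval n m s * (1 + expR ((n m)%:R * (s - x m))).
  by rewrite /pval big_ord_recr.
have p0 m s : 0 <= pval n m s by apply: le_trans (pval_ge1 _ _ _).
have base m : pval n m (t + h) <= expR (h * (\sum_(j < m) n j)%N%:R) * pval n m t.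
  elim: m => [|m IH]; first by rewrite /pval !big_ord0 mulr0 expR0 mulr1.
  rewrite !pS big_ord_recr /= natrD [h * (_ + _)]mulrDr expRD mulrACA.
  apply: ler_pM; [exact: p0|by rewrite addr_ge0// expR_ge0|exact: IH|].
  rewrite addrAC mulrDr [h * _]mulrC; apply: factor_growth_le.
  by rewrite mulr_ge0// ltW.
move=> /subnKC <-.
suff H d : pval n (k.+2 + d) (t + h) <=
    expR (h * ((2 - (1 / 2) ^+ d) * (majsum k.+1)%:R)) * pval n (k.+2 + d) t.
  apply: (le_trans (H _)); rewrite ler_wpM2r ?p0// ler_expR ler_wpM2l//.
  by rewrite ler_wpM2r// gerBl exprn_ge0// divr_ge0.
elim: d => [|d IH].
  rewrite addn0 expr0 (_ : 2 - 1 = 1 :> R) ?mul1r; last by ring.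
  apply: (le_trans (base _)); rewrite ler_wpM2r ?p0// ler_expR ler_wpM2l//.
  by rewrite ler_nat leq_addl.
rewrite addnS; set j := (k.+2 + d)%N in IH *; rewrite !(pS j).
have fac : 1 + expR ((n j)%:R * (t + h - x j)) <=
    expR (h * ((1 / 2) ^+ d.+1 * (majsum k.+1)%:R)) * (1 + expR ((n j)%:R * (t - x j))).
  rewrite addrAC mulrDr.
  have e4 : expR ((n j)%:R * (t - x j) + (n j)%:R * h) <= (1 / 4) ^+ d.+1.
    rewrite -mulrDr; apply: (@le_trans _ _ (expR (- (2 * d.+1%:R)))).
      have kj : (k.+1 <= j)%N by rewrite /j addSn ltnW// ltnS leq_addr.
      have := @xlog_gap_ge R n n_gt n_mono _ _ kj.
      have -> : (j - k.+1)%N = d.+1 by rewrite /j addSnnS addKn.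
      rewrite ler_expR ler_pdivrMr// => g1.
      have : (x j - x k.+1) * (n j)%:R <= (x j - (t + h)) * (n j)%:R.
        by rewrite ler_wpM2r ?(ltW (n_gt0 _))// lerD2l lerN2.
      have : 0 <= d.+1%:R :> R by [].
      by move: g1; move: (n j)%:R (x j) (x k.+1) d.+1%:R => m u v e; nra.
    rewrite mulrC -mulrN expRM_natl lerXn2r ?nnegrE ?expR_ge0 ?divr_ge0//.
    by rewrite expRN div1r lef_pV2 ?posrE ?expR_gt0// expR2_ge4.
  have nh0 : 0 <= (n j)%:R * h by rewrite mulr_ge0// ltW.
  apply: (le_trans (factor_growth_le_small nh0 e4)).
  rewrite ler_wpM2r ?addr_ge0 ?expR_ge0// ler_expR [_ * h]mulrC -mulrA ler_wpM2l//.
  have nj : (n j)%:R <= 2 ^+ d * (majsum k.+1)%:R :> R.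
    rewrite -natrX -natrM ler_nat /j addSn.
    exact: leq_trans (n_sum _) (majsum_double _ _).
  apply: (@le_trans _ _ (2 ^+ d * (majsum k.+1)%:R * (1 / 4) ^+ d.+1)).
    by rewrite ler_wpM2r// exprn_ge0// divr_ge0.
  rewrite mulrAC ler_wpM2r// !exprS mulrCA -exprMn.
  rewrite (_ : 2 * (1 / 4) = 1 / 2 :> R); last by field.
  by rewrite ler_wpM2r ?exprn_ge0 ?divr_ge0// ler_pM2l// lef_pV2 ?posrE// ler_nat.
have -> : h * ((2 - (1 / 2) ^+ d.+1) * (majsum k.+1)%:R) =
    h * ((2 - (1 / 2) ^+ d) * (majsum k.+1)%:R) +
    h * ((1 / 2) ^+ d.+1 * (majsum k.+1)%:R) by rewrite exprS; field.
rewrite expRD mulrACA.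
by apply: ler_pM; [exact: p0|rewrite addr_ge0// expR_ge0|exact: IH|exact: fac].
Qed.

(** Beyond log r_k each factor up to index k contributes at least half its degree, and the remaining
    factors are nondecreasing. *)
Lemma rfun_growth_ge k t h : 0 <= h -> x k <= t ->
  expR (h * ((degsum k)%:R / 2)) * r t <= r (t + h).
Proof.
move=> h0 kt; rewrite -ler_pdivlMl ?expR_gt0// -expRN.
apply: (@rfun_le _ _ n_gt n_mono n_div _ _ _ k.+1) => K.
have pS m s : pval n m.+1 s = pval n m s * (1 + expR ((n m)%:R * (s - x m))).
  by rewrite /pval big_ord_recr.
have p0 m s : 0 <= pval n m s by apply: le_trans (pval_ge1 _ _ _).
rewrite expRN ler_pdivlMl ?expR_gt0//.
have base m : (m <= k.+1)%N ->
    expR (h * ((\sum_(j < m) n j)%N%:R / 2)) * pval n m t <= pval n m (t + h).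
  elim: m => [|m IH] mk; first by rewrite /pval !big_ord0 mul0r mulr0 expR0 mulr1.
  rewrite !pS big_ord_recr /= natrD mulrDl [h * (_ + _)]mulrDr expRD mulrACA.
  apply: ler_pM.
  - by rewrite mulr_ge0 ?expR_ge0 ?p0.
  - by rewrite mulr_ge0 ?expR_ge0// addr_ge0// expR_ge0.
  - by apply: IH; exact: ltnW.
  have -> : (n m)%:R * (t + h - x m) = (n m)%:R * (t - x m) + (n m)%:R * h by ring.
  rewrite (_ : h * ((n m)%:R / 2) = (n m)%:R * h / 2); last by field.
  apply: factor_growth_ge.
    by rewrite mulr_ge0 ?(ltW (n_gt0 _))// subr_ge0 (le_trans _ kt)// xlog_le.
  by rewrite mulr_ge0// ltW.
move=> /subnKC <-; elim: (K - k.+1)%N => [|d IH]; first by rewrite addn0; exact: base.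
rewrite addnS; set j := (k.+1 + d)%N in IH *; rewrite !(pS j) mulrA; apply: ler_pM.
- by rewrite mulr_ge0 ?expR_ge0 ?p0.
- by rewrite addr_ge0// expR_ge0.
- exact: IH.
- by rewrite lerD2l ler_expR ler_wpM2l ?(ltW (n_gt0 _))// lerD2r lerDl.
Qed.

Lemma rfun_le_mono (s t : R) : s <= t -> r s <= r t.
Proof.
move=> st; rewrite -[r t]mul1r; apply: (@rfun_le _ _ n_gt n_mono n_div _ _ _ 0) => K _.
rewrite mul1r; apply: ler_prod => k _; rewrite addr_ge0 ?expR_ge0//=.
by rewrite lerD2l ler_expR ler_wpM2l ?(ltW (n_gt0 _))// lerD2r.
Qed.

Lemma rfun_is_derive (t : R) : exists l : R, is_derive t 1 r l.
Proof.
have aE := entire_seq_aseq n_gt n_mono n_div.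
have h1 : curve_derive (fun s : R => (expR s)%:C%C : Cplane R) t (expR t)%:C%C.
  have := curve_derive_comp (@curve_derive_line R 1 (expR t)) (is_derive_expR t).
  rewrite mulr1; congr (curve_derive _ _ _); apply/funext => v; exact: mulr1.
by eexists; exact: curve_derive_Re (curve_derive_ev aE h1).
Qed.

Lemma cis_pi_odd j : cis (pi * (2 * j%:R + 1)) = -1 :> Cplane R.
Proof.
have c1 : cis pi = -1 :> Cplane R by rewrite /cis cospi sinpi; apply/eqP; rewrite eq_complex /= oppr0 !eqxx.
rewrite mulrDr mulr1 cisD c1 (_ : pi * (2 * j%:R) = (2 * j)%N%:R * pi :> R).
  by rewrite -cisX c1 exprM sqrrN expr1n expr1n mul1r.
by rewrite natrM mulrC.
Qed.

(** The n_k-th roots of -1 are 2 pi / n_k apart in angle, so one is within pi / n_k <= 4 / n_k of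
    the direction of [z]; [cis_lipschitz] doubles this to 8 / n_k. *)
Lemma root_near k z : 0 < cmod z -> exists w : Cplane R,
  [/\ cmod w = 1, w ^+ n k = -1 & cmod ((cmod z)%:C%C * w - z) <= 8 / (n k)%:R * cmod z].
Proof.
move=> z0; have [a api za] := polar z.
have p0 : 0 < pi :> R by exact: pi_gt0.
have p4 : pi <= 4 :> R by have /andP[_] := pihalf_02 R; lra.
(* The shift makes the angle nonnegative, so that [Num.trunc] acts as the integer part. *)
pose a' := a + pi * 2.
have a'0 : 0 <= a' by move: api; rewrite ler_norml /a' => /andP[? _]; lra.
have ca : cis a' = cis a.
  rewrite /a' cisD (mulrC pi) -cisX.
  have := cis_pi_odd 0; rewrite mulr0 add0r mulr1 => ->.
  by rewrite sqrrN expr1n mulr1.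
pose m := Num.trunc (a' * (n k)%:R / (2 * pi)).
have m0 : 0 <= a' * (n k)%:R / (2 * pi).
  by rewrite divr_ge0// mulr_ge0 ?(ltW p0)// ltW.
have /andP[m1 m2] := truncn_itv m0.
(* The midpoint of the interval from 2 pi m / n_k to 2 pi (m + 1) / n_k, which contains [a']. *)
pose b : R := pi * (2 * m%:R + 1) / (n k)%:R.
exists (cis b); split; first exact: cmod_cis.
  by rewrite cisX /b mulrC divfK ?gt_eqF// cis_pi_odd.
rewrite {2}za -ca -mulrBr cmodM cmod_real (ger0_norm (cmod_ge0 z)) mulrC.
rewrite ler_wpM2r ?cmod_ge0// (le_trans (cis_lipschitz _ _))//.
have ab : `|b - a'| <= pi / (n k)%:R.
  have nn : (n k)%:R != 0 :> R by rewrite gt_eqF.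
  have -> : b - a' = (pi * (2 * m%:R + 1) - a' * (n k)%:R) / (n k)%:R.
    by rewrite mulrBl mulfK.
  rewrite normrM.
  rewrite [`|_^-1|]gtr0_norm ?invr_gt0// ler_wpM2r ?invr_ge0 ?(ltW (n_gt0 _))//.
  move: m1 m2; rewrite -/m ler_pdivlMr ?mulr_gt0// ltr_pdivrMr ?mulr_gt0//.
  rewrite -natr1 ler_norml => h1 h2; apply/andP; split; lra.
have -> : 8 / (n k)%:R = 2 * (4 / (n k)%:R) :> R by field; rewrite gt_eqF.
rewrite ler_wpM2l// (le_trans ab)// ler_wpM2r ?invr_ge0// ltW//.
Qed.

(** The constant 12 is 8 for the angle, from [root_near], plus 4 for the radius, since |z| - r_k <=
    |z| (log |z| - log r_k) <= 4 |z| / n_k. *)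
Lemma pfun_near_zero k z : 0 < cmod z ->
  x k <= ln (cmod z) -> ln (cmod z) <= x k.+1 ->
  exists w, [/\ f w = 0, cmod w = expR (x k) &
    cmod (w - z) <= 12 / (n k)%:R * cmod z].
Proof.
move=> z0 kz zk; have [w [w1 wn wz]] := root_near k z0.
exists ((expR (x k))%:C%C * w); split.
- apply: (@pfun_zero _ _ n_gt n_mono n_div k).
  rewrite exprMn wn mulrN1 /pcoef expRN invrK -rmorphXn /=.
  by rewrite expRM_natl.
- by rewrite cmodM w1 mulr1 cmod_real gtr0_norm// expR_gt0.
have -> : (expR (x k))%:C%C * w - z =
    ((cmod z)%:C%C * w - z) + (expR (x k) - cmod z)%:C%C * w.
  by rewrite rmorphB /=; ring.
have -> : 12 / (n k)%:R * cmod z = 8 / (n k)%:R * cmod z + 4 / (n k)%:R * cmod z.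
  by rewrite -!mulrDl -natrD.
rewrite (le_trans (cmod_triangle _ _))// lerD// cmodM w1 mulr1 cmod_real.
have zE : cmod z = expR (ln (cmod z)) by rewrite lnK.
rewrite ler0_norm ?opprB; last by rewrite subr_le0 zE ler_expR.
have -> : expR (x k) = cmod z * expR (x k - ln (cmod z)).
  by rewrite {1}zE -expRD addrC subrK.
have := expR_ge1Dx (x k - ln (cmod z)).
have : ln (cmod z) - x k <= 4 / (n k)%:R by rewrite lerBlDl -xlogS.
set E := expR _; set q := 4 / _; set l := ln _.
by move: z0; move: (cmod z) E q l (x k) => y E q l u; nra.
Qed.

End ProductGrowth.

(** * The direct tract of the product and its growth *)

Section ProductTract.
Variables (R : realType) (n : nat -> nat).
Hypothesis n_gt : forall k, (k < n k)%N.
Hypothesis n_mono : forall k, (n k <= n k.+1)%N.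
Hypothesis n_div : forall M : R, exists k, M <= \sum_(j < k) (n j)%:R^-1.
Variable n0 : nat.
Hypothesis n_sum : forall k, (n k.+1 <= majsum n n0 k)%N.

Local Notation x := (@xlog R n).
Local Notation f := (@pfun R n).
Local Notation r := (@rfun R n).

(* On the circles of radius [expR (slog k)] the modulus of the product is large. *)
Definition slog k : R := x k + 2 / (n k)%:R.

Let aE : entire_seq (@aseq R n) := entire_seq_aseq n_gt n_mono n_div.

Let fc : continuous f := continuous_ev aE.

Lemma x_slog k : x k <= slog k.
Proof. by rewrite lerDl divr_ge0. Qed.

Lemma x_eventually (M : R) : exists k0, forall k, (k0 <= k)%N -> M <= x k.
Proof.
have [k0 Hk0] := xlog_unbounded n_div M; exists k0 => k k0k.
by rewrite (le_trans Hk0)// xlog_le.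
Qed.

Lemma exp3_eventually (rho : R) : exists k0, forall k, (k0 <= k)%N -> rho < 3 ^+ k.
Proof.
exists (Num.bound `|rho|) => k bk; apply: (le_lt_trans (ler_norm _)).
apply: (lt_le_trans (archi_boundP (normr_ge0 _))).
apply: (@le_trans _ _ k%:R); first by rewrite ler_nat.
by rewrite -natrX ler_nat ltnW// ltn_expl.
Qed.

Lemma connected_circle (s : R) : connected [set z : Cplane R | cmod z = expR s].
Proof.
have -> : [set z : Cplane R | cmod z = expR s] =
    (fun a => 0 + (expR s)%:C%C * cis a) @` `[- pi, pi].
  apply/seteqP; split=> [z /= zs|_ /= [a _ <-]].
    have [a api za] := polar z; exists a; first by rewrite /= in_itv/= -ler_norml.
    by rewrite add0r -zs -za.
  by rewrite add0r cmodM cmod_cis cmod_real mulr1 gtr0_norm// expR_gt0.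
by apply: connected_segment_image; exact: continuous_circle.
Qed.

Lemma continuous_exp_real : continuous (fun t : R => (expR t)%:C%C : Cplane R).
Proof.
move=> t; apply: (@continuous_comp _ _ _ expR (fun t : R => t%:C%C : Cplane R)).
  exact: continuous_expR.
exact: continuous_real_complex.
Qed.

Lemma cmod_pfun_real t : cmod (f (expR t)%:C%C) = r t.
Proof.
rewrite (pfun_real n_gt n_mono n_div) cmod_real ger0_norm//.
by rewrite (le_trans ler01)// rfun_ge1.
Qed.

Lemma rfun_slog_gt (rho : R) k t : rho < 3 ^+ k -> slog k <= t -> rho < r t.
Proof.
move=> rk kt; apply: (lt_le_trans rk).
apply: (@le_trans _ _ (r (slog k))); last exact: rfun_le_mono.
have <- := cmod_pfun_real (slog k).
apply: (pfun_circle_ge n_gt n_mono n_div).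
by rewrite cmod_real gtr0_norm// expR_gt0.
Qed.

Lemma absorbing_ray (rho : R) D k t : absorbing f rho D -> rho < 3 ^+ k ->
  D (expR (slog k))%:C%C -> slog k <= t -> D (expR t)%:C%C.
Proof.
move=> [_ _ Dabs] rk Dk kt.
apply: (Dabs ((fun s : R => (expR s)%:C%C) @` `[slog k, t])).
- by apply: connected_segment_image; exact: continuous_exp_real.
- move=> _ [s + <-]; rewrite /= in_itv/= => /andP[ks _].
  by rewrite cmod_pfun_real; exact: rfun_slog_gt rk ks.
- exists (expR (slog k))%:C%C; split=> //; exists (slog k) => //.
  by rewrite /= in_itv/= lexx kt.
- by exists t => //; rewrite /= in_itv/= lexx kt.
Qed.

Lemma tract_ray (rho : R) D : absorbing f rho D -> connected D -> ~ bounded_set D ->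
  exists X, forall t, X <= t -> D (expR t)%:C%C.
Proof.
move=> aD Dc Dub; have [Do DU Dabs] := aD.
have unb (M : R) : exists2 z, D z & M < cmod z.
  apply: contrapT => H; apply: Dub; apply/bounded_cmodP; exists M => z Dz.
  by rewrite leNgt; apply/negP => Mz; apply: H; exists z.
have [z0 Dz0 z01] := unb 0.
have [k0 Hk0] := exp3_eventually rho; have [k1 Hk1] := x_eventually (ln (cmod z0)).
(* Large enough both for the circle to lie in {|f| > rho} and for it to have the point [z0] of [D]
   in its closed disk; by connectedness |z| then takes the value of its radius on [D]. *)
pose k := maxn k0 k1.
have rk : rho < 3 ^+ k by apply: Hk0; exact: leq_maxl.
have z0k : cmod z0 <= expR (slog k).
  rewrite -[leLHS]lnK// ler_expR (le_trans _ (x_slog k))//.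
  by apply: Hk1; exact: leq_maxr.
have [z1 Dz1 z1k] := unb (expR (slog k)).
have ci : connected ((@cmod R) @` D).
  apply: connected_continuous_connected => //.
  by apply: continuous_subspaceT; exact: continuous_cmod.
have /(_ (cmod z0) (cmod z1)) := (connected_intervalP _).1 ci.
move=> /(_ (ex_intro2 _ _ _ Dz0 erefl) (ex_intro2 _ _ _ Dz1 erefl)).
move=> /(_ (expR (slog k))); rewrite z0k (ltW z1k) => /(_ isT)[z2 Dz2 z2k].
have Dk : D (expR (slog k))%:C%C.
  apply: (Dabs [set z | cmod z = expR (slog k)]).
  - exact: connected_circle.
  - move=> z zk; apply: (lt_le_trans rk).
    exact: (pfun_circle_ge n_gt n_mono n_div).
  - by exists z2.
  - by rewrite /= cmod_real gtr0_norm// expR_gt0.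
exists (slog k) => t; exact: absorbing_ray aD rk Dk.
Qed.

Lemma direct_tract_ray (rho : R) D : direct_tract f rho D ->
  exists X, forall t, X <= t -> D (expR t)%:C%C.
Proof.
move=> tD; have [[_ Dc Dub] _ _ _ _] := tD.
exact: tract_ray (direct_tract_absorbing tD) Dc Dub.
Qed.

Lemma direct_tract_unique (rho : R) D1 D2 :
  direct_tract f rho D1 -> direct_tract f rho D2 -> D1 = D2.
Proof.
move=> t1 t2; have [X1 H1] := direct_tract_ray t1; have [X2 H2] := direct_tract_ray t2.
have [_ U1 A1] := direct_tract_absorbing t1.
have [_ U2 A2] := direct_tract_absorbing t2.
have [[_ c1 _] _ _ _ _] := t1; have [[_ c2 _] _ _ _ _] := t2.
have m1 : D1 (expR (Num.max X1 X2))%:C%C by apply: H1; rewrite le_max lexx.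
have m2 : D2 (expR (Num.max X1 X2))%:C%C by apply: H2; rewrite le_max lexx orbT.
apply/seteqP; split.
  by apply: (A2 D1 c1 U1); exists (expR (Num.max X1 X2))%:C%C.
by apply: (A1 D2 c2 U2); exists (expR (Num.max X1 X2))%:C%C.
Qed.

Lemma pfun_nonconst p : exists z, f z != f p.
Proof.
have [k Hk] := exp3_eventually (cmod (f p)).
have h : 3 ^+ k <= cmod (f (expR (slog k))%:C%C).
  apply: (pfun_circle_ge n_gt n_mono n_div).
  by rewrite cmod_real gtr0_norm// expR_gt0.
exists (expR (slog k))%:C%C; apply/negP => /eqP fE.
by have := Hk k (leqnn k); rewrite -fE ltNge h.
Qed.

Lemma component_absorbing (rho : R) z0 :
  absorbing f rho (connected_component [set z | rho < cmod (f z)] z0).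
Proof.
set U := [set z | _]; set D := connected_component U z0.
have DU : D `<=` U by exact: connected_component_sub.
have same z : D z -> D = connected_component U z.
  by move=> Dz; exact: same_connected_component.
split=> //.
  rewrite openE => z Dz; rewrite /interior.
  have [e e0 He] := near_cmod_gt fc (DU z Dz).
  apply/nbhs_cmodP; exists e => // w wz; rewrite (same z Dz).
  apply: (@connected_component_max _ U [set w | cmod (w - z) < e]) => //.
  - by rewrite /= subrr cmod0.
  - exact: connected_cdisk.
by move=> C Cc CU [z [Cz Dz]]; rewrite (same z Dz); exact: connected_component_max.
Qed.

Lemma direct_tract_exists (rho : R) : 0 < rho -> exists D, direct_tract f rho D.
Proof.
move=> rho0; have [k Hk] := exp3_eventually rho.
have rk := Hk k (leqnn k).
pose z0 : Cplane R := (expR (slog k))%:C%C.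
pose D := connected_component [set z | rho < cmod (f z)] z0.
have aD : absorbing f rho D by exact: component_absorbing.
have Dz0 : D z0.
  by apply: connected_component_refl; rewrite /= cmod_pfun_real; apply: rfun_slog_gt rk _.
have [Do DU _] := aD.
exists D; split.
- split=> //; first exact: component_connected.
  move=> /bounded_cmodP[M HM].
  pose t := Num.max (slog k) (M + 1).
  have Dt : D (expR t)%:C%C by apply: absorbing_ray aD rk Dz0 _; rewrite le_max lexx.
  have := HM _ Dt; rewrite cmod_real gtr0_norm ?expR_gt0// leNgt => /negP; apply.
  apply: (@lt_le_trans _ _ (1 + t)); last exact: expR_ge1Dx.
  have : M + 1 <= t by rewrite le_max lexx orbT.
  move=> Mt; apply: (@lt_le_trans _ _ (M + 1)); first by rewrite ltrDl.
  by rewrite (le_trans Mt)// lerDr.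
- exact: (@level_boundary_curves _ _ _ aE pfun_nonconst rho0 _ aD).
(* The complement contains the zeros, whose moduli exp(x_j) are unbounded. *)
- move=> /bounded_cmodP[M HM].
  have [j Hj] := xlog_unbounded n_div (`|M| + 1).
  have z0' : 0 < cmod ((expR (x j))%:C%C : Cplane R).
    by rewrite cmod_real gtr0_norm expR_gt0.
  have l : ln (cmod ((expR (x j))%:C%C : Cplane R)) = x j.
    by rewrite cmod_real gtr0_norm ?expR_gt0// expRK.
  have [||w [w0 wm _]] := pfun_near_zero n_gt n_mono n_div (k := j) z0'.
  - by rewrite l.
  - by rewrite l xlog_le.
  have nDw : ~ D w by move=> Dw; have := DU w Dw; rewrite w0 cmod0 ltNge (ltW rho0).
  have := HM w nDw; rewrite wm leNgt => /negP; apply; apply: (lt_le_trans _ (expR_ge1Dx _)).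
  apply: (@le_lt_trans _ _ `|M|); first exact: ler_norm.
  by rewrite (lt_le_trans (_ : _ < `|M| + 1)) ?ltrDl// (le_trans Hj)// lerDr.
- by split=> [z _|]; [exact: derivable_ev|exact: continuous_subspaceT].
- split; [exact: rho0| |exact: DU].
  by move=> z bz; exact: (absorbing_boundary fc aD bz).
Qed.

Lemma has_one_tract : has_exactly_one_direct_tract f.
Proof.
move=> rho rho0; have [D tD] := direct_tract_exists rho0.
by exists D; split=> // D' tD'; exact: direct_tract_unique tD tD'.
Qed.

Lemma max_modulus_ray (D : set (Cplane R)) t : D (expR t)%:C%C ->
  max_modulus (expR t) f D = r t.
Proof.
move=> Dt; rewrite /max_modulus; set A := [set _ | _ in _].
have At : A (r t).
  exists (expR t)%:C%C; last exact: cmod_pfun_real.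
  by split=> //; rewrite cmod_real gtr0_norm// expR_gt0.
have ub : ubound A (r t).
  by move=> _ [z [zt _] <-]; exact: (cmod_pfun_le n_gt n_mono n_div).
apply/eqP; rewrite eq_le; apply/andP; split.
  by apply: ge_sup => //; exists (r t).
by apply: ub_le_sup => //; exists (r t).
Qed.

(** [lim] is informative only once convergence is known, and the derivative of [u] supplies it.
    Agreement of [v] with [u] is asked to the right of t only, because a tract is known to contain
    just a half-line. *)
Lemma right_slope_bounds (u v : R -> R) (t l a b d : R) :
  is_derive t 1 u l -> 0 < d -> (forall h, 0 <= h -> v (t + h) = u (t + h)) ->
  (forall h, 0 < h -> h < d -> a * h <= u (t + h) - u t <= b * h) ->
  a <= lim ((v (t + h) - v t) / h @[h --> 0^'+]) <= b.
Proof.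
move=> ul d0 vu H.
have vu0 : v t = u t by rewrite -[t]addr0; exact: vu.
have cv : (v (t + h) - v t) / h @[h --> 0^'+] --> l.
  have /slope_cvg/cvgrPdist_lt H1 := ul.
  apply/cvgrPdist_lt => e e0; have := H1 e e0 => /nbhs_ballP[c /= c0 Hc].
  near=> h; have h0 : 0 < h by near: h; exact: nbhs_right_gt.
  have hc : h < c by near: h; exact: nbhs_right_lt.
  have := Hc (t + h); rewrite /ball/= opprD addNKr normrN gtr0_norm// => /(_ hc).
  have e1 : t + h - t = h by rewrite addrAC subrr add0r.
  rewrite e1 vu0 vu; last exact: ltW.
  by apply; rewrite -subr_eq0 e1 gt_eqF.
have cvl : cvg ((v (t + h) - v t) / h @[h --> 0^'+]) by apply/cvg_ex; exists l.
apply/andP; split.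
  apply: limr_ge => //; near=> h.
  have h0 : 0 < h by near: h; exact: nbhs_right_gt.
  have hd : h < d by near: h; exact: nbhs_right_lt.
  rewrite ler_pdivlMr// vu0 vu; last exact: ltW.
  by have /andP[] := H h h0 hd.
apply: limr_le => //; near=> h.
have h0 : 0 < h by near: h; exact: nbhs_right_gt.
have hd : h < d by near: h; exact: nbhs_right_lt.
rewrite ler_pdivrMr// vu0 vu; last exact: ltW.
by have /andP[] := H h h0 hd.
Unshelve. all: by end_near. Qed.

Lemma growth_slope_bounds (D : set (Cplane R)) X k t :
  (forall s, X <= s -> D (expR s)%:C%C) -> X <= t -> x k <= t -> t < x k.+1 ->
  (degsum n k)%:R / 2 <= growth_slope (expR t) f D <= 2 * (majsum n n0 k.+1)%:R.
Proof.
move=> HX Xt kt tk.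
have r0 s : 0 < r s by apply: lt_le_trans ltr01 _; exact: rfun_ge1.
have [l rl] := rfun_is_derive n_gt n_mono n_div t.
have ul := is_derive1_comp (is_derive1_ln (r0 t)) rl.
rewrite /growth_slope expRK.
apply: (right_slope_bounds (v := fun s => ln (max_modulus (expR s) f D)) ul
  (_ : 0 < x k.+1 - t)); first by rewrite subr_gt0.
  by move=> h h0 /=; rewrite max_modulus_ray//; apply: HX; rewrite (le_trans Xt)// lerDl.
move=> h h0 hd /=.
have A := rfun_growth_ge n_gt n_mono n_div (ltW h0) kt.
have th : t + h <= x k.+1 by rewrite addrC -lerBrDr ltW.
have B := rfun_growth_le n_gt n_mono n_div n_sum (ltW h0) th.
move: (r t) (r (t + h)) (r0 t) (r0 (t + h)) A B => p q p0 q0 A B.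
have e0 y : 0 < expR y * p by rewrite mulr_gt0 ?expR_gt0.
have lnE y : ln (expR y * p) = y + ln p by rewrite lnM ?posrE ?expR_gt0// expRK.
rewrite -ler_ln ?posrE// lnE in A; rewrite -ler_ln ?posrE// lnE in B.
by rewrite lerBrDr lerBlDr [_ / 2 * h]mulrC [_ * _ * h]mulrC A B.
Qed.

End ProductTract.

(** * The choice of the degrees *)

Section DegreeSequence.
Variables (N0 : nat) (m : nat -> nat).
Hypothesis N0_gt0 : (0 < N0)%N.
Hypothesis m_le : forall S, (N0 <= S)%N -> (m S <= S)%N.
Hypothesis m_mono : forall S T, (N0 <= S)%N -> (S <= T)%N -> (m S <= m T)%N.
Hypothesis m_ge : forall S j, (N0 <= S)%N -> (j ^ 2 <= S)%N -> (3 * j <= m S)%N.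

Fixpoint Sseq k := if k is k'.+1 then (Sseq k' + m (Sseq k'))%N else N0.

Definition degs k := m (Sseq k).

Lemma Sseq_ge k : (N0 <= Sseq k)%N.
Proof. by elim: k => //= k IH; rewrite (leq_trans IH)// leq_addr. Qed.

Lemma Sseq_mono k : (Sseq k <= Sseq k.+1)%N.
Proof. exact: leq_addr. Qed.

(** [m_ge] says m(S) >= 3 sqrt(S) in integer form, and (k+1)^2 + 3 (k+1) >= (k+2)^2. This yields
    both k < n_k and the unboundedness of S_k. *)
Lemma Sseq_sqr k : (k.+1 ^ 2 <= Sseq k)%N.
Proof.
elim: k => [|k IH]; first by rewrite exp1n.
have := m_ge (Sseq_ge k) IH; move: IH; rewrite /= !expnS !expn0; lia.
Qed.

Lemma degs_gt k : (k < degs k)%N.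
Proof. by have := m_ge (Sseq_ge k) (Sseq_sqr k); rewrite /degs; lia. Qed.

Lemma degs_mono k : (degs k <= degs k.+1)%N.
Proof. exact: m_mono (Sseq_ge k) (Sseq_mono k). Qed.

Lemma Sseq_sum k : Sseq k.+1 = majsum degs N0 k.
Proof.
elim: k => [|k IH]; first by rewrite /majsum /degsum big_ord1.
by rewrite /majsum degsumS addnA -/(majsum _ _ _) -IH.
Qed.

Lemma degs_sum k : (degs k.+1 <= majsum degs N0 k)%N.
Proof. by rewrite -Sseq_sum; apply: m_le; exact: Sseq_ge. Qed.

Lemma Sseq_double k : (Sseq k.+1 <= 2 * Sseq k)%N.
Proof. by rewrite /= mul2n -addnn leq_add2l; apply: m_le; exact: Sseq_ge. Qed.

End DegreeSequence.

(** * Consequences of the growth condition on psi *)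

Section PsiFacts.
Variables (R : realType) (t0 L : R) (psi dpsi : R -> R).
Hypotheses (t0_gt0 : 0 < t0) (psi_gt0 : forall t, t0 <= t -> 0 < psi t).
Hypothesis psi_derive :
  forall t, t0 <= t -> is_derive_within `[t0, +oo[ psi t (dpsi t).
Hypothesis psi_growth : forall t, t0 <= t -> 1 <= t * dpsi t / psi t <= L.
Hypothesis L_lt : L < 6%:R / 5%:R.

Lemma is_derive_within_epsilon (I : set R) (u : R -> R) (t l e : R) :
  is_derive_within I u t l -> 0 < e -> exists2 d, 0 < d &
    forall s, `|s - t| < d -> s != t -> I s ->
      `|(u s - u t) / (s - t) - l| < e.
Proof.
move=> /cvgrPdist_lt H e0; have /nbhs_ballP[d /= d0 Hd] := H e e0.
exists d => // s sd st Is; rewrite distrC; apply: Hd => //.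
by rewrite /ball/= distrC.
Qed.

Lemma psi_is_derive t : t0 < t -> is_derive (t : R) 1 psi (dpsi t).
Proof.
move=> tt; apply/slope_cvg; apply/cvgrPdist_lt => e e0.
have [d d0 Hd] := is_derive_within_epsilon (psi_derive (ltW tt)) e0.
apply/nbhs_ballP; exists (Num.min d (t - t0)).
  by rewrite /= lt_min d0 subr_gt0.
move=> s; rewrite /ball/= distrC lt_min => /andP[sd st] sNt.
rewrite distrC; apply: Hd => //; rewrite /= in_itv/= andbT.
by move: st; rewrite ltr_norml => /andP[? _]; lra.
Qed.

Lemma psi_continuous : {within `[t0, +oo[, continuous psi}.
Proof.
apply/subspace_continuousP => t; rewrite /= in_itv/= andbT => tt.
apply/cvgrPdist_lt => e e0.
have [d d0 Hd] := is_derive_within_epsilon (psi_derive tt) ltr01.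
pose K := `|dpsi t| + 1; have K0 : 0 < K by rewrite ltr_wpDl.
apply/nbhs_ballP; exists (Num.min d (e / K)).
  by rewrite /= lt_min d0 divr_gt0.
move=> s; rewrite /ball/= distrC lt_min => /andP[sd se] Is.
have [->|st] := eqVneq s t; first by rewrite subrr normr0.
have st0 : s - t != 0 by rewrite subr_eq0.
have h := Hd s sd st Is.
have q : `|(psi s - psi t) / (s - t)| < K.
  have := ler_normD ((psi s - psi t) / (s - t) - dpsi t) (dpsi t).
  by rewrite subrK /K; move: h; lra.
rewrite distrC -[_ - _](divfK st0) normrM.
rewrite ltr_pdivlMr// in se.
rewrite (le_lt_trans _ se)// mulrC ler_wpM2l// ltW//.
Qed.

Lemma dpsi_gt0 t : t0 <= t -> 0 < dpsi t.
Proof.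
move=> tt; have /andP[h _] := psi_growth tt.
have t_0 := lt_le_trans t0_gt0 tt.
move: h; rewrite ler_pdivlMr ?psi_gt0// mul1r => h.
have := lt_le_trans (psi_gt0 tt) h; by rewrite pmulr_rgt0.
Qed.

Lemma psi_mono s t : t0 <= s -> s <= t -> psi s <= psi t.
Proof.
apply: (@ger0_derive1_ndecry R psi t0).
- by move=> y; rewrite in_itv/= andbT => /psi_is_derive[].
- move=> y; rewrite in_itv/= andbT => ty; have [_ yE] := psi_is_derive ty.
  by rewrite derive1E yE ltW// dpsi_gt0// ltW.
- exact: psi_continuous.
Qed.

Lemma ln_psi_is_derive t : t0 < t ->
  is_derive (t : R) 1 (fun s => ln (psi s)) ((psi t)^-1 * dpsi t).
Proof.
move=> tt; have p0 := psi_gt0 (ltW tt).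
exact: is_derive1_comp (is_derive1_ln p0) (psi_is_derive tt).
Qed.

Lemma ln_psi_combo_derive (a b t : R) : t0 < t ->
  is_derive t 1 (fun s => a * ln (psi s) - b * ln s)
    (a * ((psi t)^-1 * dpsi t) - b * t^-1).
Proof.
move=> tt; have t_0 := lt_trans t0_gt0 tt.
exact: is_deriveB (is_deriveZ a (ln_psi_is_derive tt)) (is_deriveZ b (is_derive1_ln t_0)).
Qed.

Lemma psi_slope t : t0 <= t ->
  t^-1 <= (psi t)^-1 * dpsi t /\ (psi t)^-1 * dpsi t <= L * t^-1.
Proof.
move=> tt; have t_0 := lt_le_trans t0_gt0 tt.
have /andP[h1 h2] := psi_growth tt.
rewrite ler_pdivlMl ?psi_gt0// ler_pdivrMl ?psi_gt0//.
move: h1 h2; rewrite ler_pdivlMr ?psi_gt0// mul1r ler_pdivrMr ?psi_gt0// => h1 h2.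
rewrite ler_pdivrMr// [dpsi t * t]mulrC h1; split=> //.
by rewrite mulrA ler_pdivlMr// mulrC (le_trans h2)// mulrC.
Qed.

(** The derivative of a ln psi - b ln t is (a t psi'/psi - b) / t, so the growth condition decides
    its sign; this compares powers of psi with powers of t. *)
Let combo_MVT (a b s t : R) : t0 < s -> s <= t -> exists2 c, t0 <= c &
  (a * ln (psi t) - b * ln t) - (a * ln (psi s) - b * ln s) =
  (a * ((psi c)^-1 * dpsi c) - b * c^-1) * (t - s).
Proof.
move=> ts st.
have fd y : t0 < y -> is_derive y 1 (fun s => a * ln (psi s) - b * ln s)
    (a * ((psi y)^-1 * dpsi y) - b * y^-1) by exact: ln_psi_combo_derive.
have fdi y : y \in `]s, t[ -> is_derive y 1 (fun s => a * ln (psi s) - b * ln s)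
    (a * ((psi y)^-1 * dpsi y) - b * y^-1).
  by rewrite in_itv/= => /andP[sy _]; apply: fd; exact: lt_trans ts sy.
have fcont : {within `[s, t], continuous (fun s => a * ln (psi s) - b * ln s)}.
  apply: continuous_in_subspaceT => y; rewrite inE /= in_itv/= => /andP[sy _].
  by apply: is_derive_continuous (fd y _); exact: lt_le_trans ts sy.
have [c + cE] := MVT_segment st fdi fcont.
rewrite in_itv/= => /andP[sc _]; exists c; last exact: cE.
by rewrite (le_trans (ltW ts)).
Qed.

(** The derivative at [t0] is only one-sided, so the comparison starts at an interior point. *)
Let t1 : R := t0 + 1.

Let t01 : t0 < t1.
Proof. by rewrite ltrDl. Qed.

Let t1_gt0 : 0 < t1.
Proof. exact: lt_trans t01. Qed.

Lemma psi_ge_linear : exists2 c : R, 0 < c & forall t, t1 <= t -> c * t <= psi t.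
Proof.
exists (psi t1 / t1); first by rewrite divr_gt0// psi_gt0// ltW.
move=> t tt; have [c tc cE] := combo_MVT 1 1 t01 tt.
have t_0 := lt_le_trans t1_gt0 tt.
have p1 : 0 < psi t1 by apply: psi_gt0; exact: ltW.
have pt : 0 < psi t by apply: psi_gt0; exact: le_trans (ltW t01) tt.
have : 0 <= (1 * ((psi c)^-1 * dpsi c) - 1 * c^-1) * (t - t1).
  by rewrite mulr_ge0 ?subr_ge0// !mul1r; have [] := psi_slope tc.
rewrite -cE !mul1r => h.
have q1 : 0 < psi t1 / t1 by rewrite divr_gt0.
have q2 : 0 < psi t1 / t1 * t by rewrite mulr_gt0.
have lnE : ln (psi t1 / t1 * t) = ln (psi t1) - ln t1 + ln t.
  by rewrite lnM ?posrE// ln_div ?posrE.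
by rewrite -ler_ln ?posrE// lnE; move: h; lra.
Qed.

(** Since 2 L < 3, the function 2 ln psi - 3 ln t is nonincreasing. *)
Lemma psi_sqr_le_cube :
  exists2 K : R, 0 < K & forall t, t1 <= t -> psi t ^+ 2 <= K * t ^+ 3.
Proof.
exists (psi t1 ^+ 2 / t1 ^+ 3).
  by rewrite divr_gt0 ?exprn_gt0// psi_gt0// ltW.
move=> t tt; have [c tc cE] := combo_MVT 2 3 t01 tt.
have t_0 := lt_le_trans t1_gt0 tt.
have p1 : 0 < psi t1 by apply: psi_gt0; exact: ltW.
have pt : 0 < psi t by apply: psi_gt0; exact: le_trans (ltW t01) tt.
have : (2 * ((psi c)^-1 * dpsi c) - 3 * c^-1) * (t - t1) <= 0.
  apply: mulr_le0_ge0; last by rewrite subr_ge0.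
  have [_ h] := psi_slope tc.
  have c0 : 0 < c^-1 by rewrite invr_gt0 (lt_le_trans t0_gt0).
  have L2 : L <= 3 / 2 by move: L_lt; lra.
  have Lc : L * c^-1 <= 3 / 2 * c^-1 by rewrite ler_wpM2r// ltW.
  by move: (le_trans h Lc); move: (_ * dpsi c) (c^-1) => q i hq; lra.
rewrite -cE => h.
have e1 : 0 < psi t1 ^+ 2 by rewrite exprn_gt0.
have e2 : 0 < t1 ^+ 3 by rewrite exprn_gt0.
have e3 : 0 < t ^+ 3 by rewrite exprn_gt0.
have e4 : 0 < psi t ^+ 2 by rewrite exprn_gt0.
have q1 : 0 < psi t1 ^+ 2 / t1 ^+ 3 by rewrite divr_gt0.
have q2 : 0 < psi t1 ^+ 2 / t1 ^+ 3 * t ^+ 3 by rewrite mulr_gt0.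
have lnE : ln (psi t1 ^+ 2 / t1 ^+ 3 * t ^+ 3) =
    2 * ln (psi t1) - 3 * ln t1 + 3 * ln t.
  by rewrite lnM ?posrE// ln_div ?posrE// !lnXn// !mulr_natl.
by rewrite -ler_ln ?posrE// lnE lnXn// -mulr_natl; move: h; lra.
Qed.

End PsiFacts.

(** * Bounding the integral of 1/psi by a series *)

Section Divergence.
Variables (R : realType) (t0 : R) (psi : R -> R) (b e : nat -> R) (V : R).
Hypothesis psi_gt0 : forall t, t0 <= t -> 0 < psi t.
Hypothesis psi_mono : forall s t, t0 <= s -> s <= t -> psi s <= psi t.
Hypothesis psi_cont : {within `[t0, +oo[, continuous psi}.
Hypothesis b0 : b 0%N = t0.
Hypothesis b_mono : forall k, b k <= b k.+1.
Hypothesis b_unbounded : forall t, exists k, t < b k.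
Hypothesis b_gap : forall k, (b k.+1 - b k) / psi (b k) <= e k.
Hypothesis e_sum : forall k, \sum_(j < k) e j <= V.

Let b_le i j : (i <= j)%N -> b i <= b j.
Proof. by move=> /subnKC <-; elim: (j - i)%N => [|d IH]; rewrite ?addn0// addnS (le_trans IH). Qed.

Let E k : set R := `[b k, b k.+1[%classic.

Let E_cover : \bigcup_k E k = `[t0, +oo[%classic.
Proof.
apply/seteqP; split=> [t [k _]|t]; rewrite /E /= !in_itv/= ?andbT.
  by move=> /andP[bt _]; rewrite (le_trans _ bt)// -b0 b_le.
move=> tt; have ex := b_unbounded t.
case: (ex_minnP ex) => -[|k] bk minb; first by move: bk; rewrite b0 ltNge tt.
exists k => //; rewrite /= in_itv/= bk andbT leNgt; apply/negP => /minb.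
by rewrite ltnn.
Qed.

Let E_triv : trivIset setT E.
Proof.
apply/trivIsetP => i j _ _; wlog ij : i j / (i < j)%N.
  move=> W; rewrite neq_ltn => /orP[ij|ji]; first by apply: W; rewrite // ltn_eqF.
  by rewrite setIC; apply: W; rewrite // ltn_eqF.
move=> _; apply/seteqP; split=> // t []; rewrite /E /= !in_itv/= => /andP[_ t1] /andP[t2 _].
by have := lt_le_trans t1 (le_trans (b_le ij) t2); rewrite ltxx.
Qed.

Let F t : \bar R := ((psi t)^-1)%:E.

Let F_meas : measurable_fun `[t0, +oo[ (EFin \o (fun t : R => (psi t)^-1)).
Proof.
apply/measurable_EFinP; apply: subspace_continuous_measurable_fun => //.
apply/subspace_continuousP => t tt.
have /subspace_continuousP/(_ t tt) h := psi_cont.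
apply: cvgV h; rewrite gt_eqF// psi_gt0//.
by move: tt; rewrite /= in_itv/= andbT.
Qed.

Let b_ge k : t0 <= b k.
Proof. by rewrite -b0 b_le. Qed.

(** Cut the half-line at the points b_k; on each piece 1/psi is at most its value at the left end,
    so the piece contributes at most e_k. *)
Lemma integral_inv_finite : (\int[lebesgue_measure]_(t in `[t0, +oo[) F t < +oo)%E.
Proof.
have -> : (\int[lebesgue_measure]_(t in `[t0, +oo[) F t =
    \big[+%E/0]_(0 <= k <oo) \int[lebesgue_measure]_(t in E k) F t)%E.
  rewrite -[in LHS]E_cover; apply: ge0_integral_bigcup.
  - by move=> k; exact: measurable_itv.
  - by rewrite E_cover; exact: F_meas.
  - move=> t; rewrite E_cover /= in_itv/= andbT => tt.
    by rewrite lee_fin invr_ge0 ltW// psi_gt0.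
  - exact: E_triv.
have piece k : (\int[lebesgue_measure]_(t in E k) F t <= (e k)%:E)%E.
  have mE : measurable (E k) by exact: measurable_itv.
  have sub : E k `<=` `[t0, +oo[%classic.
    by rewrite -E_cover; exact: bigcup_sup.
  apply: (@le_trans _ _ (\int[lebesgue_measure]_(t in E k) (cst ((psi (b k))^-1)%:E t))%E).
    apply: ge0_le_integral => //.
    - move=> t /sub /=; rewrite in_itv/= andbT => tt.
      by rewrite lee_fin invr_ge0 ltW// psi_gt0.
    - exact: measurable_funS F_meas.
    - move=> t Et; have := sub t Et; move: Et; rewrite /= !in_itv/= andbT => /andP[bt _] tt.
      by rewrite lee_fin lef_pV2 ?posrE ?psi_gt0// psi_mono.
  have -> := integral_cst lebesgue_measure mE ((psi (b k))^-1)%:E.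
  have := @lebesgue_measure_itv R `[b k, b k.+1[; rewrite /= lte_fin => muE.
  rewrite [X in (_ * X)%E]muE; case: ifP => bb.
    by rewrite -EFinD -EFinM lee_fin mulrC.
  rewrite mule0 lee_fin (le_trans _ (b_gap k))// divr_ge0 ?subr_ge0//.
  by rewrite ltW// psi_gt0.
apply: (@le_lt_trans _ _ V%:E); last exact: ltry.
apply: lime_le.
  apply: is_cvg_nneseries => k _ _; apply: integral_ge0 => t Et.
  rewrite lee_fin invr_ge0 ltW// psi_gt0//.
  by move: Et; rewrite /E /= in_itv/= => /andP[bt _]; exact: le_trans bt.
apply: nearW => k; apply: (@le_trans _ _ (\sum_(0 <= j < k) (e j)%:E)%E).
  by apply: lee_sum => j _; exact: piece.
by rewrite sumEFin lee_fin big_mkord.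
Qed.

End Divergence.

(** * Degrees adapted to psi *)

Section DegreesFromPsi.
Variables (R : realType) (t0 t1 c K : R) (psi : R -> R) (N0 : nat).
Hypothesis t01 : t0 <= t1.
Hypothesis psi_gt0 : forall t, t0 <= t -> 0 < psi t.
Hypothesis psi_mono : forall s t, t0 <= s -> s <= t -> psi s <= psi t.
Hypothesis c_gt0 : 0 < c.
Hypothesis psi_linear : forall t, t1 <= t -> c * t <= psi t.
Hypothesis psi_cube : forall t, t1 <= t -> psi t ^+ 2 <= K * t ^+ 3.

(* The summand [12] makes a degree exceed [12 * Num.sqrt (psi _)], where [12] is the
   constant of [pfun_near_zero]; the other one gives [3 * Num.sqrt S <= target S]. *)
Definition psi_scale := 12 + 3 / Num.sqrt c.

Hypothesis N0_gt1 : (1 < N0)%N.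
Hypothesis N0_ge : t1 <= 8 * N0%:R.
Hypothesis N0_large : 8192 * psi_scale ^+ 4 * K <= N0%:R.

Definition target (S : nat) : R := psi_scale * Num.sqrt (psi (8 * S%:R)).

(** The successor makes the degree strictly larger than the target, which produces the strict
    inequality for the distance to the zeros. *)
Definition psi_degree (S : nat) : nat := (Num.trunc (target S)).+1.

Let scale_ge : 12 <= psi_scale.
Proof. by rewrite /psi_scale lerDl divr_ge0// sqrtr_ge0. Qed.

Let scale_gt0 : 0 < psi_scale.
Proof. by apply: lt_le_trans scale_ge. Qed.

Let scale_sqr : 9 <= psi_scale ^+ 2 * c.
Proof.
have s0 : 0 < Num.sqrt c by rewrite sqrtr_gt0.
rewrite -[X in _ * X](sqr_sqrtr (ltW c_gt0)) -exprMn.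
have -> : (9 : R) = 3 ^+ 2 by rewrite -natrX.
rewrite ler_sqr ?nnegrE ?mulr_ge0// ?(ltW s0)// ?(ltW scale_gt0)//.
by rewrite /psi_scale mulrDl divfK ?gt_eqF// lerDr mulr_ge0// ltW.
Qed.

Let arg_ge S : (N0 <= S)%N -> t1 <= 8 * S%:R.
Proof. by move=> NS; rewrite (le_trans N0_ge)// ler_wpM2l// ler_nat. Qed.

Let arg_ge0 S : (N0 <= S)%N -> t0 <= 8 * S%:R.
Proof. by move=> /arg_ge; exact: le_trans. Qed.

Lemma target_sqr S : (N0 <= S)%N -> target S ^+ 2 = psi_scale ^+ 2 * psi (8 * S%:R).
Proof. by move=> /arg_ge0/psi_gt0/ltW h; rewrite exprMn sqr_sqrtr. Qed.

Let target_ge0 S : 0 <= target S.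
Proof. by rewrite mulr_ge0 ?sqrtr_ge0// ltW. Qed.

Lemma target_sqr_ge S : (N0 <= S)%N -> 72 * S%:R <= target S ^+ 2.
Proof.
move=> NS; rewrite target_sqr//.
apply: (@le_trans _ _ (psi_scale ^+ 2 * (c * (8 * S%:R)))).
  rewrite [leRHS]mulrA; apply: (@le_trans _ _ (9 * (8 * S%:R))); first by rewrite mulrA; lra.
  by rewrite ler_wpM2r// mulr_ge0.
by rewrite ler_wpM2l ?sqr_ge0// psi_linear// arg_ge.
Qed.

(** Compare fourth powers: target^4 <= [psi_scale]^4 K 8^3 S^3, against S^4 / 2^4. Hence the
    constant 8192 = 8^3 * 2^4 in [N0_large]. The slack S / 2 absorbs the rounding in [degree_le]. *)
Lemma target_le S : (N0 <= S)%N -> target S <= S%:R / 2.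
Proof.
move=> NS; have S0 : 0 <= S%:R :> R by [].
rewrite -(@ler_pXn2r _ 4)// ?nnegrE ?divr_ge0//.
rewrite (exprM _ 2 2) target_sqr// exprMn -exprM.
apply: (@le_trans _ _ (psi_scale ^+ 4 * (K * (8 * S%:R) ^+ 3))).
  by rewrite ler_wpM2l ?exprn_ge0 ?psi_cube ?arg_ge// ltW.
have : 8192 * psi_scale ^+ 4 * K * S%:R ^+ 3 <= S%:R * S%:R ^+ 3.
  rewrite ler_wpM2r ?exprn_ge0// (le_trans N0_large)// ler_nat//.
rewrite !exprMn -exprS exprVn.
have -> : 8 ^+ 3 = 512 :> R by rewrite -natrX.
have -> : 2 ^+ 4 = 16 :> R by rewrite -natrX.
by move: (_ ^+ 4) (_ ^+ 3) (_ ^+ 4) => x y w; rewrite mulrA; lra.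
Qed.

Lemma target_lt_degree S : target S < (psi_degree S)%:R.
Proof. by have /andP[] := Num.Theory.truncn_itv (target_ge0 S). Qed.

Lemma degree_leD1 S : (psi_degree S)%:R <= target S + 1.
Proof.
have /andP[h _] := Num.Theory.truncn_itv (target_ge0 S).
by rewrite /psi_degree -natr1 lerD2r.
Qed.

Lemma degree_le S : (N0 <= S)%N -> (psi_degree S <= S)%N.
Proof.
move=> NS; rewrite -(ler_nat R) (le_trans (degree_leD1 S))//.
have h := target_le NS.
have : 2 <= S%:R :> R by rewrite ler_nat (leq_trans N0_gt1).
by move: h; move: (target S) => u; lra.
Qed.

Lemma degree_mono S T : (N0 <= S)%N -> (S <= T)%N -> (psi_degree S <= psi_degree T)%N.
Proof.
move=> NS ST; rewrite ltnS; apply: Num.Theory.le_truncn.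
rewrite ler_wpM2l ?(ltW scale_gt0)// ler_wsqrtr// psi_mono ?arg_ge0//.
by rewrite ler_wpM2l// ler_nat.
Qed.

Lemma degree_ge S j : (N0 <= S)%N -> (j ^ 2 <= S)%N -> (3 * j <= psi_degree S)%N.
Proof.
move=> NS jS; rewrite -(ler_nat R) (le_trans _ (ltW (target_lt_degree S)))//.
rewrite -ler_sqr ?nnegrE// (le_trans _ (target_sqr_ge NS))//.
rewrite natrM exprMn -!natrX.
apply: (@le_trans _ _ (9 * S%:R)); first by rewrite ler_wpM2l// ler_nat.
by rewrite ler_wpM2r// ler_nat.
Qed.

(** The target is at least 1, so rounding up at most doubles it. *)
Lemma degree_sqr_le S : (N0 <= S)%N ->
  (psi_degree S)%:R ^+ 2 <= 4 * psi_scale ^+ 2 * psi (8 * S%:R).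
Proof.
move=> NS; have h1 : 1 <= target S.
  rewrite -ler_sqr ?nnegrE// expr1n (le_trans _ (target_sqr_ge NS))//.
  rewrite -natrM ler1n muln_gt0/=; exact: leq_trans (ltnW N0_gt1) NS.
rewrite -mulrA -target_sqr//.
have -> : 4 = 2 ^+ 2 :> R by rewrite -natrX.
have u0 := target_ge0 S; rewrite -exprMn ler_sqr ?nnegrE//; last by rewrite mulr_ge0.
by move: (degree_leD1 S) h1; move: (target S) => u; lra.
Qed.

Lemma sqrt_psi_lt_degree S : (N0 <= S)%N ->
  12 * Num.sqrt (psi (8 * S%:R)) < (psi_degree S)%:R.
Proof.
move=> NS; apply: le_lt_trans (target_lt_degree S).
by rewrite ler_wpM2r// sqrtr_ge0.
Qed.

Let n := degs N0 psi_degree.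

Let N0_gt0 : (0 < N0)%N. Proof. exact: ltnW. Qed.

Lemma degrees_gt k : (k < n k)%N.
Proof. exact: degs_gt N0_gt0 degree_ge k. Qed.

Lemma degrees_mono k : (n k <= n k.+1)%N.
Proof. exact: degs_mono degree_mono k. Qed.

Lemma degrees_sum k : (n k.+1 <= majsum n N0 k)%N.
Proof. exact: degs_sum degree_le k. Qed.

(** S_(k+2) <= 4 S_k by doubling twice. Together with the factor 2 in the upper bound for the growth
    slope it accounts for the argument 8 S of psi in [target]. *)
Lemma majsum_degrees k : (majsum n N0 k.+1 <= 4 * Sseq N0 psi_degree k)%N.
Proof.
rewrite -Sseq_sum (leq_trans (Sseq_double degree_le k.+1))//.
by rewrite -[4%N]/(2 * 2)%N -mulnA leq_mul2l/= (Sseq_double degree_le).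
Qed.

Hypothesis psi_cont : {within `[t0, +oo[, continuous psi}.
Hypothesis psi_int : (\int[lebesgue_measure]_(t in `[t0, +oo[) ((psi t)^-1)%:E = +oo)%E.

(* [n_k^2] is comparable to [psi (8 S_k)], so [8 n_k / psi (8 S_k)], which dominates
   the integral of [1 / psi] over [8 S_k, 8 S_(k+1)], is comparable to [1 / n_k]. *)
Lemma degrees_div (M : R) : exists k, M <= \sum_(j < k) (n j)%:R^-1.
Proof.
apply: contrapT => H.
have {}H k : \sum_(j < k) (n j)%:R^-1 <= M.
  by rewrite leNgt; apply/negP => h; apply: H; exists k; exact: ltW.
pose S := Sseq N0 psi_degree.
(* The indices are shifted by one to insert the initial piece from t0 to 8 S_0. On the later pieces
   8 n_k / psi (8 S_k) <= 32 [psi_scale]^2 / n_k by [degree_sqr_le]. *)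
pose b k := if k is k'.+1 then 8 * (S k')%:R else t0.
pose e k := if k is k'.+1 then 32 * psi_scale ^+ 2 * (n k')%:R^-1
            else (b 1%N - t0) / psi t0.
have NS k : (N0 <= S k)%N by exact: Sseq_ge.
have := @integral_inv_finite R t0 psi b e (e 0%N + 32 * psi_scale ^+ 2 * M)
  psi_gt0 psi_mono psi_cont.
rewrite psi_int ltxx => h; suff: false by []; apply: h => //.
- case=> [|k]; first by rewrite /b arg_ge0.
  by rewrite /b ler_wpM2l// ler_nat; exact: Sseq_mono.
- move=> t; exists (Num.trunc `|t|).+2; rewrite /b (le_lt_trans (ler_norm t))//.
  have /andP[_ h1] := Num.Theory.truncn_itv (normr_ge0 t).
  rewrite (lt_le_trans h1)//.
  apply: (@le_trans _ _ (S (Num.trunc `|t|).+1)%:R).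
    rewrite ler_nat.
    have := Sseq_sqr N0_gt0 degree_ge (Num.trunc `|t|).+1; rewrite -/(S _).
    by apply: leq_trans; rewrite -mulnn (leq_trans (leqnSn _))// leq_pmulr.
  by rewrite ler_peMl// ler1n.
- case=> [|k]; first by [].
  have n0 : 0 < (n k)%:R :> R by rewrite ltr0n (leq_ltn_trans _ (degrees_gt k)).
  have p0 : 0 < psi (8 * (S k)%:R) by rewrite psi_gt0// arg_ge0.
  rewrite /b /e -mulrBr -natrB ?Sseq_mono//.
  have -> : (S k.+1 - S k = n k)%N by rewrite /S /= addKn.
  rewrite ler_pdivrMr// mulrAC ler_pdivlMr//.
  by have := degree_sqr_le (NS k); rewrite -/(n k) expr2 => h2; lra.
- case=> [|k].
    rewrite big_ord0 addr_ge0//.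
      rewrite /e divr_ge0// ?(ltW (psi_gt0 _))// subr_ge0 /b.
      by rewrite arg_ge0.
    by apply: mulr_ge0; [rewrite mulr_ge0 ?sqr_ge0|have := H 0%N; rewrite big_ord0].
  by rewrite big_ord_recl lerD2l /e -mulr_sumr ler_wpM2l// mulr_ge0 ?sqr_ge0.
Qed.

End DegreesFromPsi.

(** * The zeros of the product *)

Section Construction.
Variables (R : realType) (t0 : R) (psi : R -> R) (n : nat -> nat) (n0 : nat) (S : nat -> nat).
Hypothesis psi_gt0 : forall t, t0 <= t -> 0 < psi t.
Hypothesis psi_mono : forall s t, t0 <= s -> s <= t -> psi s <= psi t.
Hypothesis n_gt : forall k, (k < n k)%N.
Hypothesis n_mono : forall k, (n k <= n k.+1)%N.
Hypothesis n_div : forall M : R, exists k, M <= \sum_(j < k) (n j)%:R^-1.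
Hypothesis n_sum : forall k, (n k.+1 <= majsum n n0 k)%N.
Hypothesis S_ge : forall k, (majsum n n0 k.+1 <= 4 * S k)%N.
Hypothesis n_psi : forall k, 12 * Num.sqrt (psi (8 * (S k)%:R)) < (n k)%:R.

Lemma degsum_ge k : (k < degsum n k)%N.
Proof.
rewrite /degsum big_ord_recr/=; apply: leq_trans (n_gt k) _; exact: leq_addl.
Qed.

Lemma xlog_bracket k1 t : xlog R n k1 <= t ->
  exists k, [/\ (k1 <= k)%N, xlog R n k <= t & t < xlog R n k.+1].
Proof.
move=> h1; have [k0 H] := x_eventually n_div (t + 1).
have ex : exists k, t < xlog R n (k1 + k)%N.
  by exists k0; have := H (k1 + k0)%N (leq_addl _ _); lra.
case: (ex_minnP ex) => -[|k] tk mink; first by move: tk; rewrite addn0 ltNge h1.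
exists (k1 + k)%N; rewrite leq_addr -addnS; split=> //.
by rewrite leNgt; apply/negP => /mink; rewrite ltnn.
Qed.

Lemma zeros_near rho D : direct_tract (@pfun R n) rho D ->
  \forall r \near +oo, forall z : Cplane R, cmod z = r ->
    exists2 w : Cplane R, pfun n w = 0 &
      cmod (w - z) < r / Num.sqrt (psi (growth_slope r (pfun n) D)).
Proof.
move=> /(direct_tract_ray n_gt n_mono n_div)[X DX].
(* For k >= k1 the degree sum exceeds k, so half of it is at least [t0]; the slope then lies where
   psi is positive and monotone. *)
pose k1 := (Num.trunc `|t0|).*2.+1.
near=> r => z zr.
have r0 : 0 < r by near: r; exact: nbhs_pinfty_gt.
have Xr : X <= ln r.
  have h : expR X <= r by near: r; exact: nbhs_pinfty_ge.
  by rewrite -[X]expRK ler_ln ?posrE ?expR_gt0.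
have kr : xlog R n k1 <= ln r.
  have h : expR (xlog R n k1) <= r by near: r; exact: nbhs_pinfty_ge.
  by rewrite -[xlog R n k1]expRK ler_ln ?posrE ?expR_gt0.
have [k [k1k xk xk1]] := xlog_bracket kr.
have := growth_slope_bounds n_gt n_mono n_div n_sum DX Xr xk xk1.
rewrite lnK ?posrE//; move: (growth_slope _ _ _) => a /andP[a1 a2].
have z0 : 0 < cmod z by rewrite zr.
have [||w [fw _ wz]] := pfun_near_zero n_gt n_mono n_div z0 (k := k).
- by rewrite zr.
- by rewrite zr ltW.
exists w => //; apply: le_lt_trans wz _; rewrite zr mulrC ltr_pM2l//.
have ta : t0 <= a.
  apply: le_trans a1; rewrite ler_pdivlMr//.
  have /andP[_ h1] := Num.Theory.truncn_itv (normr_ge0 t0).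
  apply: (@le_trans _ _ ((Num.trunc `|t0|).+1%:R * 2)).
    by rewrite ler_wpM2r// (le_trans (ler_norm t0))// ltW.
  rewrite -natrM ler_nat muln2 doubleS; exact: leq_ltn_trans k1k (degsum_ge k).
have aS : a <= 8 * (S k)%:R.
  apply: (le_trans a2); rewrite -!natrM ler_nat.
  by rewrite -[8%N]/(2 * 4)%N -mulnA leq_mul2l/= S_ge.
have pa : 0 < psi a by exact: psi_gt0.
have pS : 0 < psi (8 * (S k)%:R) by apply: psi_gt0; exact: le_trans aS.
have nk0 : 0 < (n k)%:R :> R by rewrite ltr0n (leq_ltn_trans _ (n_gt k)).
rewrite ltr_pdivrMr// mulrC ltr_pdivlMr ?sqrtr_gt0//.
apply: le_lt_trans (n_psi k); rewrite ler_wpM2l// ler_wsqrtr//.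
exact: psi_mono.
Unshelve. all: by end_near.
Qed.

End Construction.

Theorem theorem1p2 (R : realType) (t0 L : R) (psi dpsi : R -> R)
  (t0_gt0 : 0 < t0)
  (psi_gt0 : forall t, t0 <= t -> 0 < psi t)
  (psi_derive : forall t, t0 <= t -> is_derive_within `[t0, +oo[ psi t (dpsi t))
  (psi_int : (\int[lebesgue_measure]_(t in `[t0, +oo[) ((psi t)^-1)%:E = +oo)%E)
  (L_gt1 : 1 < L) (L_lt : L < 6%:R / 5%:R)
  (psi_growth : forall t, t0 <= t -> 1 <= t * dpsi t / psi t <= L) :
  exists f : Cplane R -> Cplane R,
    [/\ entire f,
        has_exactly_one_direct_tract f &
        forall (rho : R) (D : set (Cplane R)), direct_tract f rho D ->
          \forall r \near +oo, forall z : Cplane R, cmod z = r ->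
            exists2 w : Cplane R, f w = 0 &
              cmod (w - z) < r / Num.sqrt (psi (growth_slope r f D))].
Proof.
have [c c0 psi_lin] := psi_ge_linear t0_gt0 psi_gt0 psi_derive psi_growth.
have [K K0 psi_cub] := psi_sqr_le_cube t0_gt0 psi_gt0 psi_derive psi_growth L_lt.
have mono := psi_mono t0_gt0 psi_gt0 psi_derive psi_growth.
have cont := psi_continuous psi_derive.
have t01 : t0 <= t0 + 1 by rewrite lerDl.
(* [B] dominates both lower bounds required of [N0]; adding 2 to its integer part also secures
   [1 < N0]. *)
pose B := `|t0 + 1| + `|8192 * psi_scale c ^+ 4 * K|.
pose N0 := (Num.trunc B).+2.
have B0 : 0 <= B by rewrite addr_ge0.
have BN : B <= N0%:R.
  have /andP[_ h] := Num.Theory.truncn_itv B0.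
  by rewrite (le_trans (ltW h))// ler_nat.
have N1 : (1 < N0)%N by [].
have N2 : t0 + 1 <= 8 * N0%:R.
  rewrite (le_trans (ler_norm _))//.
  apply: (@le_trans _ _ N0%:R); last by rewrite ler_peMl// ler1n.
  by apply: le_trans BN; rewrite lerDl.
have N3 : 8192 * psi_scale c ^+ 4 * K <= N0%:R.
  rewrite (le_trans (ler_norm _))//; apply: le_trans BN; by rewrite lerDr.
have n_gt := degrees_gt t01 psi_gt0 c0 psi_lin N1 N2.
have n_mono := degrees_mono c t01 mono N2.
have n_sum := degrees_sum t01 psi_gt0 psi_cub N1 N2 N3.
have n_div := degrees_div t01 psi_gt0 mono c0 psi_lin N1 N2 cont psi_int.
have n_maj := majsum_degrees t01 psi_gt0 psi_cub N1 N2 N3.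
exists (pfun (degs N0 (psi_degree c psi))); split.
- by move=> z; apply: derivable_ev; exact: entire_seq_aseq.
- exact: has_one_tract.
- move=> rho D; apply: (zeros_near psi_gt0 mono n_gt n_mono n_div n_sum n_maj).
  by move=> k; apply: sqrt_psi_lt_degree; exact: Sseq_ge.
Qed.
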